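(* Let $n\ge 3$ be an integer, let $r>1$ and $0\le\theta<2\pi/n$ be real numbers, and let $\mathcal{D}\subset\mathbb{H}^3$ be a hyperbolic $n$-drum determined by the parameters $r$ and $\theta$. Put $\alpha=2\pi/n$ and $$z_2=\frac{e^{i\alpha}-re^{i\theta}}{e^{i\alpha}-1},\qquad z_3=\frac{re^{i(\alpha+\theta)}-e^{i\alpha}}{re^{i\theta}-e^{i\alpha}},$$ and for $k\in\{2,3\}$ put $$\operatorname{Vol}(\tau_k)=\operatorname{Im}\left(\operatorname{Li}_2(z_k)\right)+\ln|z_k|\,\arg(1-z_k).$$ Then the hyperbolic volume of $\mathcal{D}$ is $$\operatorname{Vol}(\mathcal{D})=n\left(\operatorname{Vol}(\tau_2)+\operatorname{Vol}(\tau_3)\right).$$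
   Context: Use the upper half-space model $\mathbb{H}^3=\{z+tj : z\in\mathbb{C},\ t>0\}$, with ideal boundary $\partial\mathbb{H}^3=\widehat{\mathbb{C}}=\mathbb{C}\cup\{\infty\}$. An $n$-drum ($n\ge 3$) is defined as follows. Let $\mathcal{P}$ be a totally geodesic regular ideal $n$-gon in $\mathbb{H}^3$. There is an elliptic isometry $\sigma$ that rotates through angle $2\pi/n$ about a geodesic axis and restricts to a rotational symmetry of $\mathcal{P}$. Let $\varphi$ be a loxodromic isometry with this same axis, with non-trivial translation length and a (possibly trivial) rotation angle. The convex hull of $\mathcal{P}\cup\varphi(\mathcal{P})$ in $\mathbb{H}^3$ is called an $n$-drum. After applying an isometry one may assume that the axis is the geodesic from $0$ to $\infty$, that the ideal vertices of $\mathcal{P}$ are $e^{2k\pi i/n}$ for $k=0,1,\dots,n-1$, and that $\varphi$ acts on $\widehat{\mathbb{C}}$ as multiplication by $re^{i\theta}$ with $r>1$ real and $0\le\theta<2\pi/n$. The drum is then said to be determined by the parameters $r$ and $\theta$. Equivalently, up to isometry, it is the convex hull in $\mathbb{H}^3$ of the $2n$ ideal points $e^{2k\pi i/n}$ and $re^{i\theta}e^{2k\pi i/n}$, $0\le k\le n-1$. $\operatorname{Li}_2$ is the dilogarithm function, $\operatorname{Li}_2(z)=\sum_{m=1}^\infty z^m/m^2$ for $|z|\le 1$, extended by principal-branch analytic continuation to $\mathbb{C}\setminus[1,\infty)$; $\arg$ is the principal argument, with values in $(-\pi,\pi]$. With $a=e^{i\alpha}$, $b=re^{i\theta}$, $c=ab$,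 the symbols $\tau_2=[1,a,b,\infty]$ and $\tau_3=[a,b,c,\infty]$ denote ideal tetrahedra listed by their ideal vertices, and $z_2=\frac{b-a}{1-a}$, $z_3=\frac{c-a}{b-a}$ are their edge parameters along the common edge from $a$ to $\infty$. The number $\operatorname{Vol}(\tau_k)$ is the (oriented) volume given by the displayed formula in terms of $z_k$. *)

(* Defs.v *)
From mathcomp Require Import all_boot all_order all_algebra.
From mathcomp Require Import complex.
From mathcomp Require Import all_classical all_reals all_analysis.
Import Order.TTheory GRing.Theory Num.Theory numFieldNormedType.Exports.

Set Implicit Arguments.
Unset Strict Implicit.
Unset Printing Implicit Defensive.

Local Open Scope classical_set_scope.
Local Open Scope ring_scope.
Local Open Scope complex_scope.

Definition modulus {R : realType} (z : R[i]) : R := Normc.normc z.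

Definition expi {R : realType} (x : R) : R[i] := cos x +i* sin x.

(* The principal argument, in ]-pi, pi]; it is only meaningful for z != 0. *)
Definition carg {R : realType} (z : R[i]) : R :=
  if 0 <= complex.Im z then acos (complex.Re z / modulus z)
  else - acos (complex.Re z / modulus z).

Definition analytic_at {R : realType} (f : R[i] -> R[i]) (z0 : R[i]) : Prop :=
  exists (c : nat -> R[i]) (rho : R), 0 < rho /\
    forall z, modulus (z - z0) < rho ->
      series (fun m => c m * (z - z0) ^+ m) @ \oo --> (f z : R[i]^o).

(* C \ [1, +oo[ *)
Definition slit_plane {R : realType} : set R[i] :=
  [set z | ~ (complex.Im z = 0 /\ 1 <= complex.Re z)].

(* f is the principal branch of Li_2: it is given by the dilogarithm series on
   the closed unit disc and continues it analytically to the slit plane. As the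
   slit plane is connected, this determines f on the slit plane and at 1; the
   values of f on ]1, +oo[ are left free. *)
Definition is_dilogarithm {R : realType} (f : R[i] -> R[i]) : Prop :=
  (forall z, modulus z <= 1 ->
     series (fun m => z ^+ m.+1 / m.+1%:R ^+ 2) @ \oo --> (f z : R[i]^o)) /\
  (forall z0, slit_plane z0 -> analytic_at f z0).

(* The point hz + ht j of the upper half-space. *)
Record hspace (R : realType) := HPoint { hz : R[i]; ht : R; ht_gt0 : 0 < ht }.

Definition arcosh {R : realType} (x : R) : R := ln (x + Num.sqrt (x ^+ 2 - 1)).

Definition hdist {R : realType} (p q : hspace R) : R :=
  arcosh (1 + (modulus (hz p - hz q) ^+ 2 + (ht p - ht q) ^+ 2)
              / (2 * ht p * ht q)).

Definition hisometry {R : realType} (f : hspace R -> hspace R) : Prop :=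
  bijective f /\ forall p q, hdist (f p) (f q) = hdist p q.

Definition hsegment {R : realType} (p q : hspace R) : set (hspace R) :=
  [set x | hdist p x + hdist x q = hdist p q].

Definition hconvex {R : realType} (A : set (hspace R)) : Prop :=
  forall p q, A p -> A q -> hsegment p q `<=` A.

Definition hhull {R : realType} (A : set (hspace R)) : set (hspace R) :=
  \bigcap_(B in [set B | hconvex B /\ A `<=` B]) B.

(* The complete geodesic with distinct finite ideal endpoints v and w: the
   semicircle with diameter [v, w] orthogonal to the boundary. *)
Definition ideal_line {R : realType} (v w : R[i]) : set (hspace R) :=
  [set p | exists s : R, [/\ 0 < s < 1, hz p = v + s%:C * (w - v) &
             ht p ^+ 2 = s * (1 - s) * modulus (w - v) ^+ 2]].

(* The convex hull of a set of (finite) ideal points: the least convex set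
   containing all the geodesics that join two of them. *)
Definition ideal_hull {R : realType} (V : set R[i]) : set (hspace R) :=
  hhull [set p | exists v w, [/\ V v, V w, v <> w & ideal_line v w p]].

(* The regular ideal n-gon in normal position, in the plane |z|^2 + t^2 = 1. *)
Definition std_ideal_ngon {R : realType} (n : nat) : set (hspace R) :=
  ideal_hull [set v | exists2 k, (k < n)%N & v = expi (2 * k%:R * pi / n%:R)].

(* D is the convex hull of P and phi(P), for a regular ideal n-gon P and a
   loxodromic isometry phi, such that some isometry g moves P to the normal
   position and conjugates phi to the isometry with axis from 0 to infinity
   that acts on the ideal boundary as the multiplication by r e^(i theta). The
   rotation by 2 pi / n about the axis is then a symmetry of P. *)
Definition is_drum {R : realType} (n : nat) (r theta : R)
    (D : set (hspace R)) : Prop :=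
  exists (P : set (hspace R)) (phi g : hspace R -> hspace R),
    [/\ hisometry phi, hisometry g,
        g @` P = std_ideal_ngon n,
        (forall p, hz (g (phi p)) = r%:C * expi theta * hz (g p) /\
                   ht (g (phi p)) = r * ht (g p)) &
        D = hhull (P `|` phi @` P)].

Definition hcoords {R : realType} (p : hspace R) : R * R * R :=
  (complex.Re (hz p), complex.Im (hz p), ht p).

(* The hyperbolic volume element is dx dy dt / t^3. *)
Definition hvolume {R : realType} (D : set (hspace R)) : \bar R :=
  (\int[(@lebesgue_measure R \x @lebesgue_measure R) \x @lebesgue_measure R]_(x
      in hcoords @` D) (x.2 ^- 3)%:E)%E.

(* The oriented volume of the ideal tetrahedron with edge parameter z. *)
Definition tetra_volume {R : realType} (Li2 : R[i] -> R[i]) (z : R[i]) : R :=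
  complex.Im (Li2 z) + ln (modulus z) * carg (1 - z).

(* Main.v *)
(* In the coordinates (z, w) with w = |z|^2 + t^2, hyperbolic segments become
   straight segments, so a drum in normal position becomes a region that is
   explicit at each height w between 1 and r^2: the convex hull of 2n points
   sliding linearly from the vertices of one polygon to those of the other. It
   splits into 2n wedges over its lateral faces, with apex on the axis, of only
   two shapes up to rotation. After the scalings x = ut, y = vt, the volume of a
   wedge is a double integral whose inner one is elementary; each of the two
   shapes contributes half of the integral over 0 < u < 1 of
     (Im Z / (2 |u - Z|^2)) ln ((u |1 - Z|^2 + (1 - u) |Z|^2) / (u (1 - u)))
   summed over Z = z2 and Z = 1 / (1 - z3).
   Write D(t) = Im Li2(tz) + ln |tz| arg(1 - tz). The dilogarithm series gives the
   differential equation |1 - tz|^2 (t (Im Li2(tz))')' = Im z near t = 0, hence on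
   the whole ray by analyticity, and so D'(t) = - Im z ln |tz| / |1 - tz|^2. For
   Z = 1 / z the integrand above is then the derivative of (D(u') - D(u)) / 2,
   where u |-> u' is an involution of [0, 1] exchanging 0 and 1, and the integral
   is - D(1). The relations D(1 / z) = D(1 - z) = - D(z) at t = 1 come from the
   same two derivatives. *)

Require Import Defs.
From HB Require Import structures.
From mathcomp Require Import all_boot all_order all_algebra.
From mathcomp Require Import complex.
From mathcomp Require Import all_classical all_reals all_analysis.
From mathcomp Require Import measurable_realfun zify ring lra.
Import Order.TTheory GRing.Theory Num.Theory numFieldNormedType.Exports.

Local Open Scope classical_set_scope.
Local Open Scope ring_scope.
Local Open Scope complex_scope.

(** * Integration against dt / t and dx dy dt / t^3 *)

(** Three obstacles shape the proof. First, [is_drum] fixes the drum only up to an abstract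
    distance-preserving bijection, so the volume has to be invariant under all of these. Each is a
    product of mirrors built from inversions and translations. The point is that (x / t, y / t, t)
    turns dx dy dt / t^3 into du dv dt / t, where an inversion replaces t by a constant over t and
    dt / t is invariant under that. Second, the hull is only bracketed: open wedges are packed in
    it, closed wedges cover it, and both families have the same total volume. Monotonicity of the
    integral of nonnegative functions then settles the value without any measurability of the hull.
    Third, z2 is never real, but z3 can be, and then neither the logarithmic primitive nor the
    smooth form of the argument is available. In this flat case the integrand attached to tau_3 is
    identically 0, and z3 turns out to be negative, where arg(1 - z3) = 0 and Li2 is real by
    conjugation and analyticity. *)

Section affine_substitution.
Local Open Scope ereal_scope.
Context {R : realType}.
Implicit Types f : R -> \bar R.
Local Notation mu := (@lebesgue_measure R).

Let measurable_affine (c d : R) :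
  measurable_fun [set: R] (fun x => c * x + d : R)%R.
Proof.
apply: measurable_funD; last exact: measurable_cst.
by apply: measurable_funM => //; exact: measurable_cst.
Qed.

(** The right-hand side gives every interval its length, which characterizes Lebesgue measure. *)
Lemma lebesgue_measure_affine (c d : R) (c0 : (0 < c)%R) A : measurable A ->
  mu A = pushforward (mscale (NngNum (ltW c0)) mu)
    (fun x : measurableTypeR R => c * x + d : measurableTypeR R)%R A.
Proof.
move=> mA; apply: lebesgue_measure_unique => //=.
  exact: measurable_affine.
move=> mphi _ [[a b]] _ <-.
rewrite /mscale/= /pushforward/=.
rewrite (_ : _ @^-1` _ = `]((a - d) / c)%R, ((b - d) / c)%R]%classic); last first.
  apply/seteqP; split=> x /=; rewrite !in_itv/= ltr_pdivrMr// ler_pdivlMr//.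
    by move=> /andP[? ?]; apply/andP; split; lra.
  by move=> /andP[? ?]; apply/andP; split; lra.
rewrite !lebesgue_measure_itv/= !lte_fin ltr_pM2r ?invr_gt0// ltrD2r.
case: ifPn => _; last by rewrite mule0.
by rewrite -!EFinB -EFinM; congr EFin; field; rewrite gt_eqF.
Qed.

Lemma ge0_integral_affine (c d : R) f : (0 < c)%R ->
  measurable_fun setT f -> (forall x, 0 <= f x) ->
  \int[mu]_x f x = c%:E * \int[mu]_x f (c * x + d)%R.
Proof.
move=> c0 mf f0.
pose phi := (fun x : measurableTypeR R => c * x + d : measurableTypeR R)%R.
have mphi : measurable_fun setT phi by exact: measurable_affine.
transitivity (\int[pushforward (mscale (NngNum (ltW c0)) mu) phi]_x f x).
  by apply: eq_measure_integral => A mA _; exact: lebesgue_measure_affine.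
rewrite (ge0_integral_pushforward mphi)//= ge0_integral_mscale//=.
- by rewrite preimage_setT; exact: measurableT.
- exact: (measurableT_comp mf mphi).
Qed.

End affine_substitution.

Section haar.
Local Open Scope ereal_scope.
Context {R : realType}.
Implicit Types f : R -> \bar R.
Local Notation mu := (@lebesgue_measure R).

(** Inversion is discontinuous at 0, so it is written through [expR] and [ln] on each half-line,
    with the value 0 at 0. *)
Lemma measurable_invr : measurable_fun [set: R] (fun x : R => x^-1)%R.
Proof.
have -> : (fun x : R => x^-1)%R = (fun x => if (0 < x)%R then expR (- ln x)
    else if (x < 0)%R then (- expR (- ln (- x)))%R else 0%R).
  apply/funext => x; case: ltrgt0P => [x0|x0|->]; last by rewrite invr0.
    by rewrite expRN lnK.
  by rewrite expRN lnK ?posrE ?oppr_gt0// invrN opprK.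
apply: measurable_fun_ifT.
- by apply: measurable_fun_ltr => //; exact: measurable_cst.
- apply: measurableT_comp; first exact: measurable_expR.
  by apply: measurableT_comp => //; exact: measurable_ln.
- apply: measurable_fun_ifT; last exact: measurable_cst.
  + by apply: measurable_fun_ltr => //; exact: measurable_cst.
  + apply: measurableT_comp => //.
    apply: measurableT_comp; first exact: measurable_expR.
    by apply: measurableT_comp => //; apply: measurableT_comp.
Qed.

(* Extended by 0, so that all the integrals can be taken over the whole line. *)
Definition posinv (t : R) : R := if (0 < t)%R then (t^-1)%R else 0%R.

Lemma posinv_ge0 t : (0 <= posinv t)%R.
Proof. by rewrite /posinv; case: ifPn => // t0; rewrite invr_ge0 ltW. Qed.

Lemma measurable_posinv : measurable_fun [set: R] posinv.
Proof.
apply: measurable_fun_ifT; last exact: measurable_cst.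
- by apply: measurable_fun_ltr => //; exact: measurable_cst.
- exact: measurable_invr.
Qed.

Definition haar f := \int[mu]_t (f t * (posinv t)%:E).

Lemma haar_ge0 f : (forall x, 0 <= f x) -> 0 <= haar f.
Proof.
by move=> f0; apply: integral_ge0 => x _; rewrite mule_ge0// lee_fin posinv_ge0.
Qed.

Lemma eq_haar f g : (forall x, (0 < x)%R -> f x = g x) -> haar f = haar g.
Proof.
move=> fg; apply: eq_integral => x _; rewrite /posinv; case: ifPn => [x0|_].
  by rewrite fg.
by rewrite !mule0.
Qed.

Lemma measurable_haar_integrand d (T : measurableType d) (f : T -> \bar R)
    (g : T -> R) : measurable_fun setT f -> measurable_fun setT g ->
  measurable_fun setT (fun t => f t * (posinv (g t))%:E).
Proof.
move=> mf mg; apply: emeasurable_funM => //; apply/measurable_EFinP.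
by apply: measurableT_comp => //; exact: measurable_posinv.
Qed.

Lemma haar_scale c f : (0 < c)%R -> measurable_fun setT f ->
  (forall x, 0 <= f x) -> haar (fun t => f (c * t)%R) = haar f.
Proof.
move=> c0 mf f0; rewrite {2}/haar (@ge0_integral_affine _ c 0) //; last 2 first.
- by apply: measurable_haar_integrand => //; exact: measurable_id.
- by move=> x; rewrite mule_ge0// lee_fin posinv_ge0.
rewrite -ge0_integralZl//; last 3 first.
- apply: measurable_haar_integrand => //.
    apply: measurableT_comp => //.
    apply: measurable_funD; last exact: measurable_cst.
    by apply: measurable_funM => //; exact: measurable_cst.
  apply: measurable_funD; last exact: measurable_cst.
  by apply: measurable_funM => //; exact: measurable_cst.
- by move=> x _; rewrite mule_ge0// lee_fin posinv_ge0.
- by rewrite lee_fin ltW.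
apply: eq_integral => x _; rewrite addr0 muleCA -EFinM; congr (_ * _%:E).
rewrite /posinv pmulr_rgt0//; case: ifPn => [x0|_]; last by rewrite mulr0.
by rewrite invfM mulrA divff ?mul1r// gt_eqF.
Qed.

(* The products of both sides with the Haar integral of the indicator h of [1, 2]
   are the same double integral, by Fubini and invariance under scaling; and the
   Haar integral of h is positive and finite. *)
Lemma haar_inv f : measurable_fun setT f -> (forall x, 0 <= f x) ->
  haar (fun t => f (t^-1)%R) = haar f.
Proof.
move=> mf f0.
pose h x : \bar R := (\1_(`[1%R, 2%R]%classic : set R) x)%:E.
have h0 x : 0 <= h x by rewrite lee_fin.
have mh : measurable_fun setT h.
  by apply/measurable_EFinP; apply: measurable_indic; exact: measurable_itv.
have mM : measurable_fun setT (fun p : R * R => p.1 * p.2)%R.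
  by apply: measurable_funM; [exact: measurable_fst|exact: measurable_snd].
have mi := measurable_invr.
have mD : measurable_fun setT (fun p : R * R => p.1 / p.2)%R.
  apply: measurable_funM; first exact: measurable_fst.
  by apply: (measurableT_comp mi); exact: measurable_snd.
pose w t := (posinv t)%:E.
have w0 t : 0 <= w t by rewrite lee_fin posinv_ge0.
have mw : measurable_fun setT w.
  by apply/measurable_EFinP; exact: measurable_posinv.
have haarZl g c : measurable_fun setT g -> (forall x, 0 <= g x) -> 0 <= c ->
    haar (fun x => c * g x) = c * haar g.
  move=> mg g0 c0; rewrite /haar -ge0_integralZl//.
  - by apply: eq_integral => x _; rewrite muleA.
  - by apply: measurable_haar_integrand => //; exact: measurable_id.
  - by move=> x _; apply: mule_ge0 => //; exact: w0.
have haarC (g : R -> R -> \bar R) :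
    measurable_fun setT (fun p : R * R => g p.1 p.2) ->
    (forall x y, 0 <= g x y) ->
    haar (fun x => haar (g x)) = haar (fun y => haar (g ^~ y)).
  move=> mg g0.
  pose G (p : R * R) := g p.1 p.2 * w p.1 * w p.2.
  have G0 p : 0 <= G p by rewrite !mule_ge0.
  have mG : measurable_fun setT G.
    apply: measurable_haar_integrand; last exact: measurable_snd.
    by apply: measurable_haar_integrand => //; exact: measurable_fst.
  have := fubini_tonelli (m1 := mu) (m2 := mu) G mG G0.
  have e1 : haar (fun x => haar (g x)) = \int[mu]_x \int[mu]_y G (x, y).
    apply: eq_integral => x _; rewrite muleC -ge0_integralZl//.
    - by apply: eq_integral => y _; rewrite /G/= muleA [w x * _]muleC.
    - apply: emeasurable_funM; last by exact: mw.
      exact: (measurableT_comp mg (pair1_measurable x)).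
    - by move=> y _; apply: mule_ge0 => //; exact: w0.
    - exact: w0.
  have e2 : haar (fun y => haar (g ^~ y)) = \int[mu]_y \int[mu]_x G (x, y).
    apply: eq_integral => y _; rewrite muleC -ge0_integralZl//.
    - by apply: eq_integral => x _; rewrite /G/= muleC.
    - apply: emeasurable_funM; last by exact: mw.
      exact: (measurableT_comp mg (pair2_measurable y)).
    - by move=> x _; apply: mule_ge0 => //; exact: w0.
    - exact: w0.
  by rewrite e1 e2.
have If : haar f * haar h = haar (fun t => haar (fun s => f t * h (t * s)%R)).
  rewrite muleC -haarZl//; last exact: haar_ge0.
  apply: eq_haar => t t0; rewrite haarZl//; last first.
    by apply: measurableT_comp => //; apply: measurable_funM => //; exact: measurable_cst.
  by rewrite (haar_scale _ _ t0 mh h0)// muleC.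
have If' : haar (fun t => f (t^-1)%R) * haar h =
    haar (fun t => haar (fun s => h t * f (t / s)%R)).
  have h1 : 0 <= haar (fun t => f (t^-1)%R) by apply: haar_ge0.
  rewrite -(haarZl _ _ mh h0 h1); apply: eq_haar => t t0.
  have ft0 (s : R) : 0 <= f (t / s)%R by [].
  have mft : measurable_fun setT (fun s : R => f (t / s)%R).
    apply: (measurableT_comp mf); apply: measurable_funM; [exact: measurable_cst|exact: mi].
  rewrite (haarZl _ _ mft ft0 (h0 t)) muleC; congr (_ * _).
  rewrite -(haar_scale t _ t0 mft ft0).
  apply: eq_haar => s s0; congr f.
  by rewrite invfM mulrA divff ?mul1r// gt_eqF.
have : haar f * haar h = haar (fun t => f (t^-1)%R) * haar h.
  (* With the order of integration exchanged, s is fixed, and replacing t by s t in h t * f (t / s)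
     gives f t * h (t * s). *)
  rewrite If If' (haarC (fun t s => f t * h (t * s)%R)); last 2 first.
  - apply: emeasurable_funM; last exact: (measurableT_comp mh mM).
    by apply: (measurableT_comp mf); exact: measurable_fst.
  - by move=> x y; rewrite mule_ge0.
  rewrite (haarC (fun t s => h t * f (t / s)%R)); last 2 first.
  - apply: emeasurable_funM; last exact: (measurableT_comp mf mD).
    by apply: (measurableT_comp mh); exact: measurable_fst.
  - by move=> x y; rewrite mule_ge0.
  apply: eq_haar => s s0.
  pose k (t : R) := h t * f (t / s)%R.
  rewrite -(haar_scale s k)//; last 2 first.
  - apply: emeasurable_funM => //; apply: (measurableT_comp mf).
    by apply: measurable_funM; [exact: measurable_id|exact: measurable_cst].
  - by move=> x; rewrite /k mule_ge0.
  apply: eq_haar => t t0; rewrite /k muleC [(s * t)%R]mulrC mulfK//.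
  by rewrite gt_eqF.
have hfin : haar h \is a fin_num /\ haar h != 0.
  have hE : haar h = \int[mu]_(x in `[1%R, 2%R]) (posinv x)%:E.
    rewrite [RHS]integral_mkcond; apply: eq_integral => x _.
    by rewrite /h patchE indicE; case: ifPn => _; rewrite ?mul1e ?mul0e.
  have muE : mu `[1%R, 2%R]%classic = 1.
    by rewrite lebesgue_measure_itv/= lte_fin ltr1n -EFinB; congr EFin; lra.
  have mwI (D : set R) : measurable_fun D w by exact: measurable_funTS.
  have mI : measurable (`[1%R, 2%R]%classic : set R) by exact: measurable_itv.
  have hle : haar h <= 1.
    rewrite hE; apply: (@le_trans _ _ (\int[mu]_(x in `[1%R, 2%R]) (cst 1) x)).
      apply: ge0_le_integral => //.
      - by move=> x _; exact: w0.
      - exact: mwI.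
      - move=> x /=; rewrite in_itv/= => /andP[x1 _].
        have x0 : (0 < x)%R by apply: lt_le_trans x1.
        by rewrite lee_fin /posinv x0/= invf_le1.
    by rewrite integral_cst// mul1e -[leRHS]muE.
  have hge : (2^-1)%:E <= haar h.
    rewrite hE; apply: (@le_trans _ _ (\int[mu]_(x in `[1%R, 2%R]) (cst (2^-1)%:E) x)).
      by rewrite integral_cst// -[leLHS]mule1 -muE.
    apply: ge0_le_integral => //.
    - by move=> x _; rewrite lee_fin invr_ge0.
    - exact: mwI.
    - move=> x /=; rewrite in_itv/= => /andP[x1 x2].
      have x0 : (0 < x)%R by apply: lt_le_trans x1.
      rewrite lee_fin /posinv x0/= lef_pV2 ?posrE//.
  split.
    by rewrite ge0_fin_numE ?haar_ge0// (le_lt_trans hle)// ltry.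
  by rewrite gt_eqF// (lt_le_trans _ hge)// lte_fin invr_gt0.
case: hfin => hf hn0 /(congr1 (fun x => x * (fine (haar h))^-1%:E)).
rewrite -[in haar f * _](fineK hf) -[in haar (fun t => f (t^-1)%R) * _](fineK hf).
rewrite -!muleA -EFinM divff ?mule1// -eqe fineK//.
Qed.

End haar.

Section coordinates.
Context {R : realType}.

Lemma measurable_coord1 : measurable_fun setT (fun p : R * R * R => p.1.1).
Proof. by apply: (measurableT_comp measurable_fst); exact: measurable_fst. Qed.

Lemma measurable_coord2 : measurable_fun setT (fun p : R * R * R => p.1.2).
Proof. by apply: (measurableT_comp measurable_snd); exact: measurable_fst. Qed.

Lemma measurable_coord3 : measurable_fun setT (fun p : R * R * R => p.2).
Proof. exact: measurable_snd. Qed.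

End coordinates.

Section projective.
Local Open Scope ereal_scope.
Context {R : realType}.
Local Notation mu := (@lebesgue_measure R).

Lemma plane_measure_sigma_finite : sigma_finite setT (mu \x mu).
Proof.
have /sigma_finiteP[F [TF ndF Foo]] := sigma_finiteT mu.
exists (fun n => F n `*` F n).
  rewrite -setXTT TF predeqE => -[x y]; split.
    move=> [/= [n _ Fnx] [k _ Gky]]; exists (maxn n k) => //; split.
    - by move: x Fnx; exact/subsetPset/ndF/leq_maxl.
    - by move: y Gky; exact/subsetPset/ndF/leq_maxr.
  by move=> [n _ []/= ? ?]; split; exists n.
move=> k; have [? ?] := Foo k.
split; first exact: measurableX.
by rewrite product_measure1E// lte_mul_pinfty// ge0_fin_numE.
Qed.

(** The product measure is packed with its sigma-finiteness so that Tonelli's theorem accepts the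
    whole plane as one factor. *)
Definition plane_measure :
  {sigma_finite_measure set (measurableTypeR R * measurableTypeR R)%type -> \bar R} :=
  HB.pack_for (SigmaFiniteMeasure.type (measurableTypeR R * measurableTypeR R)%type R)
    (mu \x mu) (Measure_isSigmaFinite.Build _ _ _ (mu \x mu) plane_measure_sigma_finite).
Local Notation mu2 := plane_measure.

Lemma ge0_integral_affine2 (c d e : R) (f : R * R -> \bar R) : (0 < c)%R ->
  measurable_fun setT f -> (forall x, 0 <= f x) ->
  \int[mu2]_q f q = (c ^+ 2)%:E * \int[mu2]_q f (c * q.1 + d, c * q.2 + e)%R.
Proof.
move=> c0 mf f0.
have maff (a b : R) : measurable_fun [set: R] (fun x => a * x + b : R)%R.
  apply: measurable_funD; last exact: measurable_cst.
  by apply: measurable_funM => //; exact: measurable_cst.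
have mf1 x : measurable_fun setT (fun y => f (x, y)).
  exact: measurable_fun_pair2.
have mphi : measurable_fun setT
    (fun q : R * R => (c * q.1 + d, c * q.2 + e)%R).
  apply: measurable_fun_pair.
    apply: (measurableT_comp (maff c d)); exact: measurable_fst.
  apply: (measurableT_comp (maff c e)); exact: measurable_snd.
have mf2 : measurable_fun setT (fun q : R * R => f (c * q.1 + d, c * q.2 + e)%R).
  exact: measurableT_comp.
rewrite fubini_tonelli1// fubini_tonelli1//.
rewrite (ge0_integral_affine c d)//; last 2 first.
- exact: measurable_fun_fubini_tonelli_F.
- by move=> x; apply: integral_ge0 => y _.
rewrite EFinM -muleA; congr (_ * _).
rewrite -ge0_integralZl//; last 3 first.
- exact: (measurable_fun_fubini_tonelli_F (m2 := mu) _ mf2).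
- by move=> x _; apply: integral_ge0 => y _.
- by rewrite lee_fin ltW.
apply: eq_integral => x _.
by rewrite /fubini_F (ge0_integral_affine c e).
Qed.

(** The volume integral for functions on the whole space: [posinv] discards the points with t <=
    0. *)
Definition hvol (f : R * R * R -> \bar R) :=
  \int[mu2 \x mu]_p (f p * (posinv p.2 ^+ 3)%:E).

(** At fixed t, the substitution x = t u, y = t v has Jacobian t^2, which reduces t^-3 to the
    density 1 / t of [haar]. *)
Lemma hvol_projective f : measurable_fun setT f -> (forall x, 0 <= f x) ->
  hvol f = \int[mu2]_q haar (fun t => f (t * q.1, t * q.2, t)%R).
Proof.
move=> mf f0.
pose g (p : R * R * R) := f p * (posinv p.2 ^+ 3)%:E.
have g0 p : 0 <= g p by rewrite mule_ge0// lee_fin exprn_ge0// posinv_ge0.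
have mp2 : measurable_fun setT (fun p : R * R * R => posinv p.2).
  by apply: (measurableT_comp measurable_posinv); exact: measurable_snd.
have mg : measurable_fun setT g.
  apply: emeasurable_funM => //; apply/measurable_EFinP.
  exact: measurable_funX.
pose k (p : R * R * R) := f (p.2 * p.1.1, p.2 * p.1.2, p.2)%R * (posinv p.2)%:E.
have k0 p : 0 <= k p by rewrite mule_ge0// lee_fin posinv_ge0.
have mk : measurable_fun setT k.
  apply: emeasurable_funM; last exact/measurable_EFinP.
  apply: measurableT_comp => //; apply: measurable_fun_pair; last first.
    exact: measurable_snd.
  have m11 := @measurable_coord1 R.
  have m12 := @measurable_coord2 R.
  have m2 := @measurable_coord3 R.
  by apply: measurable_fun_pair; exact: measurable_funM.
transitivity (\int[mu]_t \int[mu2]_q k (q, t)); last first.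
  transitivity (\int[mu2]_q \int[mu]_t k (q, t)); last by [].
  by apply/esym; exact: fubini_tonelli.
transitivity (\int[mu]_t \int[mu2]_q g (q, t)).
  exact: (@fubini_tonelli2 _ _ _ _ R mu2 mu g mg g0).
apply: eq_integral => t _.
rewrite /fubini_G.
have [t0|t0] := ltP 0%R t; last first.
  have pt : posinv t = 0%R by rewrite /posinv ltNge t0.
  rewrite !integral0_eq// => q _; first by rewrite /k/= pt mule0.
  by rewrite /g/= pt expr0n/= mule0.
have mgt : measurable_fun setT (fun q : R * R => g (t * q.1 + 0, t * q.2 + 0, t)%R).
  apply: (measurableT_comp mg); apply: measurable_fun_pair; last exact: measurable_cst.
  apply: measurable_fun_pair; (apply: measurable_funD; last exact: measurable_cst).
    by apply: measurable_funM; [exact: measurable_cst|exact: measurable_fst].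
  by apply: measurable_funM; [exact: measurable_cst|exact: measurable_snd].
rewrite (ge0_integral_affine2 t 0 0 _ t0 (measurable_fun_pair1 t mg) (fun q => g0 _)).
rewrite -ge0_integralZl//; last by rewrite lee_fin exprn_ge0// ltW.
apply: eq_integral => -[u v] _; rewrite /g /k/= !addr0 muleCA -EFinM.
congr (_ * _%:E); rewrite /posinv t0.
by rewrite exprVn; field; rewrite gt_eqF.
Qed.

Lemma eq_hvol f g : (forall x y t, (0 < t)%R -> f (x, y, t) = g (x, y, t)) ->
  hvol f = hvol g.
Proof.
move=> fg; apply: eq_integral => -[[x y] t] _ /=; rewrite /posinv.
case: ifPn => [t0|_]; first by rewrite fg.
by rewrite expr0n/= !mule0.
Qed.

Definition inversion_coords (k : R) (p : R * R * R) : R * R * R :=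
  let N := (p.1.1 ^+ 2 + p.1.2 ^+ 2 + p.2 ^+ 2)%R in
  (k * p.1.1 / N, k * p.1.2 / N, k * p.2 / N)%R.

Lemma measurable_inversion_coords k : measurable_fun setT (inversion_coords k).
Proof.
have m11 := @measurable_coord1 R.
have m12 := @measurable_coord2 R.
have m2 := @measurable_coord3 R.
have mN : measurable_fun setT (fun p : R * R * R =>
    (p.1.1 ^+ 2 + p.1.2 ^+ 2 + p.2 ^+ 2)^-1)%R.
  apply: (measurableT_comp measurable_invr).
  by do 2 ?apply: measurable_funD; exact: measurable_funX.
have mk (g : R * R * R -> R) : measurable_fun setT g ->
    measurable_fun setT (fun p => k * g p)%R.
  by move=> mg; apply: measurable_funM => //; exact: measurable_cst.
by apply: measurable_fun_pair; [apply: measurable_fun_pair|];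
  apply: measurable_funM => //; exact: mk.
Qed.

(* In the coordinates (x / t, y / t, t) an inversion only moves t, which becomes
   a constant divided by t. *)
Lemma hvol_inversion k f : (0 < k)%R -> measurable_fun setT f ->
  (forall x, 0 <= f x) -> hvol (f \o inversion_coords k) = hvol f.
Proof.
move=> k0 mf f0.
have mfk := measurableT_comp mf (measurable_inversion_coords k).
rewrite (hvol_projective _ mf f0) (hvol_projective _ mfk (fun p => f0 _)).
apply: eq_integral => -[u v] _ /=.
pose n := (1 + u ^+ 2 + v ^+ 2)%R.
have n0 : (0 < n)%R by rewrite /n -addrA ltr_wpDr// addr_ge0 ?sqr_ge0.
pose g t := f (t * u, t * v, t)%R.
have mg : measurable_fun setT g.
  apply: measurableT_comp => //.
  apply: measurable_fun_pair; last exact: measurable_id.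
  by apply: measurable_fun_pair; apply: measurable_funM => //; exact: measurable_cst.
have g0 t : 0 <= g t by exact: f0.
transitivity (haar g); last by [].
have kn : (0 < k / n)%R by rewrite divr_gt0.
have mgk : measurable_fun setT (fun t : R => g (k / n * t)%R).
  apply: (measurableT_comp mg).
  by apply: measurable_funM; [exact: measurable_cst|exact: measurable_id].
rewrite -(haar_scale (k / n)%R g kn mg g0) -(haar_inv _ mgk (fun t => g0 _)).
apply: eq_haar => t t0; rewrite /g /inversion_coords/=.
have e : (0 < (t * u) ^+ 2 + (t * v) ^+ 2 + t ^+ 2)%R.
  by rewrite ltr_wpDl ?addr_ge0 ?sqr_ge0// exprn_gt0.
have e' : ((t * u) ^+ 2 + (t * v) ^+ 2 + t ^+ 2 = t ^+ 2 * n)%R.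
  by rewrite /n; ring.
rewrite e'; congr (f (_, _, _)); field; by rewrite !gt_eqF.
Qed.

Lemma hvol_translation (a b : R) f : measurable_fun setT f ->
  (forall x, 0 <= f x) ->
  hvol (fun p => f (p.1.1 + a, p.1.2 + b, p.2)%R) = hvol f.
Proof.
move=> mf f0.
pose g (p : R * R * R) := f p * (posinv p.2 ^+ 3)%:E.
have g0 p : 0 <= g p by rewrite mule_ge0// lee_fin exprn_ge0// posinv_ge0.
have mp2 : measurable_fun setT (fun p : R * R * R => posinv p.2).
  by apply: (measurableT_comp measurable_posinv); exact: measurable_snd.
have mg : measurable_fun setT g.
  apply: emeasurable_funM => //; apply/measurable_EFinP.
  exact: measurable_funX.
have m11 := @measurable_coord1 R.
have m12 := @measurable_coord2 R.
have m2 := @measurable_coord3 R.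
have mt : measurable_fun setT (fun p : R * R * R => (p.1.1 + a, p.1.2 + b, p.2)%R).
  apply: measurable_fun_pair => //.
  by apply: measurable_fun_pair; apply: measurable_funD => //; exact: measurable_cst.
transitivity (\int[mu2 \x mu]_p g (p.1.1 + a, p.1.2 + b, p.2)%R); first by [].
pose g' (p : R * R * R) := g (p.1.1 + a, p.1.2 + b, p.2)%R.
have mg' : measurable_fun setT g' by exact: (measurableT_comp mg mt).
transitivity (\int[mu]_t \int[mu2]_q g' (q, t)).
  exact: (@fubini_tonelli2 _ _ _ _ R mu2 mu g' mg' (fun p => g0 _)).
transitivity (\int[mu]_t \int[mu2]_q g (q, t)); last first.
  by apply/esym; exact: (@fubini_tonelli2 _ _ _ _ R mu2 mu g mg g0).
apply: eq_integral => t _.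
rewrite [RHS](ge0_integral_affine2 1 a b)//; last first.
  exact: (measurable_fun_pair1 t mg).
rewrite expr1n mul1e; apply: eq_integral => -[u v] _ /=.
by rewrite !mul1r.
Qed.

End projective.

(** * Volume of a wedge *)

Section wedge.
Local Open Scope ereal_scope.
Context {R : realType}.
Local Notation mu := (@lebesgue_measure R).
Local Notation mu2 := (@plane_measure R).

Definition ind (c : bool) : \bar R := if c then 1 else 0.

Lemma ind_ge0 c : 0 <= ind c. Proof. by case: c. Qed.

Lemma ind_and c d : ind (c && d) = ind c * ind d.
Proof. by case: c; case: d; rewrite /= ?mule0 ?mule1. Qed.

Lemma measurable_ind d (T : measurableType d) (P : T -> bool) :
  measurable_fun setT P -> measurable_fun setT (fun x => ind (P x)).
Proof.
by move=> mP; apply: measurable_fun_ifT => //; exact: measurable_cst.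
Qed.

Lemma measurable_lteif d (T : measurableType d) (f g : T -> R) c :
  measurable_fun setT f -> measurable_fun setT g ->
  measurable_fun setT (fun x => (f x < g x ?<= if c)%R).
Proof.
by case: c => mf mg; [exact: measurable_fun_ler|exact: measurable_fun_ltr].
Qed.

Lemma measurable_sqrt : measurable_fun [set: R] (@Num.sqrt R).
Proof. by apply: continuous_measurable_fun; exact: sqrt_continuous. Qed.

(** Endpoints are negligible, so the flags disappear. This is what gives open and closed wedges the
    same volume. *)
Lemma integral_ind_itv (b0 b1 : bool) (x y : R) (f : R -> \bar R) :
  measurable_fun setT f ->
  \int[mu]_z (ind (z \in Interval (BSide b0 x) (BSide b1 y)) * f z) =
  \int[mu]_(z in `]x, y[) f z.
Proof.
move=> mf; rewrite -(integral_itv_bndoo b0 b1); last exact: measurable_funTS.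
rewrite [RHS]integral_mkcond; apply: eq_integral => z _.
by rewrite patchE mem_setE /ind; case: ifPn; rewrite ?mul1e ?mul0e.
Qed.

Lemma integral_id_itv (U : R) : (0 <= U)%R ->
  \int[mu]_(u in `]0%R, U[) u%:E = (U ^+ 2 / 2)%:E.
Proof.
rewrite le_eqVlt => /predU1P[<-|U0].
  by rewrite set_itvoo0 integral_set0 expr0n/= mul0r.
rewrite -(integral_itv_bndoo true false); last first.
  exact: measurable_funTS.
rewrite (@continuous_FTC2 _ (fun u : R => u) (fun u => u ^+ 2 / 2)%R)//.
- by rewrite expr0n/= mul0r sube0.
- by apply: continuous_subspaceT => x; exact: cvg_id.
- split.
  + by move=> x _; exact: ex_derive.
  + by apply: cvg_at_right_filter; apply: cvgM; [exact: exprn_continuous|exact: cvg_cst].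
  + by apply: cvg_at_left_filter; apply: cvgM; [exact: exprn_continuous|exact: cvg_cst].
- move=> x _; rewrite derive1E derive_val; by rewrite /GRing.scale/=; field.
Qed.

(* The ray {t (u, v, 1)} meets the hemisphere of radius tau at t = tau / nu (u, v). *)
Definition nu (q : R * R) : R := Num.sqrt (1 + q.1 ^+ 2 + q.2 ^+ 2).

Lemma nu_gt0 q : (0 < nu q)%R.
Proof. by rewrite sqrtr_gt0 -addrA ltr_wpDr// addr_ge0// sqr_ge0. Qed.

Lemma sqr_nu q : (nu q ^+ 2 = 1 + q.1 ^+ 2 + q.2 ^+ 2)%R.
Proof. by rewrite sqr_sqrtr// -addrA addr_ge0// addr_ge0// sqr_ge0. Qed.

Lemma measurable_nu : measurable_fun setT nu.
Proof.
apply: (measurableT_comp measurable_sqrt).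
apply: measurable_funD; last by apply: measurable_funX; exact: measurable_snd.
apply: measurable_funD; first exact: measurable_cst.
by apply: measurable_funX; exact: measurable_fst.
Qed.

(* The trace of a wedge on the hemisphere of radius tau, in the coordinates
   (x / t, y / t); b selects the closed or the open wedge. *)
Definition slice (b : bool) (tau X Y1 Y2 : R) (q : R * R) : bool :=
  [&& (0 <= q.1)%R, (tau * q.1 / nu q < X ?<= if b)%R,
      (Y1 * q.1 < q.2 * X ?<= if b)%R & (q.2 * X < Y2 * q.1 ?<= if b)%R].

Lemma measurable_slice b tau X Y1 Y2 :
  measurable_fun setT (slice b tau X Y1 Y2).
Proof.
have m1 : measurable_fun setT (fun q : R * R => q.1) by exact: measurable_fst.
have m2 : measurable_fun setT (fun q : R * R => q.2) by exact: measurable_snd.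
apply: measurable_and.
  by apply: measurable_fun_ler => //; exact: measurable_cst.
apply: measurable_and.
  apply: measurable_lteif; last exact: measurable_cst.
  apply: measurable_funM.
    by apply: measurable_funM => //; exact: measurable_cst.
  by apply: (measurableT_comp measurable_invr); exact: measurable_nu.
apply: measurable_and; apply: measurable_lteif.
- by apply: measurable_funM => //; exact: measurable_cst.
- by apply: measurable_funM => //; exact: measurable_cst.
- by apply: measurable_funM => //; exact: measurable_cst.
- by apply: measurable_funM => //; exact: measurable_cst.
Qed.

Lemma lteif_sqr (x y : R) b : (0 <= x)%R -> (0 <= y)%R ->
  (x ^+ 2 < y ^+ 2 ?<= if b)%R = (x < y ?<= if b)%R.
Proof.
by move=> x0 y0; case: b => /=; [rewrite ler_sqr|rewrite ltr_sqr].
Qed.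

Lemma slice_radial b (tau X m u : R) : (0 < tau)%R -> (0 < X)%R -> (0 < u)%R ->
  (tau * u / nu (u, u * m) < X ?<= if b)%R =
  (u ^+ 2 * (tau ^+ 2 - X ^+ 2 * (1 + m ^+ 2)) < X ^+ 2 ?<= if b)%R.
Proof.
move=> t0 X0 u0; have n0 := nu_gt0 (u, u * m)%R.
rewrite lteif_pdivrMr// -(lteif_sqr (tau * u)); last 2 first.
- by rewrite mulr_ge0// ltW.
- by rewrite mulr_ge0// ltW.
rewrite [((X * _) ^+ 2)%R]exprMn sqr_nu/=.
rewrite -[in RHS](lteifD2r _ (X ^+ 2 * (1 + m ^+ 2) * u ^+ 2)%R).
by congr (_ < _ ?<= if b)%R; ring.
Qed.

(** With the slope m = v / u in place of v, dv becomes u dm and the condition on u becomes u < U(m),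
    with U^2 = X^2 / (tau^2 - X^2 - (m X)^2). The inner integral of u is U^2 / 2, and m X = Y1 + s
    (Y2 - Y1) gives the variable s. The bound on tau^2 keeps U finite. *)
Lemma slice_area b (tau X Y1 Y2 : R) :
  (0 < tau)%R -> (0 < X)%R -> (Y1 < Y2)%R ->
  (forall s, 0 < s < 1 -> X ^+ 2 + (Y1 + s * (Y2 - Y1)) ^+ 2 < tau ^+ 2)%R ->
  \int[mu2]_q ind (slice b tau X Y1 Y2 q) =
  \int[mu]_(s in `]0%R, 1%R[)
    ((Y2 - Y1) * X /
     (2 * (tau ^+ 2 - X ^+ 2 - (Y1 + s * (Y2 - Y1)) ^+ 2)))%:E.
Proof.
move=> t0 X0 Y12 Hq.
have mS := measurable_ind _ _ _ (measurable_slice b tau X Y1 Y2).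
pose I1 (p : R * R) := ind ((0 < p.1) && (p.1 ^+ 2 *
  (tau ^+ 2 - X ^+ 2 * (1 + p.2 ^+ 2)) < X ^+ 2 ?<= if b))%R.
pose pos (u : R) : R := if (0 < u)%R then u else 0%R.
have pos0 u : (0 <= pos u)%R by rewrite /pos; case: ifPn => // /ltW.
have mpos : measurable_fun setT pos.
  apply: measurable_fun_ifT; [|exact: measurable_id|exact: measurable_cst].
  by apply: measurable_fun_ltr; [exact: measurable_cst|exact: measurable_id].
pose IY (m : R) :=
  m \in Interval (BSide b (Y1 / X)%R) (BSide (~~ b) (Y2 / X)%R).
have IYE m : IY m = ((Y1 < m * X ?<= if b) && (m * X < Y2 ?<= if b))%R.
  by rewrite /IY in_itv/= negbK lteif_pdivrMr// lteif_pdivlMr.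
pose K (p : R * R) := (pos p.1)%:E * I1 p.
pose H (p : R * R) := K p * ind (IY p.2).
have m1 : measurable_fun setT (fun q : R * R => q.1) by exact: measurable_fst.
have m2 : measurable_fun setT (fun q : R * R => q.2) by exact: measurable_snd.
have mcst d (T : measurableType d) (c : R) : measurable_fun setT (fun _ : T => c).
  exact: measurable_cst.
have mK : measurable_fun setT K.
  apply: emeasurable_funM.
    by apply/measurable_EFinP; exact: (measurableT_comp mpos).
  apply: measurable_ind; apply: measurable_and.
    exact: measurable_fun_ltr.
  apply: measurable_lteif => //.
  apply: measurable_funM; first exact: measurable_funX.
  apply: measurable_funB => //; apply: measurable_funM => //.
  by apply: measurable_funD => //; exact: measurable_funX.
have mIY : measurable_fun setT IY.
  rewrite (_ : IY = fun m => (Y1 < m * X ?<= if b) && (m * X < Y2 ?<= if b))%R.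
    apply: measurable_and; apply: measurable_lteif => //.
      by apply: measurable_funM => //; exact: measurable_id.
    by apply: measurable_funM => //; exact: measurable_id.
  by apply/funext => m; rewrite IYE.
have mH : measurable_fun setT H.
  apply: emeasurable_funM => //; apply: measurable_ind.
  exact: (measurableT_comp mIY).
have K0 p : 0 <= K p by rewrite mule_ge0 ?ind_ge0// lee_fin.
have H0 p : 0 <= H p by rewrite mule_ge0 ?ind_ge0.
transitivity (\int[mu]_u \int[mu]_v ind (slice b tau X Y1 Y2 (u, v))).
  exact: (@fubini_tonelli1 _ _ _ _ R mu mu _ mS (fun q => ind_ge0 _)).
have GH u : \int[mu]_v ind (slice b tau X Y1 Y2 (u, v)) = \int[mu]_m H (u, m).
  have mg : measurable_fun setT (fun v => ind (slice b tau X Y1 Y2 (u, v))).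
    exact: (measurable_fun_pair2 u mS).
  have [u0|u0|u0] := ltgtP u 0%R.
  - rewrite !integral0_eq// => v _.
    + by rewrite /H /K /pos/= ltNge (ltW u0)/= !mul0e.
    + by rewrite /slice/= leNgt u0.
  - rewrite (ge0_integral_affine u 0 _ u0 mg (fun v => ind_ge0 _)).
    have mgu : measurable_fun setT
        (fun v : R => ind (slice b tau X Y1 Y2 (u, u * v + 0)))%R.
      apply: (measurableT_comp mg); apply: measurable_funD; last exact: mcst.
      by apply: measurable_funM; [exact: mcst|exact: measurable_id].
    rewrite -(@ge0_integralZl_EFin _ _ R mu setT measurableT _
      (fun v _ => ind_ge0 _) mgu _ (ltW u0)).
    apply: eq_integral => m _; rewrite /H /K /I1 /pos u0/= -muleA -ind_and.
    congr (_ * ind _); rewrite /slice/= addr0 (ltW u0)/= slice_radial// IYE.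
    congr (_ && (_ && _)).
      by rewrite (_ : u * m * X = m * X * u)%R ?lteif_pM2r//; ring.
    by rewrite (_ : u * m * X = m * X * u)%R ?lteif_pM2r//; ring.
  (* On the line u = 0 the slice contains at most the point v = 0, which is negligible. *)
  - rewrite u0 [RHS]integral0_eq; last first.
      by move=> m _; rewrite /H /K /pos/= ltxx !mul0e.
    apply/eqP; rewrite eq_le integral_ge0 ?andbT; last by move=> ? _; exact: ind_ge0.
    apply: (@le_trans _ _ (\int[mu]_v (\1_[set 0%R] v)%:E)).
      apply: ge0_le_integral => //.
      + by move=> v _; exact: ind_ge0.
      + by rewrite -u0.
      + by apply/measurable_EFinP; exact: measurable_indic.
      + move=> v _; rewrite /slice/= !mulr0 lexx/= indicE /ind.
        case: ifPn => [/and3P[_ h1 h2]|_]; last by rewrite lee_fin.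
        rewrite mem_set//=; apply/eqP.
        have /andP[] : (0 <= v * X <= 0)%R by rewrite (lteifW h1) (lteifW h2).
        by rewrite pmulr_lge0// pmulr_lle0// => ? ?; rewrite eq_le; apply/andP.
    apply: (@le_trans _ _ (mu [set 0%R])); last by rewrite lebesgue_measure_set1.
    by rewrite integral_indic// setIT.
transitivity (\int[mu]_u \int[mu]_m H (u, m)).
  by apply: eq_integral => u _; exact: GH.
rewrite (@fubini_tonelli _ _ _ _ R mu mu H mH H0).
pose kap m := \int[mu]_u K (u, m).
have mkap : measurable_fun setT kap.
  exact: (measurable_fun_fubini_tonelli_G (m1 := mu) K mK K0).
transitivity (\int[mu]_m (ind (IY m) * kap m)).
  apply: eq_integral => m _; rewrite /kap -ge0_integralZl ?ind_ge0//.
  - by apply: eq_integral => u _; rewrite /H/= muleC.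
  - exact: (measurable_fun_pair1 m mK).
rewrite integral_ind_itv//.
have kapE m : (Y1 < m * X < Y2)%R ->
    kap m = (X ^+ 2 / (2 * (tau ^+ 2 - X ^+ 2 - (m * X) ^+ 2)))%:E.
  move=> /andP[m1' m2'].
  have := Hq ((m * X - Y1) / (Y2 - Y1))%R.
  have Y0 : (0 < Y2 - Y1)%R by rewrite subr_gt0.
  rewrite divr_gt0// ?subr_gt0//= ltr_pdivrMr// mul1r ltrD2r m2' => /(_ isT).
  rewrite divfK ?gt_eqF// [(Y1 + _)%R]addrC subrK => hq.
  have q0 : (0 < tau ^+ 2 - X ^+ 2 - (m * X) ^+ 2)%R by lra.
  set q := (tau ^+ 2 - X ^+ 2 - (m * X) ^+ 2)%R in q0 *.
  have qE : (tau ^+ 2 - X ^+ 2 * (1 + m ^+ 2) = q)%R by rewrite /q; ring.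
  have sq0 : (0 < Num.sqrt q)%R by rewrite sqrtr_gt0.
  have U0 : (0 <= X / Num.sqrt q)%R by rewrite divr_ge0 ?ltW.
  transitivity (\int[mu]_u (ind (u \in Interval (BSide false 0%R)
      (BSide (~~ b) (X / Num.sqrt q)%R)) * u%:E)).
    apply: eq_integral => u _; rewrite /K /I1 /pos/= in_itv/= qE negbK muleC.
    case: ifPn => u0; last by rewrite !mul0e.
    rewrite /=; congr (ind _ * _).
    rewrite lteif_pdivlMr// -(lteif_sqr (u * _)) ?(ltW X0)//; last first.
      by rewrite mulr_ge0// ltW.
    by rewrite exprMn sqr_sqrtr// ltW.
  rewrite integral_ind_itv// integral_id_itv//.
  rewrite exprMn exprVn sqr_sqrtr ?ltW//; congr EFin; field.
  by rewrite gt_eqF.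
have XY : (0 < (Y2 - Y1) / X)%R by rewrite divr_gt0// subr_gt0.
pose L m := ind (m \in `](Y1 / X), (Y2 / X)[)%R * kap m.
have kap0 m : 0 <= kap m by apply: integral_ge0 => u _.
have L0 m : 0 <= L m by rewrite mule_ge0 ?ind_ge0.
have mL : measurable_fun setT L.
  apply: emeasurable_funM => //; apply: measurable_ind.
  rewrite (_ : (fun m => _) = fun m => (Y1 / X < m) && (m < Y2 / X))%R; last first.
    by apply/funext => m; rewrite in_itv.
  apply: measurable_and; apply: measurable_fun_ltr => //; exact: measurable_id.
transitivity (\int[mu]_m L m).
  rewrite [LHS]integral_mkcond; apply: eq_integral => m _.
  by rewrite patchE mem_setE /L /ind; case: ifPn; rewrite ?mul1e ?mul0e.
rewrite (ge0_integral_affine ((Y2 - Y1) / X)%R (Y1 / X)%R _ XY mL L0).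
have maff : measurable_fun [set: R] (fun s : R => (Y2 - Y1) / X * s + Y1 / X)%R.
  apply: measurable_funD; last exact: mcst.
  by apply: measurable_funM; [exact: mcst|exact: measurable_id].
have mLa := measurableT_comp mL maff.
rewrite -(@ge0_integralZl_EFin _ _ R mu setT measurableT _ (fun v _ => L0 _) mLa _ (ltW XY)).
rewrite [RHS]integral_mkcond; apply: eq_integral => s _.
rewrite patchE mem_setE /L /ind !in_itv/=.
have -> : (Y1 / X < (Y2 - Y1) / X * s + Y1 / X)%R = (0 < s)%R.
  by rewrite -subr_gt0 addrK pmulr_rgt0.
have -> : ((Y2 - Y1) / X * s + Y1 / X < Y2 / X)%R = (s < 1)%R.
  rewrite -ltrBrDr -mulrBl -[ltRHS]mulr1 ltr_pM2l//.
case: ifPn => [/andP[s0 s1]|_]; last by rewrite mul0e mule0.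
have sX : (((Y2 - Y1) / X * s + Y1 / X) * X = Y1 + s * (Y2 - Y1))%R.
  by field; rewrite gt_eqF.
have Y0 : (0 < Y2 - Y1)%R by rewrite subr_gt0.
rewrite mul1e kapE sX; last first.
  rewrite ltrDl mulr_gt0//= -ltrBrDl -[ltRHS]mul1r ltr_pM2r//.
rewrite -EFinM; congr EFin.
have := Hq s; rewrite s0 s1 => /(_ isT) hq.
have q0 : (0 < tau ^+ 2 - X ^+ 2 - (Y1 + s * (Y2 - Y1)) ^+ 2)%R by lra.
by field; rewrite !gt_eqF.
Qed.

(* At height w the wedge is the triangle with apex 0 and vertices (X w, Y1 w) and
   (X w, Y2 w). *)
Definition wedge (b : bool) (r : R) (X Y1 Y2 : R -> R) (p : R * R * R) : bool :=
  let w := (p.1.1 ^+ 2 + p.1.2 ^+ 2 + p.2 ^+ 2)%R in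
  [&& (1 < w ?<= if b)%R, (w < r ^+ 2 ?<= if b)%R, (0 <= p.1.1)%R,
      (p.1.1 < X w ?<= if b)%R, (Y1 w * p.1.1 < p.1.2 * X w ?<= if b)%R &
      (p.1.2 * X w < Y2 w * p.1.1 ?<= if b)%R].

Lemma measurable_wedge b r X Y1 Y2 : measurable_fun setT X ->
  measurable_fun setT Y1 -> measurable_fun setT Y2 ->
  measurable_fun setT (wedge b r X Y1 Y2).
Proof.
move=> mX mY1 mY2.
have m11 := @measurable_coord1 R.
have m12 := @measurable_coord2 R.
have m2 := @measurable_coord3 R.
have mw : measurable_fun setT (fun p : R * R * R =>
    (p.1.1 ^+ 2 + p.1.2 ^+ 2 + p.2 ^+ 2))%R.
  by do 2 ?apply: measurable_funD; exact: measurable_funX.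
have mc (c : R) : measurable_fun setT (fun _ : R * R * R => c).
  exact: measurable_cst.
have mXw := measurableT_comp mX mw.
have mY1w := measurableT_comp mY1 mw.
have mY2w := measurableT_comp mY2 mw.
apply: measurable_and; first exact: measurable_lteif.
apply: measurable_and; first exact: measurable_lteif.
apply: measurable_and; first exact: measurable_fun_ler.
apply: measurable_and; first exact: measurable_lteif.
by apply: measurable_and; apply: measurable_lteif => //; exact: measurable_funM.
Qed.

(** The integrand of [slice_area] at tau = t, times the density 1 / t. The last factor of the
    denominator is the square of the height [ht] of the point of the face at level w and position
    s. *)
Definition face_density (X Y1 Y2 : R -> R) (s t : R) : R :=
  (let w := t ^+ 2 in
   (Y2 w - Y1 w) * X w /
   (2 * t * (w - X w ^+ 2 - (Y1 w + s * (Y2 w - Y1 w)) ^+ 2)))%R.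

(** Dividing t by [nu] makes t the Euclidean norm of the point, so that w = t^2 is constant on a
    slice. Tonelli's theorem then leaves an integral of slice areas over dt / t. *)
Lemma hvol_wedge b (r : R) (X Y1 Y2 : R -> R) : (1 < r)%R ->
  measurable_fun setT X -> measurable_fun setT Y1 -> measurable_fun setT Y2 ->
  (forall w, 1 < w < r ^+ 2 -> [/\ 0 < X w, Y1 w < Y2 w &
    forall s, 0 < s < 1 -> X w ^+ 2 + (Y1 w + s * (Y2 w - Y1 w)) ^+ 2 < w])%R ->
  hvol (fun p => ind (wedge b r X Y1 Y2 p)) =
  \int[mu]_(s in `]0%R, 1%R[) \int[mu]_(t in `]1%R, r[)
    (face_density X Y1 Y2 s t)%:E.
Proof.
move=> r1 mX mY1 mY2 HE.
have mwd := measurable_ind _ _ _ (measurable_wedge b r X Y1 Y2 mX mY1 mY2).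
have m1 : measurable_fun setT (fun q : R * R => q.1) by exact: measurable_fst.
have m2 : measurable_fun setT (fun q : R * R => q.2) by exact: measurable_snd.
rewrite (hvol_projective _ mwd (fun p => ind_ge0 _)).
pose S (q : R * R) (t : R) :=
  wedge b r X Y1 Y2 ((nu q)^-1 * t * q.1, (nu q)^-1 * t * q.2, (nu q)^-1 * t)%R.
pose k (p : R * R * R) := ind (S p.1 p.2) * (posinv p.2)%:E.
have k0 p : 0 <= k p by rewrite mule_ge0 ?ind_ge0// lee_fin posinv_ge0.
have mk : measurable_fun setT k.
  have m11 := @measurable_coord1 R.
  have m12 := @measurable_coord2 R.
  have mt : measurable_fun setT (fun p : R * R * R => p.2).
    exact: measurable_snd.
  have mnu : measurable_fun setT (fun p : R * R * R => (nu p.1)^-1 * p.2)%R.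
    apply: measurable_funM => //; apply: (measurableT_comp measurable_invr).
    by apply: (measurableT_comp measurable_nu); exact: measurable_fst.
  apply: measurable_haar_integrand => //; apply: (measurableT_comp mwd).
  apply: measurable_fun_pair => //.
  by apply: measurable_fun_pair; exact: measurable_funM.
transitivity (\int[mu2]_q \int[mu]_t k (q, t)).
  apply: eq_integral => q _.
  have mq : measurable_fun setT
      (fun t : R => ind (wedge b r X Y1 Y2 (t * q.1, t * q.2, t)%R)).
    apply: (measurableT_comp mwd); apply: measurable_fun_pair.
      apply: measurable_fun_pair; (apply: measurable_funM; last exact: measurable_cst);
      exact: measurable_id.
    exact: measurable_id.
  have n0 : (0 < (nu q)^-1)%R by rewrite invr_gt0 nu_gt0.
  by rewrite -(haar_scale _ _ n0 mq (fun t => ind_ge0 _)).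
rewrite (@fubini_tonelli _ _ _ _ R mu2 mu k mk k0).
pose h (t s : R) : R := face_density X Y1 Y2 s t.
have trI t : (1 < t < r)%R -> (0 < t)%R /\ (1 < t ^+ 2 < r ^+ 2)%R.
  move=> /andP[t1 tr]; have t0 : (0 < t)%R by exact: lt_trans t1.
  split=> //; rewrite -[ltLHS](expr1n _ 2) !ltr_pXn2r ?nnegrE ?t1 ?tr//= ltW//.
  exact: lt_trans tr.
have h0 t s : (1 < t < r)%R -> (0 < s < 1)%R -> (0 <= h t s)%R.
  move=> /trI[t0 /HE[X0 Y12 hq]] s01; rewrite /h /face_density/=; have := hq _ s01.
  move=> q0; rewrite divr_ge0//.
    by rewrite mulr_ge0 ?ltW// subr_gt0.
  by rewrite mulr_ge0 ?mulr_ge0// ?ltW//; lra.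
pose g (p : R * R) := ind (p.1 \in `]1%R, r[) * (ind (p.2 \in `]0%R, 1%R[) * (h p.1 p.2)%:E).
have g0 p : 0 <= g p.
  rewrite /g /ind; case: ifPn; rewrite ?mul0e// mul1e => i1.
  case: ifPn; rewrite ?mul0e// mul1e => i2.
  by move: i1 i2; rewrite !in_itv/= lee_fin => i1 i2; exact: h0.
have mitv (x y : R) : measurable_fun setT (fun z : R => z \in `]x, y[).
  rewrite (_ : (fun z => _) = fun z => (x < z) && (z < y))%R; last first.
    by apply/funext => z; rewrite in_itv.
  apply: measurable_and; apply: measurable_fun_ltr => //; exact: measurable_id.
have mg : measurable_fun setT g.
  apply: emeasurable_funM.
    by apply: measurable_ind; exact: (measurableT_comp (mitv _ _) measurable_fst).
  apply: emeasurable_funM.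
    by apply: measurable_ind; exact: (measurableT_comp (mitv _ _) measurable_snd).
  apply/measurable_EFinP.
  have mw : measurable_fun setT (fun p : R * R => p.1 ^+ 2)%R.
    exact: measurable_funX.
  have mXw := measurableT_comp mX mw.
  have mY1w := measurableT_comp mY1 mw.
  have mY2w := measurableT_comp mY2 mw.
  apply: measurable_funM.
    by apply: measurable_funM => //; exact: measurable_funB.
  apply: (measurableT_comp measurable_invr); apply: measurable_funM.
    by apply: measurable_funM => //; exact: measurable_cst.
  apply: measurable_funB.
    by apply: measurable_funB => //; exact: measurable_funX.
  apply: measurable_funX; apply: measurable_funD => //.
  by apply: measurable_funM => //; exact: measurable_funB.
transitivity (\int[mu]_t \int[mu]_s g (t, s)); last first.
  rewrite (@fubini_tonelli _ _ _ _ R mu mu g mg g0).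
  rewrite [RHS]integral_mkcond; apply: eq_integral => s _.
  rewrite patchE mem_setE; case: ifPn => s01.
    rewrite [RHS]integral_mkcond; apply: eq_integral => t _.
    by rewrite patchE mem_setE /g/= s01 mul1e /ind; case: ifPn; rewrite ?mul1e ?mul0e.
  by rewrite integral0_eq// => t _; rewrite /g/= (negbTE s01) /= mul0e mule0.
pose J t := \int[mu2]_q k (q, t).
have mJ : measurable_fun setT J.
  exact: (measurable_fun_fubini_tonelli_G (m1 := mu2) k mk k0).
have nuE q t : (((nu q)^-1 * t * q.1) ^+ 2 + ((nu q)^-1 * t * q.2) ^+ 2 +
      ((nu q)^-1 * t) ^+ 2 = t ^+ 2)%R.
  rewrite !exprMn exprVn sqr_nu; field.
  by rewrite -sqr_nu sqrf_eq0 gt_eqF// nu_gt0.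
(* Outside [1, r] the slice is empty, because the wedge requires w = t^2 to be between 1 and r^2. *)
transitivity (\int[mu]_t (ind (t \in Interval (BSide true 1%R) (BSide false r)) * J t)).
  apply: eq_integral => t _; rewrite /ind; case: ifPn => [_|ti].
    by rewrite mul1e.
  rewrite mul0e; apply: integral0_eq => q _; rewrite /k /posinv/=.
  case: ifPn => t0; last by rewrite mule0.
  have -> : S q t = false; last by rewrite mul0e.
  rewrite /S /wedge/= nuE; apply/negP => /and3P[/lteifW h1 /lteifW h2 _].
  move: ti; rewrite in_itv/= => /negP; apply; apply/andP; split.
    by rewrite -(@ler_pXn2r _ 2) ?nnegrE ?expr1n// ltW.
  by rewrite -(@ler_pXn2r _ 2) ?nnegrE// ltW// (lt_trans _ r1).
rewrite integral_ind_itv// [LHS]integral_mkcond; apply: eq_integral => t _.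
rewrite patchE mem_setE; case: ifPn => ti; last first.
  by rewrite integral0_eq// => s _; rewrite /g/= (negbTE ti) /= mul0e.
have /trI[t0 t2] : (1 < t < r)%R by move: ti; rewrite in_itv.
have [X0 Y12 hq] := HE _ t2.
have tn q : (0 < (nu q)^-1 * t)%R by rewrite mulr_gt0// invr_gt0 nu_gt0.
have SE q : S q t = slice b t (X (t ^+ 2)%R) (Y1 (t ^+ 2)%R) (Y2 (t ^+ 2)%R) q.
  move/andP: t2 => [t21 t22].
  rewrite /S /wedge/= nuE /slice (_ : (1 < t ^+ 2 ?<= if b)%R = true); last exact: lteifS.
  rewrite (_ : (t ^+ 2 < r ^+ 2 ?<= if b)%R = true)/=; last exact: lteifS.
  rewrite pmulr_rge0//; congr [&& _, _, _ & _].
  - by rewrite -mulrA mulrC.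
  - by rewrite mulrCA -[(_ * t * q.2 * _)%R]mulrA lteif_pM2l.
  - by rewrite mulrCA -[(_ * t * q.2 * _)%R]mulrA lteif_pM2l.
have mSl := measurable_ind _ _ _
  (measurable_slice b t (X (t ^+ 2)%R) (Y1 (t ^+ 2)%R) (Y2 (t ^+ 2)%R)).
transitivity ((t^-1)%:E * \int[mu2]_q
    ind (slice b t (X (t ^+ 2)%R) (Y1 (t ^+ 2)%R) (Y2 (t ^+ 2)%R) q)).
  rewrite -(@ge0_integralZl_EFin _ _ R mu2 setT measurableT _
    (fun q _ => ind_ge0 _) mSl); last first.
    by rewrite invr_ge0 ltW.
  by apply: eq_integral => q _; rewrite /k /posinv/= t0 SE muleC.
rewrite (slice_area _ _ _ _ _ t0 X0 Y12 hq).
rewrite -ge0_integralZl//; last 3 first.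
- apply: measurable_funTS; apply/measurable_EFinP.
  apply: measurable_funM; first exact: measurable_cst.
  apply: (measurableT_comp measurable_invr).
  apply: measurable_funM; first exact: measurable_cst.
  apply: measurable_funB; first exact: measurable_cst.
  apply: measurable_funX; apply: measurable_funD; first exact: measurable_cst.
  by apply: measurable_funM; [exact: measurable_id|exact: measurable_cst].
- move=> s /=; rewrite in_itv/= => /hq q0.
  rewrite lee_fin divr_ge0//; first by rewrite mulr_ge0 ?ltW// subr_gt0.
  by rewrite mulr_ge0//; lra.
- by rewrite lee_fin invr_ge0 ltW.
rewrite [LHS]integral_mkcond; apply: eq_integral => s _.
rewrite patchE mem_setE /g/= ti mul1e /ind; case: ifPn => si; last by rewrite mul0e.
rewrite mul1e -EFinM; congr EFin; rewrite /h /face_density/=.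
have := si; rewrite in_itv/= => /hq q0.
have q1 : (0 < t ^+ 2 - X (t ^+ 2)%R ^+ 2 - (Y1 (t ^+ 2)%R +
  s * (Y2 (t ^+ 2)%R - Y1 (t ^+ 2)%R)) ^+ 2)%R by lra.
by field; rewrite !gt_eqF.
Qed.
End wedge.

(** * Isometries preserve the volume *)

Section hspace_basics.
Context {R : realType}.
Implicit Types p q : hspace R.

Lemma hspace_eq p q : hz p = hz q -> ht p = ht q -> p = q.
Proof.
case: p => z t t0; case: q => z' t' t0' /= ez et.
by subst z' t'; congr HPoint; exact: bool_irrelevance.
Qed.

Lemma complex_eq (z w : R[i]) : complex.Re z = complex.Re w ->
  complex.Im z = complex.Im w -> z = w.
Proof. by case: z => a b; case: w => c d /= -> ->. Qed.

Lemma ReD (z w : R[i]) : complex.Re (z + w) = complex.Re z + complex.Re w.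
Proof. by case: z => a b; case: w. Qed.
Lemma ImD (z w : R[i]) : complex.Im (z + w) = complex.Im z + complex.Im w.
Proof. by case: z => a b; case: w. Qed.
Lemma ReN (z : R[i]) : complex.Re (- z) = - complex.Re z.
Proof. by case: z. Qed.
Lemma ImN (z : R[i]) : complex.Im (- z) = - complex.Im z.
Proof. by case: z. Qed.
Lemma ReM (z w : R[i]) : complex.Re (z * w) =
  complex.Re z * complex.Re w - complex.Im z * complex.Im w.
Proof. by case: z => a b; case: w. Qed.
Lemma ImM (z w : R[i]) : complex.Im (z * w) =
  complex.Re z * complex.Im w + complex.Im z * complex.Re w.
Proof. by case: z => a b; case: w. Qed.

Lemma sqr_modulus (z : R[i]) :
  modulus z ^+ 2 = complex.Re z ^+ 2 + complex.Im z ^+ 2.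
Proof.
by case: z => a b; rewrite /modulus /Normc.normc sqr_sqrtr// addr_ge0 ?sqr_ge0.
Qed.

Definition hx p := complex.Re (hz p).
Definition hy p := complex.Im (hz p).
Definition hw p := hx p ^+ 2 + hy p ^+ 2 + ht p ^+ 2.

Lemma hspace_eqxyt p q : hx p = hx q -> hy p = hy q -> ht p = ht q -> p = q.
Proof. by move=> ex ey et; apply: hspace_eq => //; exact: complex_eq. Qed.

Lemma hw_gt0 p : 0 < hw p.
Proof. by rewrite /hw ltr_wpDl ?addr_ge0 ?sqr_ge0// exprn_gt0// ht_gt0. Qed.

(* The hyperbolic cosine of the distance, i.e. minus the Minkowski product of
   (hz, 1, hw) / ht at p and q. *)
Definition coshd p q := (hw p + hw q - 2 * (hx p * hx q + hy p * hy q))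
  / (2 * ht p * ht q).

Lemma coshd_sub1 p q : coshd p q = 1 + ((hx p - hx q) ^+ 2 + (hy p - hy q) ^+ 2
   + (ht p - ht q) ^+ 2) / (2 * ht p * ht q).
Proof.
rewrite /coshd /hw; have := ht_gt0 p; have := ht_gt0 q => q0 p0.
by field; rewrite !gt_eqF.
Qed.

Lemma coshd_ge1 p q : 1 <= coshd p q.
Proof.
rewrite coshd_sub1 lerDl divr_ge0// ?addr_ge0 ?sqr_ge0//.
by rewrite !mulr_ge0// ltW// ht_gt0.
Qed.

Lemma coshd_eq1 p q : coshd p q = 1 -> p = q.
Proof.
rewrite coshd_sub1 => /eqP; rewrite -subr_eq0 addrC addKr mulf_eq0 invr_eq0.
rewrite !mulf_eq0 pnatr_eq0/= ![ht _ == 0]gt_eqF ?ht_gt0//= !orbF.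
rewrite paddr_eq0 ?addr_ge0 ?sqr_ge0// paddr_eq0 ?sqr_ge0// !sqrf_eq0 !subr_eq0.
by move=> /andP[/andP[/eqP ? /eqP ?] /eqP ?]; exact: hspace_eqxyt.
Qed.

(** The exponential of [arcosh]. For x >= 1 its inverse is the conjugate expression, so x is
    recovered as the half-sum of both, and sums of distances become products. *)
Definition exp_arcosh (x : R) := x + Num.sqrt (x ^+ 2 - 1).

Lemma exp_arcosh_ge1 x : 1 <= x -> 1 <= exp_arcosh x.
Proof. by move=> x1; rewrite /exp_arcosh ler_wpDr// sqrtr_ge0. Qed.

Lemma exp_arcoshV x : 1 <= x -> (exp_arcosh x)^-1 = x - Num.sqrt (x ^+ 2 - 1).
Proof.
move=> x1; have e0 := lt_le_trans ltr01 (exp_arcosh_ge1 _ x1).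
have e1 : exp_arcosh x != 0 by rewrite gt_eqF.
apply: (mulfI e1); rewrite mulfV// /exp_arcosh mulrC -subr_sqr sqr_sqrtr; first by ring.
by rewrite subr_ge0 -[leLHS](expr1n _ 2) ler_pXn2r// nnegrE; lra.
Qed.

Lemma exp_arcoshK x : 1 <= x -> (exp_arcosh x + (exp_arcosh x)^-1) / 2 = x.
Proof. by move=> x1; rewrite exp_arcoshV// /exp_arcosh; field. Qed.

Lemma arcosh_inj (x y : R) : 1 <= x -> 1 <= y -> arcosh x = arcosh y -> x = y.
Proof.
move=> x1 y1 xy; rewrite -(exp_arcoshK x)// -(exp_arcoshK y)//.
suff -> : exp_arcosh x = exp_arcosh y by [].
by apply: ln_inj => //; rewrite posrE (lt_le_trans ltr01)// exp_arcosh_ge1.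
Qed.

Lemma hdistE p q : hdist p q = arcosh (coshd p q).
Proof.
rewrite /hdist coshd_sub1 sqr_modulus ReD ImD ReN ImN; congr (arcosh (_ + _ / _)).
Qed.

Lemma hdist_coshd p q p' q' :
  hdist p q = hdist p' q' <-> coshd p q = coshd p' q'.
Proof.
rewrite !hdistE; split; last by move=> ->.
by apply: arcosh_inj; exact: coshd_ge1.
Qed.

Definition htranslate (a b : R) p : hspace R :=
  @HPoint R (hz p + (a +i* b)) (ht p) (ht_gt0 p).

Lemma hinv_ht_gt0 (k : R) (k0 : 0 < k) p : 0 < k * ht p / hw p.
Proof. by rewrite divr_gt0 ?hw_gt0// mulr_gt0// ht_gt0. Qed.

(** The inversion in the hemisphere |z|^2 + t^2 = k; the parameter is the squared radius. *)
Definition hinv (k : R) (k0 : 0 < k) p : hspace R :=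
  @HPoint R ((k * hx p / hw p) +i* (k * hy p / hw p)) _ (hinv_ht_gt0 k k0 p).

Lemma hx_translate a b p : hx (htranslate a b p) = hx p + a.
Proof. by rewrite /hx /= ReD. Qed.
Lemma hy_translate a b p : hy (htranslate a b p) = hy p + b.
Proof. by rewrite /hy /= ImD. Qed.

Lemma htranslateK a b : cancel (htranslate a b) (htranslate (- a) (- b)).
Proof.
by move=> p; apply: hspace_eqxyt; rewrite ?hx_translate ?hy_translate ?addrK.
Qed.

Lemma hx_inv k k0 p : hx (hinv k k0 p) = k * hx p / hw p. Proof. by []. Qed.
Lemma hy_inv k k0 p : hy (hinv k k0 p) = k * hy p / hw p. Proof. by []. Qed.
Lemma ht_inv k k0 p : ht (hinv k k0 p) = k * ht p / hw p. Proof. by []. Qed.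

Lemma hw_inv k k0 p : hw (hinv k k0 p) = k ^+ 2 / hw p.
Proof.
have w0 := hw_gt0 p; rewrite {1}/hw hx_inv hy_inv ht_inv.
transitivity (k ^+ 2 * (hx p ^+ 2 + hy p ^+ 2 + ht p ^+ 2) / hw p ^+ 2).
  by field; rewrite gt_eqF.
by rewrite -/(hw p); field; rewrite gt_eqF.
Qed.

Lemma hinvK k k0 : involutive (hinv k k0).
Proof.
move=> p; have w0 := hw_gt0 p.
by apply: hspace_eqxyt; rewrite ?(hx_inv, hy_inv, ht_inv) hw_inv; field;
  rewrite ?(gt_eqF k0) ?(gt_eqF w0).
Qed.

Lemma coshd_translate a b p q :
  coshd (htranslate a b p) (htranslate a b q) = coshd p q.
Proof.
rewrite !coshd_sub1 !hx_translate !hy_translate/=.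
by congr (_ + _ / _); ring.
Qed.

Lemma coshd_inv k k0 p q : coshd (hinv k k0 p) (hinv k k0 q) = coshd p q.
Proof.
have w0 := hw_gt0 p; have v0 := hw_gt0 q.
have t0 := ht_gt0 p; have s0 := ht_gt0 q.
rewrite /coshd !hw_inv !(hx_inv, hy_inv, ht_inv); field.
by rewrite (gt_eqF k0) (gt_eqF w0) (gt_eqF v0) (gt_eqF t0) (gt_eqF s0).
Qed.

End hspace_basics.

Section volume.
Context {R : realType}.
Implicit Types (p q : hspace R) (A B : set (hspace R)).
Local Notation mu := (@lebesgue_measure R).

(** The integral of a nonnegative function is a supremum over the simple functions below it, hence
    monotone for arbitrary functions. The drum is compared with its pieces through this. *)
Lemma ge0_le_integral_nomeas d (T : measurableType d)
    (m : {measure set T -> \bar R}) (f g : T -> \bar R) :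
  (forall x, 0 <= f x)%E -> (forall x, f x <= g x)%E ->
  (\int[m]_x f x <= \int[m]_x g x)%E.
Proof.
move=> f0 fg; have g0 x : (0 <= g x)%E by exact: le_trans (fg x).
rewrite !ge0_integralTE//; apply: le_ereal_sup => _ [h hf <-].
by exists h => // x; exact: le_trans (fg x).
Qed.

Lemma hcoords_gt0 A x : (hcoords @` A) x -> 0 < x.2.
Proof. by move=> [p _ <-]; exact: ht_gt0. Qed.

Lemma hcoordsE p : hcoords p = (hx p, hy p, ht p).
Proof. by []. Qed.

Lemma hcoords_inj : injective (@hcoords R).
Proof.
by move=> p q; rewrite !hcoordsE => -[ex ey et]; exact: hspace_eqxyt.
Qed.

Lemma hcoords_image A p : (hcoords @` A) (hcoords p) <-> A p.
Proof.
by split=> [[q Aq /hcoords_inj <-]//|Ap]; exists p.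
Qed.

Lemma hcoords_surj x y t : 0 < t -> exists p, hcoords p = (x, y, t).
Proof. by move=> t0; exists (@HPoint R (x +i* y) t t0). Qed.

Lemma hvolumeE A :
  hvolume A = hvol (fun x => ind (x \in hcoords @` A)).
Proof.
rewrite /hvolume [LHS]integral_mkcond; apply: eq_integral => -[[x y] t] _.
rewrite patchE /ind; case: ifPn; last by rewrite mul0e.
by rewrite inE => /hcoords_gt0 /= t0; rewrite mul1e /posinv t0 exprVn.
Qed.

Definition hmeasurable A := measurable (hcoords @` A).

(** Preimages compose without mention of inverse maps, and [drum_preimage] presents every drum as a
    preimage. *)
Definition vol_pres (f : hspace R -> hspace R) := forall A, hmeasurable A ->
  hmeasurable (f @^-1` A) /\ hvolume (f @^-1` A) = hvolume A.

Lemma vol_pres_comp f g : vol_pres f -> vol_pres g -> vol_pres (f \o g).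
Proof.
by move=> vf vg A /vf[/vg[m <-] <-].
Qed.

Let measurable_upper : measurable [set x : R * R * R | 0 < x.2].
Proof.
rewrite (_ : [set x | _] = snd @^-1` `]0, +oo[%classic); last first.
  by apply/seteqP; split=> x /=; rewrite in_itv/= andbT.
by rewrite -[X in measurable X]setTI; apply: measurable_snd.
Qed.

Lemma vol_pres_coords (f : hspace R -> hspace R)
    (F : R * R * R -> R * R * R) : measurable_fun setT F ->
  (forall p, hcoords (f p) = F (hcoords p)) ->
  (forall h, measurable_fun setT h -> (forall x, 0 <= h x)%E ->
    hvol (h \o F) = hvol h) -> vol_pres f.
Proof.
move=> mF fF volF A mA.
have imE : hcoords @` (f @^-1` A) =
    [set x | 0 < x.2] `&` F @^-1` (hcoords @` A).
  apply/seteqP; split=> [_ [p Ap <-]|[[x y] t] [/= t0 [q Aq qE]]].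
    by split; [exact: ht_gt0|exists (f p) => //; rewrite fF].
  have [p pE] := hcoords_surj x y t t0; exists p => //=.
  suff -> : f p = q by [].
  by apply: hcoords_inj; rewrite fF pE qE.
split.
  rewrite /hmeasurable imE; apply: measurableI; first exact: measurable_upper.
  by rewrite -[X in measurable X]setTI; exact: mF.
have mh : measurable_fun setT (fun x : R * R * R => ind (x \in hcoords @` A) : \bar R).
  apply: measurable_ind; apply: (measurable_fun_bool true) => //.
  rewrite setTI (_ : _ @^-1` _ = hcoords @` A)//.
  by apply/seteqP; split=> x; [exact: set_mem|exact: mem_set].
rewrite !hvolumeE -[RHS](volF _ mh (fun x => ind_ge0 _)).
apply: eq_hvol => x y t t0 /=; congr ind.
by rewrite imE; apply/idP/idP; rewrite !inE => //=; case.
Qed.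

Lemma vol_pres_translate a b : vol_pres (@htranslate R a b).
Proof.
apply: (@vol_pres_coords _ (fun x => (x.1.1 + a, x.1.2 + b, x.2))).
- have m11 : measurable_fun setT (fun p : R * R * R => p.1.1).
    by apply: (measurableT_comp measurable_fst); exact: measurable_fst.
  have m12 := @measurable_coord2 R.
  apply: measurable_fun_pair; last exact: measurable_snd.
  by apply: measurable_fun_pair; apply: measurable_funD => //; exact: measurable_cst.
- by move=> p; rewrite !hcoordsE hx_translate hy_translate.
- by move=> h mh h0; exact: hvol_translation.
Qed.

Lemma vol_pres_inv k k0 : vol_pres (@hinv R k k0).
Proof.
apply: (@vol_pres_coords _ (inversion_coords k)).
- exact: measurable_inversion_coords.
- by [].
- by move=> h mh h0; exact: hvol_inversion.
Qed.

Definition cosh_pres (f : hspace R -> hspace R) :=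
  forall p q, coshd (f p) (f q) = coshd p q.

(** The properties used of the reflection in the perpendicular bisector of p and q; the last clause
    says that the bisector is fixed pointwise. *)
Definition mirror p q (s : hspace R -> hspace R) :=
  [/\ involutive s, cosh_pres s, vol_pres s, s p = q &
      forall x, coshd x p = coshd x q -> s x = x].

Definition hinvc (a b k : R) (k0 : 0 < k) p :=
  htranslate a b (hinv k k0 (htranslate (- a) (- b) p)).

Lemma hinvcK a b k k0 : involutive (hinvc a b k k0).
Proof.
move=> p; rewrite /hinvc htranslateK hinvK.
by rewrite -[RHS](htranslateK (- a) (- b)) !opprK.
Qed.

Lemma cosh_pres_hinvc a b k k0 : cosh_pres (hinvc a b k k0).
Proof. by move=> p q; rewrite coshd_translate coshd_inv coshd_translate. Qed.

Lemma vol_pres_hinvc a b k k0 : vol_pres (hinvc a b k k0).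
Proof.
apply: (vol_pres_comp (htranslate a b)); first exact: vol_pres_translate.
apply: vol_pres_comp; first exact: vol_pres_inv.
exact: vol_pres_translate.
Qed.

Lemma hinvc_coords a b k k0 p (N := (hx p - a) ^+ 2 + (hy p - b) ^+ 2 + ht p ^+ 2) :
  [/\ 0 < N, hx (hinvc a b k k0 p) = a + k * (hx p - a) / N,
   hy (hinvc a b k k0 p) = b + k * (hy p - b) / N &
   ht (hinvc a b k k0 p) = k * ht p / N].
Proof.
have NE : hw (htranslate (- a) (- b) p) = N.
  by rewrite /hw hx_translate hy_translate.
rewrite /hinvc hx_translate hy_translate hx_inv hy_inv /= NE.
by rewrite hx_translate hy_translate -NE hw_gt0; split => //; rewrite addrC.
Qed.

(* The inversion centered at the intersection of the boundary plane with the line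
   through p and q. *)
Lemma mirror_ht_neq p q : ht p != ht q -> exists s, mirror p q s.
Proof.
move=> pq; have tp0 := ht_gt0 p; have tq0 := ht_gt0 q.
have d0 : ht p - ht q != 0 by rewrite subr_eq0.
pose a := (ht p * hx q - ht q * hx p) / (ht p - ht q).
pose b := (ht p * hy q - ht q * hy p) / (ht p - ht q).
pose N := (hx p - a) ^+ 2 + (hy p - b) ^+ 2 + ht p ^+ 2.
have N0 : 0 < N by rewrite ltr_wpDl ?addr_ge0 ?sqr_ge0// exprn_gt0.
(* The inversion multiplies the offset of p from the center by k / N, and the offset of q is ht q /
   ht p times that of p. *)
have k0 : 0 < N * ht q / ht p by rewrite divr_gt0// mulr_gt0.
exists (hinvc a b _ k0); split.
- exact: hinvcK.
- exact: cosh_pres_hinvc.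
- exact: vol_pres_hinvc.
- have [_] := hinvc_coords a b _ k0 p; rewrite -/N => ex ey et.
  apply: hspace_eqxyt; rewrite ?ex ?ey ?et; last first.
  + by field; rewrite ?(gt_eqF N0) ?(gt_eqF tp0).
  + rewrite [X in b + X](_ : _ = ht q * (hy p - b) / ht p).
      by rewrite /b; field; rewrite d0 gt_eqF.
    by field; rewrite ?(gt_eqF N0) ?(gt_eqF tp0).
  + rewrite [X in a + X](_ : _ = ht q * (hx p - a) / ht p).
      by rewrite /a; field; rewrite d0 gt_eqF.
    by field; rewrite ?(gt_eqF N0) ?(gt_eqF tp0).
- move=> x xpq; have tx0 := ht_gt0 x.
  have [M0] := hinvc_coords a b _ k0 x.
  set M := (hx x - a) ^+ 2 + (hy x - b) ^+ 2 + ht x ^+ 2 in M0 *.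
  (* A point equidistant from p and q lies on the hemisphere of the inversion. Equidistance is
     linear in [hw x], and [wx] is its solution. *)
  have MN : M = N * ht q / ht p.
    have wx : hw x = (ht q * (hw p - 2 * (hx x * hx p + hy x * hy p)) -
        ht p * (hw q - 2 * (hx x * hx q + hy x * hy q))) / (ht p - ht q).
      apply: (mulIf d0); rewrite divfK//; move: xpq; rewrite /coshd => /eqP.
      have x2 : 2 * ht x != 0 by rewrite mulf_neq0 ?pnatr_eq0// gt_eqF.
      rewrite eqr_div ?(mulf_neq0 x2) ?(gt_eqF tp0) ?(gt_eqF tq0)// => /eqP xpq.
      apply: (mulfI x2).
      lra.
    transitivity (hw x - 2 * (hx x * a + hy x * b) + a ^+ 2 + b ^+ 2).
      by rewrite /M /hw; ring.
    rewrite wx /N /a /b /hw; field.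
    by rewrite d0 gt_eqF.
  rewrite MN => ex ey et.
  have kk : N * ht q / ht p != 0 by rewrite gt_eqF.
  by apply: hspace_eqxyt; rewrite ?ex ?ey ?et; rewrite mulrAC divff// ?mul1r// addrC subrK.
Qed.

(** At equal heights the inversion centered below p separates them: p goes to height 1 / ht p and q
    strictly lower. The mirror found there is conjugated back. *)
Lemma mirror_exists p q : p <> q -> exists s, mirror p q s.
Proof.
move=> pq; have [tpq|] := eqVneq (ht p) (ht q); last exact: mirror_ht_neq.
pose s := hinvc (hx p) (hy p) 1 ltr01.
have sK : involutive s by exact: hinvcK.
have cs : cosh_pres s by exact: cosh_pres_hinvc.
have vs : vol_pres s by exact: vol_pres_hinvc.
have [s' [s'K cs' vs' s'p s'x]] : exists s', mirror (s p) (s q) s'.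
  apply: mirror_ht_neq.
  have [Np _ _ ->] := hinvc_coords (hx p) (hy p) 1 ltr01 p.
  have [Nq _ _ ->] := hinvc_coords (hx p) (hy p) 1 ltr01 q.
  rewrite !mul1r -tpq; apply/negP => /eqP /(mulfI _) h.
  have /invr_inj := h (lt0r_neq0 (ht_gt0 p)).
  rewrite !subrr expr0n/= !add0r => /esym/eqP.
  rewrite tpq -subr_eq0 addrK paddr_eq0 ?sqr_ge0// !sqrf_eq0 !subr_eq0.
  move=> /andP[/eqP e1 /eqP e2]; apply: pq.
  by apply: hspace_eqxyt.
exists (s \o s' \o s); split.
- by move=> x /=; rewrite sK s'K sK.
- by move=> x y /=; rewrite cs cs' cs.
- by apply: vol_pres_comp => //; exact: vol_pres_comp.
- by rewrite /= s'p sK.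
- by move=> x xpq /=; rewrite s'x ?sK// !cs.
Qed.

(** The distances to the four points determine a point: p0 and p1, both on the axis, give [ht] and
    then [hw], while p2 and p3 give [hx] and [hy]. *)
Lemma cosh_pres_fix f : cosh_pres f -> forall p0 p1 p2 p3,
  hcoords p0 = (0, 0, 1) -> hcoords p1 = (0, 0, 2) ->
  hcoords p2 = (1, 0, 1) -> hcoords p3 = (0, 1, 1) ->
  f p0 = p0 -> f p1 = p1 -> f p2 = p2 -> f p3 = p3 -> forall x, f x = x.
Proof.
move=> cf p0 p1 p2 p3.
rewrite !hcoordsE => -[x0 y0 t0] [x1 y1 t1] [x2 y2 t2] [x3 y3 t3] f0 f1 f2 f3 x.
have := cf x p0; have := cf x p1; have := cf x p2; have := cf x p3.
rewrite f0 f1 f2 f3 /coshd; have tx0 := ht_gt0 x; have tf0 := ht_gt0 (f x).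
have e p c : ht p = c -> 0 < c -> 2 * ht x * ht p != 0 /\ 2 * ht (f x) * ht p != 0.
  by move=> -> c0; split; rewrite !mulf_neq0 ?pnatr_eq0 ?gt_eqF.
have [] := e _ _ t0 ltr01; have [] := e _ _ t1 (ltr0Sn R 1).
have [] := e _ _ t2 ltr01; have [] := e _ _ t3 ltr01.
have w0 : hw p0 = 1 by rewrite /hw x0 y0 t0; ring.
have w1 : hw p1 = 4 by rewrite /hw x1 y1 t1; ring.
have w2 : hw p2 = 2 by rewrite /hw x2 y2 t2; ring.
have w3 : hw p3 = 2 by rewrite /hw x3 y3 t3; ring.
rewrite w0 w1 w2 w3 x0 y0 t0 x1 y1 t1 x2 y2 t2 x3 y3 t3.
move=> d3 d3' d2 d2' d1 d1' d0 d0'.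
move=> /eqP; rewrite eqr_div// => /eqP h3 /eqP; rewrite eqr_div// => /eqP h2.
move=> /eqP; rewrite eqr_div// => /eqP h1 /eqP; rewrite eqr_div// => /eqP h0.
have tt : ht (f x) = ht x by lra.
rewrite tt in h0 h1 h2 h3.
have t20 : ht x * 2 != 0 by rewrite mulf_neq0 ?pnatr_eq0 ?gt_eqF.
have hh0 : hw (f x) = hw x.
  by apply: (mulIf t20); lra.
rewrite hh0 in h2 h3.
apply: hspace_eqxyt => //; apply: (mulIf t20); lra.
Qed.

(* An isometry is a product of at most four mirrors, found by fixing successively
   four points that are not on a common plane. *)
Theorem cosh_pres_vol_pres f : cosh_pres f -> vol_pres f.
Proof.
have step (g : hspace R -> hspace R) (P : hspace R -> Prop) (p : hspace R) :
    cosh_pres g -> (forall x, P x -> g x = x) ->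
    exists s, [/\ involutive s, cosh_pres s, vol_pres s &
      forall x, P x \/ x = p -> s (g x) = x].
  move=> cg gP; have [gp|gp] := pselect (g p = p).
    by exists id; split => // x [/gP|->].
  have [s [sK cs vs sp sx]] := mirror_exists _ _ gp.
  exists s; split => // x [Px|->]; last exact: sp.
  (* A point x already fixed by g is as far from g p as from p, hence on the bisector fixed by the
     mirror. *)
  by rewrite gP//; apply: sx; rewrite -{1}(gP _ Px) cg.
move=> cf.
have [p0 h0] := hcoords_surj 0 0 1 ltr01.
have [p1 h1] := hcoords_surj 0 0 2 (ltr0Sn R 1).
have [p2 h2] := hcoords_surj 1 0 1 ltr01.
have [p3 h3] := hcoords_surj 0 1 1 ltr01.
have [s0 [s0K c0 v0 P0]] := step f (fun _ => False) p0 cf (fun _ => False_ind _).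
have [|s1 [s1K c1 v1 P1]] := step (s0 \o f) _ p1 _ P0.
  by move=> x y /=; rewrite c0 cf.
have [|s2 [s2K c2 v2 P2]] := step (s1 \o (s0 \o f)) _ p2 _ P1.
  by move=> x y /=; rewrite c1 c0 cf.
have [|s3 [s3K c3 v3 P3]] := step (s2 \o (s1 \o (s0 \o f))) _ p3 _ P2.
  by move=> x y /=; rewrite c2 c1 c0 cf.
have fE x : s3 (s2 (s1 (s0 (f x)))) = x.
  apply: (@cosh_pres_fix (fun x => s3 (s2 (s1 (s0 (f x))))) _ p0 p1 p2 p3) => //.
  - by move=> y z; rewrite c3 c2 c1 c0 cf.
  - by apply: P3; do 3 left; right.
  - by apply: P3; do 2 left; right.
  - by apply: P3; left; right.
  - by apply: P3; right.
have -> : f = s0 \o (s1 \o (s2 \o s3)).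
  by apply/funext => x /=; rewrite -{2}(fE x) s3K s2K s1K s0K.
by do 3 apply: vol_pres_comp => //.
Qed.

End volume.

(** * Segments and hulls *)

Section segments.
Context {R : realType}.
Implicit Types (p q x : hspace R) (A B : set (hspace R)).

Lemma hisometry_cosh (f : hspace R -> hspace R) : hisometry f ->
  forall p q, coshd (f p) (f q) = coshd p q.
Proof. by move=> [_ hf] p q; apply/hdist_coshd. Qed.

(* x is between p and q in the affine coordinates (hx, hy, hw), in which
   hyperbolic segments are straight. *)
Definition lift_between (s : R) p q x :=
  [/\ hx x = (1 - s) * hx p + s * hx q, hy x = (1 - s) * hy p + s * hy q &
      hw x = (1 - s) * hw p + s * hw q].

Lemma exp_arcosh_cosh (a : R) : 1 <= a ->
  [/\ 1 <= exp_arcosh a & a = (exp_arcosh a + (exp_arcosh a)^-1) / 2].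
Proof. by move=> a1; rewrite exp_arcosh_ge1// exp_arcoshK. Qed.

(** Exponentiating turns the additivity of distances into an algebraic relation. *)
Lemma hsegment_exp p q x : hsegment p q x <->
  exp_arcosh (coshd p x) * exp_arcosh (coshd x q) = exp_arcosh (coshd p q).
Proof.
have e0 a b : 0 < exp_arcosh (@coshd R a b).
  by rewrite (lt_le_trans ltr01)// exp_arcosh_ge1// coshd_ge1.
rewrite /hsegment/= !hdistE /arcosh -!/(exp_arcosh _) -lnM ?posrE//.
split=> [|->//]; apply: ln_inj; by rewrite posrE ?mulr_gt0.
Qed.

(* Both lemmas compute Minkowski products of S x - c p - a q; for x on the segment
   [p, q] and suitable S, c, a this vector is isotropic and orthogonal to p,
   hence zero. *)
Lemma minkowski_norm (S c a : R) p q x :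
  (S * hw x / ht x - c * hw p / ht p - a * hw q / ht q) *
  (S / ht x - c / ht p - a / ht q) -
  (S * hx x / ht x - c * hx p / ht p - a * hx q / ht q) ^+ 2 -
  (S * hy x / ht x - c * hy p / ht p - a * hy q / ht q) ^+ 2 =
  S ^+ 2 + c ^+ 2 + a ^+ 2 - 2 * S * c * coshd p x - 2 * S * a * coshd x q
  + 2 * c * a * coshd p q.
Proof.
have := ht_gt0 p; have := ht_gt0 q; have := ht_gt0 x => x0 q0 p0.
rewrite /coshd /hw; field.
by rewrite (gt_eqF x0) (gt_eqF p0) (gt_eqF q0).
Qed.

Lemma minkowski_dot (S c a : R) p q x :
  (S * hw x / ht x - c * hw p / ht p - a * hw q / ht q) +
  (S / ht x - c / ht p - a / ht q) * hw p -
  2 * ((S * hx x / ht x - c * hx p / ht p - a * hx q / ht q) * hx p +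
       (S * hy x / ht x - c * hy p / ht p - a * hy q / ht q) * hy p) =
  2 * ht p * (S * coshd p x - c - a * coshd p q).
Proof.
have := ht_gt0 p; have := ht_gt0 q; have := ht_gt0 x => x0 q0 p0.
rewrite /coshd /hw; field.
by rewrite (gt_eqF x0) (gt_eqF p0) (gt_eqF q0).
Qed.

(** An isotropic vector orthogonal to a timelike one is zero. The timelike vector is (x, y, 1, x^2 +
    y^2 + t^2), and t != 0 is what makes it timelike. *)
Lemma minkowski_definite (V U W Z x y t : R) : t != 0 ->
  V * U - W ^+ 2 - Z ^+ 2 = 0 ->
  V + U * (x ^+ 2 + y ^+ 2 + t ^+ 2) - 2 * (W * x + Z * y) = 0 ->
  [/\ V = 0, U = 0, W = 0 & Z = 0].
Proof.
move=> t0 h1 h2.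
have h3 : (W - U * x) ^+ 2 + (Z - U * y) ^+ 2 + (U * t) ^+ 2 = 0.
  transitivity (- (V * U - W ^+ 2 - Z ^+ 2)); last by rewrite h1 oppr0.
  have -> : V = 2 * (W * x + Z * y) - U * (x ^+ 2 + y ^+ 2 + t ^+ 2) by lra.
  ring.
move/eqP: h3; rewrite paddr_eq0 ?addr_ge0 ?sqr_ge0// paddr_eq0 ?sqr_ge0//.
rewrite !sqrf_eq0 mulf_eq0 (negbTE t0) orbF => /andP[/andP[/eqP e1 /eqP e2] /eqP e3].
move: h2 e1 e2; rewrite e3 !mul0r !subr0 addr0 => h2 e1 e2.
by move: h2; rewrite e1 e2 !mul0r !addr0 mulr0 subr0.
Qed.

Lemma hsegment_lift p q x : hsegment p q x ->
  exists2 s, 0 <= s <= 1 & lift_between s p q x.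
Proof.
have p0 := ht_gt0 p; have q0 := ht_gt0 q; have x0 := ht_gt0 x.
move=> /hsegment_exp.
have [A1 Ae] := exp_arcosh_cosh _ (coshd_ge1 p x).
have [C1 Ce] := exp_arcosh_cosh _ (coshd_ge1 x q).
have [E1 Ee] := exp_arcosh_cosh _ (coshd_ge1 p q).
set A := exp_arcosh (coshd p x) in A1 Ae *.
set C := exp_arcosh (coshd x q) in C1 Ce *.
set E := exp_arcosh (coshd p q) in E1 Ee *.
move=> AC.
have A0 : 0 < A by exact: lt_le_trans A1.
have C0 : 0 < C by exact: lt_le_trans C1.
(* These are the hyperbolic sines of d(p, q), d(x, q) and d(p, x). On the hyperboloid a point x of
   the segment satisfies sinh d(p, q) x = sinh d(x, q) p + sinh d(p, x) q. *)
pose S := (A * C - (A * C)^-1) / 2.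
pose c := (C - C^-1) / 2.
pose a := (A - A^-1) / 2.
have AV : A^-1 <= 1 by rewrite invf_le1.
have CV : C^-1 <= 1 by rewrite invf_le1.
have a0 : 0 <= a by rewrite /a; lra.
have c0 : 0 <= c by rewrite /c; lra.
have [V U W Z] : [/\ S * hw x / ht x - c * hw p / ht p - a * hw q / ht q = 0,
  S / ht x - c / ht p - a / ht q = 0,
  S * hx x / ht x - c * hx p / ht p - a * hx q / ht q = 0 &
  S * hy x / ht x - c * hy p / ht p - a * hy q / ht q = 0].
  apply: (minkowski_definite _ _ _ _ (hx p) (hy p) (ht p)).
  - by rewrite gt_eqF.
  - rewrite minkowski_norm Ae Ce Ee -AC /S /c /a; field.
    by rewrite (gt_eqF A0) (gt_eqF C0).
  - rewrite -/(hw p) minkowski_dot Ae Ee -AC /S /c /a; field.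
    by rewrite (gt_eqF A0) (gt_eqF C0).
(* If A C = 1 then S = 0 cannot be divided by; but then x = p, and s = 0 is the parameter. *)
have [AC1|AC1] := ltP 1 (A * C); last first.
  have eA : A = 1 by apply/eqP; rewrite eq_le A1 andbT (le_trans _ AC1)// ler_peMr// ltW.
  have px : p = x by apply: coshd_eq1; rewrite Ae eA invr1; lra.
  exists 0; first by rewrite lexx ler01.
  by rewrite /lift_between px subr0 !mul1r !mul0r !addr0.
have ACV : (A * C)^-1 < 1 by rewrite invf_lt1// mulr_gt0.
have S0 : 0 < S by rewrite /S; lra.
pose s := a * ht x / (S * ht q).
have sE : 1 - s = c * ht x / (S * ht p).
  have -> : 1 - s = (S / ht x - c / ht p - a / ht q) * (ht x / S) + c * ht x / (S * ht p).
    by rewrite /s; field; rewrite (gt_eqF S0) (gt_eqF x0) (gt_eqF p0) (gt_eqF q0).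
  by rewrite U mul0r add0r.
exists s.
  apply/andP; split.
    by apply: divr_ge0; apply: mulr_ge0 => //; exact: ltW.
  by rewrite -subr_ge0 sE; apply: divr_ge0; apply: mulr_ge0 => //; exact: ltW.
split; rewrite sE /s.
- have -> : hx x = (S * hx x / ht x - c * hx p / ht p - a * hx q / ht q) * (ht x / S)
      + c * ht x / (S * ht p) * hx p + a * ht x / (S * ht q) * hx q.
    by field; rewrite (gt_eqF S0) (gt_eqF x0) (gt_eqF p0) (gt_eqF q0).
  by rewrite W mul0r add0r.
- have -> : hy x = (S * hy x / ht x - c * hy p / ht p - a * hy q / ht q) * (ht x / S)
      + c * ht x / (S * ht p) * hy p + a * ht x / (S * ht q) * hy q.
    by field; rewrite (gt_eqF S0) (gt_eqF x0) (gt_eqF p0) (gt_eqF q0).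
  by rewrite Z mul0r add0r.
- have -> : hw x = (S * hw x / ht x - c * hw p / ht p - a * hw q / ht q) * (ht x / S)
      + c * ht x / (S * ht p) * hw p + a * ht x / (S * ht q) * hw q.
    by field; rewrite (gt_eqF S0) (gt_eqF x0) (gt_eqF p0) (gt_eqF q0).
  by rewrite V mul0r add0r.
Qed.

(** With l and m the coefficients of x / ht x on p / ht p and q / ht q, and k = cosh d(p, q), unit
    norm reads l^2 + m^2 + 2 l m k = 1. Hence (l + m k)^2 - 1 = m^2 (k^2 - 1) and exp d(p, x) = l +
    m E with E = exp d(p, q). Likewise exp d(x, q) = m + l E, and the product of the two is E. *)
Lemma lift_hsegment p q x s : 0 <= s <= 1 -> lift_between s p q x ->
  hsegment p q x.
Proof.
move=> /andP[s0 s1] [ex ey ew].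
have p0 := ht_gt0 p; have q0 := ht_gt0 q; have x0 := ht_gt0 x.
have k1 := coshd_ge1 p q; set k := coshd p q in k1 *.
pose l := (1 - s) * ht p / ht x.
pose m := s * ht q / ht x.
have l0 : 0 <= l by rewrite /l divr_ge0 ?mulr_ge0 ?subr_ge0 ?(ltW x0) ?(ltW p0).
have m0 : 0 <= m by rewrite /m divr_ge0 ?mulr_ge0 ?(ltW x0) ?(ltW q0).
have pxE : coshd p x = l + m * k.
  rewrite /coshd ex ey ew /l /m /k /coshd /hw; field.
  by rewrite (gt_eqF x0) (gt_eqF p0) (gt_eqF q0).
have xqE : coshd x q = l * k + m.
  rewrite /coshd ex ey ew /l /m /k /coshd /hw; field.
  by rewrite (gt_eqF x0) (gt_eqF p0) (gt_eqF q0).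
have lm : l ^+ 2 + m ^+ 2 + 2 * l * m * k = 1.
  have xx : coshd x x = 1.
    by rewrite coshd_sub1 !subrr expr0n/= !addr0 mul0r addr0.
  rewrite -[RHS]xx.
  have -> : coshd x x = l * coshd p x + m * coshd x q.
    rewrite {1}/coshd {1}ex {1}ey {1}ew /l /m /coshd /hw; field.
    by rewrite (gt_eqF x0) (gt_eqF p0) (gt_eqF q0).
  by rewrite pxE xqE; ring.
have k21 : 0 <= k ^+ 2 - 1 by rewrite subr_ge0 -[leLHS](expr1n _ 2) ler_pXn2r// nnegrE; lra.
have key (u v : R) : 0 <= u -> 0 <= v -> u ^+ 2 + v ^+ 2 + 2 * u * v * k = 1 ->
    exp_arcosh (u + v * k) = u + v * exp_arcosh k.
  move=> u0 v0 uv; rewrite /exp_arcosh.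
  have -> : (u + v * k) ^+ 2 - 1 = v ^+ 2 * (k ^+ 2 - 1) by lra.
  by rewrite sqrtrM ?sqr_ge0// sqrtr_sqr ger0_norm// mulrDr addrA.
apply/hsegment_exp; rewrite pxE xqE [l * k + m]addrC key// key//; last first.
  by rewrite -[RHS]lm; ring.
have e0 : 0 < exp_arcosh k by rewrite (lt_le_trans ltr01)// exp_arcosh_ge1.
have [_ kE] := exp_arcosh_cosh _ k1.
move: lm; rewrite -/k {1}kE; set E := exp_arcosh k in e0 *.
move=> lm; transitivity (E * (l ^+ 2 + m ^+ 2 + 2 * l * m * ((E + E^-1) / 2))).
  by field; rewrite gt_eqF.
by rewrite lm mulr1.
Qed.

Lemma hconvex_halfspace (a b c d : R) :
  hconvex [set p | 0 <= a * hx p + b * hy p + c * hw p + d].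
Proof.
move=> p q /= hp hq x /hsegment_lift[s /andP[s0 s1] [ex ey ew]] /=.
rewrite ex ey ew.
have s1' : 0 <= 1 - s by rewrite subr_ge0.
have := addr_ge0 (mulr_ge0 s1' hp) (mulr_ge0 s0 hq); lra.
Qed.

Lemma hhull_sub A : A `<=` hhull A.
Proof. by move=> x Ax B [_]; apply. Qed.

Lemma hhull_min A B : hconvex B -> A `<=` B -> hhull A `<=` B.
Proof. by move=> cB AB x; apply. Qed.

Lemma hhull_convex A : hconvex (hhull A).
Proof.
move=> p q Ap Aq x xpq B [cB AB]; apply: (cB p q) => //.
  by apply: Ap.
by apply: Aq.
Qed.

(** Segments are defined by distances alone, so an isometry and its inverse both preserve
    convexity. *)
Lemma hhull_preimage (f : hspace R -> hspace R) A : hisometry f ->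
  hhull (f @^-1` A) = f @^-1` hhull A.
Proof.
move=> [[g fK gK] hf]; apply/seteqP; split=> x.
  apply; split; last by move=> y; exact: (hhull_sub A (f y)).
  move=> p q Ap Aq y ypq; apply: (hhull_convex A _ _ Ap Aq).
  by rewrite /hsegment/= !hf.
move=> /= Ax B [cB AB].
have hg p q : hdist (g p) (g q) = hdist p q by rewrite -hf !gK.
have : (g @^-1` B) (f x).
  apply: Ax; split; last by move=> y Ay; apply: AB; rewrite /= gK.
  move=> p q Bp Bq y ypq; apply: (cB (g p) (g q)) => //.
  by rewrite /hsegment/= !hg.
by rewrite /= fK.
Qed.

End segments.

(** * Decomposition of the drum *)

Section plane.
Context {R : realType}.
Implicit Types (u v z : R[i]).

Lemma Re_expi (x : R) : complex.Re (expi x) = cos x. Proof. by []. Qed.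

Lemma expiD (x y : R) : expi (x + y) = expi x * expi y.
Proof. by apply: complex_eq; rewrite ?ReM ?ImM/= ?cosD ?sinD// addrC. Qed.

Lemma expi0 : expi 0 = 1 :> R[i].
Proof. by apply: complex_eq; rewrite /= ?cos0 ?sin0. Qed.

Lemma expiNK (x : R) z : expi x * (expi (- x) * z) = z.
Proof. by rewrite mulrA -expiD subrr expi0 mul1r. Qed.

Definition cross u v : R :=
  complex.Re u * complex.Im v - complex.Im u * complex.Re v.

Lemma cross_expi (t : R) u v : cross (expi t * u) (expi t * v) = cross u v.
Proof.
rewrite /cross !ReM !ImM/=; have := cos2Dsin2 t.
set c := cos t; set s := sin t => e.
transitivity ((c ^+ 2 + s ^+ 2) * (complex.Re u * complex.Im v -
  complex.Im u * complex.Re v)); first by ring.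
by rewrite e mul1r.
Qed.

Lemma crossC u v : cross u v = - cross v u.
Proof. by rewrite /cross; ring. Qed.

Lemma cross_polar (rho rho' x y : R) :
  cross (rho%:C * expi x) (rho'%:C * expi y) = rho * rho' * sin (y - x).
Proof. by rewrite /cross !ReM !ImM/= sinB; ring. Qed.

Lemma polarP z : exists rho phi : R, [/\ 0 <= rho, 0 <= phi < 2 * pi &
  z = rho%:C * expi phi].
Proof.
have pi0 := pi_gt0 R.
have [->|z0] := eqVneq z 0.
  by exists 0, 0; rewrite lexx mulr_gt0// mul0r; split.
case: z z0 => x y z0.
pose rho := Num.sqrt (x ^+ 2 + y ^+ 2).
have xy0 : 0 < x ^+ 2 + y ^+ 2.
  rewrite lt_neqAle addr_ge0 ?sqr_ge0// andbT eq_sym paddr_eq0 ?sqr_ge0//.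
  rewrite !sqrf_eq0; apply: contra_neqN z0 => /andP[/eqP -> /eqP ->].
  exact: complex_eq.
have rho0 : 0 < rho by rewrite sqrtr_gt0.
have rho2 : rho ^+ 2 = x ^+ 2 + y ^+ 2 by rewrite sqr_sqrtr// ltW.
have xr : -1 <= x / rho <= 1.
  have h : `|x / rho| <= 1.
    rewrite -(@ler_pXn2r _ 2) ?nnegrE// expr1n -normrX ger0_norm ?sqr_ge0//.
    by rewrite exprMn exprVn rho2 ler_pdivrMr// mul1r lerDl sqr_ge0.
  by rewrite -ler_norml.
have ca : cos (acos (x / rho)) = x / rho by apply: acosK; rewrite in_itv.
have c2 : 1 - (x / rho) ^+ 2 = (`|y| / rho) ^+ 2.
  rewrite !exprMn exprVn real_normK ?num_real// rho2; field.
  by rewrite -rho2 sqrf_eq0 gt_eqF.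
have sa : sin (acos (x / rho)) = `|y| / rho.
  by rewrite sin_acos// c2 sqrtr_sqr ger0_norm// divr_ge0// ltW.
have rn : rho != 0 by rewrite gt_eqF.
have [y0|y0] := leP 0 y.
  exists rho, (acos (x / rho)); split; first exact: ltW.
    rewrite acos_ge0//= (le_lt_trans (acos_lepi xr))//.
    by rewrite ltr_pMl// ltr1n.
  apply: complex_eq; rewrite ?ReM ?ImM/= ca sa ger0_norm// mul0r.
    by rewrite subr0 mulrC divfK.
  by rewrite addr0 mulrC divfK.
exists rho, (2 * pi - acos (x / rho)); split; first exact: ltW.
  have a0 : 0 < acos (x / rho).
    apply: acos_gt0; have /andP[-> x1] := xr; rewrite lt_neqAle x1 andbT/=.
    apply/eqP => x1'; move: c2; rewrite x1' expr1n subrr => /esym/eqP.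
    by rewrite sqrf_eq0 mulf_eq0 invr_eq0 (negbTE rn) orbF normr_eq0 lt_eqF.
  have ap := acos_lepi xr; apply/andP; split; lra.
have e2 : 2 * pi = pi *+ 2 :> R by rewrite mulr_natl.
have cE : cos (2 * pi - acos (x / rho)) = x / rho.
  by rewrite e2 addrC cosD2pi cosN.
have sE : sin (2 * pi - acos (x / rho)) = y / rho.
  by rewrite e2 addrC sinD2pi sinN sa ltr0_norm// mulNr opprK.
apply: complex_eq; rewrite ?ReM ?ImM/= cE sE mul0r.
  by rewrite subr0 mulrC divfK.
by rewrite addr0 mulrC divfK.
Qed.

(** After reduction of j modulo n, with d = j pi / n the difference cos x - cos (x + 2 d) is 2 sin
    (x + d) sin d. For 0 < j < n both angles are in [0, pi], because pi / n <= d <= pi - pi / n. *)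
Lemma cos_vertex_le (n : nat) (x : R) (j : nat) : (0 < n)%N ->
  `|x| <= pi / n%:R -> cos (x + j%:R * (2 * pi / n%:R)) <= cos x.
Proof.
move=> n0 xn; have pi0 := pi_gt0 R.
have nR : 0 < n%:R :> R by rewrite ltr0n.
have nn : n%:R != 0 :> R by rewrite gt_eqF.
have -> : cos (x + j%:R * (2 * pi / n%:R)) =
    cos (x + (j %% n)%:R * (2 * pi / n%:R)).
  rewrite {1}(divn_eq j n) natrD natrM mulrDl addrA -[RHS](periodicn (@cosD2pi R) (j %/ n)).
  congr (cos _); rewrite -mulr_natr -mulr_natr; field.
  by [].
have : (j %% n < n)%N by rewrite ltn_pmod.
move: (j %% n)%N => {}j jn.
case: j jn => [|j] jn; first by rewrite mul0r addr0.
rewrite -subr_ge0.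
have -> : cos x - cos (x + j.+1%:R * (2 * pi / n%:R)) =
  2 * sin (x + j.+1%:R * (pi / n%:R)) * sin (j.+1%:R * (pi / n%:R)).
  set d := j.+1%:R * (pi / n%:R).
  have -> : j.+1%:R * (2 * pi / n%:R) = d + d by rewrite /d; field.
  have -> : cos x = cos ((x + d) - d) by congr cos; ring.
  have -> : cos (x + (d + d)) = cos ((x + d) + d) by congr cos; ring.
  by set e := x + d; rewrite cosB cosD; ring.
move: xn; rewrite ler_norml => /andP[x1 x2].
have p1 : 0 < pi / n%:R :> R by rewrite divr_gt0.
have jpi : j.+1%:R * (pi / n%:R) + pi / n%:R <= pi :> R.
  have h : j.+2%:R * (pi / n%:R) <= n%:R * (pi / n%:R) :> R.
    by rewrite ler_pM2r ?ler_nat.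
  have e1 : n%:R * (pi / n%:R) = pi :> R by rewrite mulrC divfK.
  by move: h; rewrite e1 -natr1 mulrDl mul1r.
have j1 : pi / n%:R <= j.+1%:R * (pi / n%:R) :> R by rewrite ler_peMl ?ler1n // ltW.
by rewrite !mulr_ge0// sin_ge0_pi//; apply/andP; split; lra.
Qed.

Lemma sector_polar (n k : nat) (v z : R[i]) (rho x rho' phi : R)
    (alpha := 2 * pi / n%:R) :
  v = rho%:C * expi x -> z = expi x * (rho'%:C * expi phi) ->
  cross v (expi (- (k%:R * alpha)) * z) = rho * rho' * sin (phi - k%:R * alpha) /\
  cross (expi (- (k%:R * alpha)) * z) (expi alpha * v) =
    rho * rho' * sin (k.+1%:R * alpha - phi).
Proof.
move=> -> ->.
have -> : expi (- (k%:R * alpha)) * (expi x * (rho'%:C * expi phi)) =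
    rho'%:C * expi (x + phi - k%:R * alpha).
  by rewrite !expiD; ring.
have -> : expi alpha * (rho%:C * expi x) = rho%:C * expi (x + alpha).
  by rewrite expiD; ring.
rewrite !cross_polar [rho' * rho]mulrC -natr1; split; congr (_ * sin _); ring.
Qed.

Lemma polar_from v z : exists rho x rho' phi : R,
  [/\ 0 <= rho, 0 <= rho', 0 <= phi < 2 * pi, v = rho%:C * expi x &
   z = expi x * (rho'%:C * expi phi)].
Proof.
have [rho [x [rho0 _ vE]]] := polarP v.
have [rho' [phi [rho'0 phi0 zE]]] := polarP (expi (- x) * z).
by exists rho, x, rho', phi; split => //; rewrite -zE expiNK.
Qed.

(* The n sectors of angle alpha starting at v cover the plane and are disjoint. *)
Lemma sector_exists (n : nat) (v z : R[i]) (alpha := 2 * pi / n%:R) : (1 < n)%N ->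
  exists2 k, (k < n)%N & 0 <= cross v (expi (- (k%:R * alpha)) * z) /\
    0 <= cross (expi (- (k%:R * alpha)) * z) (expi alpha * v).
Proof.
move=> n1; have pi0 := pi_gt0 R.
have nR : 0 < n%:R :> R by rewrite ltr0n (leq_trans _ n1).
have a0 : 0 < alpha by rewrite divr_gt0// mulr_gt0.
have api : alpha <= pi.
  by rewrite ler_pdivrMr// mulrC ler_pM2l// ler_nat.
have na : n%:R * alpha = 2 * pi by rewrite mulrC divfK// gt_eqF.
have [rho [x [rho' [phi [r0 r0' /andP[p0 p2] vE zE]]]]] := polar_from v z.
have pa : 0 <= phi / alpha by rewrite divr_ge0// ltW.
have /andP[k1 k2] := Num.Theory.truncn_itv pa.
set k := Num.truncn (phi / alpha) in k1 k2.
rewrite ler_pdivlMr// in k1; rewrite ltr_pdivrMr// in k2.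
exists k.
  rewrite -(ltr_nat R) -(ltr_pM2r a0) na; exact: le_lt_trans k1 p2.
have [-> ->] := sector_polar n k v z rho x rho' phi vE zE.
rewrite -/alpha; rewrite -natr1 mulrDl mul1r in k2 *.
by split; rewrite !mulr_ge0// sin_ge0_pi//; apply/andP; split; lra.
Qed.

Lemma sin_le0_pi (x : R) : - pi <= x <= 0 -> sin x <= 0.
Proof.
move=> /andP[x1 x2]; rewrite -oppr_ge0 -sinN sin_ge0_pi//.
by apply/andP; split; lra.
Qed.

Lemma sector_unique (n j k : nat) (v z : R[i]) (alpha := 2 * pi / n%:R) :
  (1 < n)%N -> (j < n)%N -> (k < n)%N ->
  0 < cross v (expi (- (j%:R * alpha)) * z) ->
  0 < cross (expi (- (j%:R * alpha)) * z) (expi alpha * v) ->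
  0 < cross v (expi (- (k%:R * alpha)) * z) ->
  0 < cross (expi (- (k%:R * alpha)) * z) (expi alpha * v) -> j = k.
Proof.
move=> n1 jn kn; have pi0 := pi_gt0 R.
have nR : 0 < n%:R :> R by rewrite ltr0n (leq_trans _ n1).
have a0 : 0 < alpha by rewrite divr_gt0// mulr_gt0.
have api : alpha <= pi.
  by rewrite ler_pdivrMr// mulrC ler_pM2l// ler_nat.
have na : n%:R * alpha = 2 * pi by rewrite mulrC divfK// gt_eqF.
have [rho [x [rho' [phi [r0 r0' /andP[p0 p2] vE zE]]]]] := polar_from v z.
have key i : (i < n)%N ->
    0 < rho * rho' * sin (phi - i%:R * alpha) ->
    0 < rho * rho' * sin (i.+1%:R * alpha - phi) ->
    i%:R * alpha < phi < i.+1%:R * alpha.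
  move=> lin s1 s2; have rr : 0 <= rho * rho' by rewrite mulr_ge0.
  have i2 : i.+1%:R * alpha <= 2 * pi by rewrite -na ler_pM2r// ler_nat.
  have i0 : 0 <= i%:R * alpha by rewrite mulr_ge0// ltW.
  have {}s1 : 0 < sin (phi - i%:R * alpha).
    by rewrite ltNge; apply/negP => h; move: s1; rewrite ltNge mulr_ge0_le0.
  have {}s2 : 0 < sin (i.+1%:R * alpha - phi).
    by rewrite ltNge; apply/negP => h; move: s2; rewrite ltNge mulr_ge0_le0.
  rewrite -natr1 mulrDl mul1r in s2 i2 *.
  (* The signs of the two sines locate phi only modulo 2 pi; the bounds on phi and i rule out the
     other turns. *)
  have h1 : i%:R * alpha < phi.
    rewrite ltNge; apply/negP => h.
    have [h'|h'] := leP (- pi) (phi - i%:R * alpha).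
      by move: s1; rewrite ltNge sin_le0_pi//; apply/andP; split; lra.
    have e : sin (i%:R * alpha + alpha - phi) =
        sin (i%:R * alpha + alpha - phi - 2 * pi).
      rewrite -(sinD2pi (i%:R * alpha + alpha - phi - 2 * pi)) -mulr_natl.
      by congr sin; ring.
    by move: s2; rewrite e ltNge sin_le0_pi//; apply/andP; split; lra.
  have h2 : phi - i%:R * alpha <= pi.
    rewrite leNgt; apply/negP => h.
    have e : sin (phi - i%:R * alpha) = sin (phi - i%:R * alpha - 2 * pi).
      rewrite -(sinD2pi (phi - i%:R * alpha - 2 * pi)) -mulr_natl.
      by congr sin; ring.
    by move: s1; rewrite e ltNge sin_le0_pi//; apply/andP; split; lra.
  rewrite h1/= ltNge; apply/negP => h.
  by move: s2; rewrite ltNge sin_le0_pi//; apply/andP; split; lra.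
have [-> ->] := sector_polar n j v z rho x rho' phi vE zE.
have [-> ->] := sector_polar n k v z rho x rho' phi vE zE.
rewrite -/alpha => h1 h2 h3 h4.
have /andP[j1 j2] := key _ jn h1 h2.
have /andP[k1 k2] := key _ kn h3 h4.
have := lt_trans j1 k2; have := lt_trans k1 j2.
rewrite !ltr_pM2r// !ltr_nat !ltnS => kj jk.
by apply/eqP; rewrite eqn_leq jk kj.
Qed.

End plane.

(** * The drum in normal position and half-spaces containing it *)

Section drum.
Context {R : realType}.
Implicit Types (p q : hspace R).

(** The sign brings the direction of argument psi onto the positive real axis, so that
    [hx (hrot psi p)] measures p along that direction. *)
Definition hrot (psi : R) p : hspace R :=
  @HPoint R (expi (- psi) * hz p) (ht p) (ht_gt0 p).

Lemma hx_rot psi p : hx (hrot psi p) = cos psi * hx p + sin psi * hy p.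
Proof. by rewrite /hx /= ReM/= cosN sinN mulNr opprK. Qed.

Lemma hy_rot psi p : hy (hrot psi p) = cos psi * hy p - sin psi * hx p.
Proof. by rewrite /hy /= ImM/= cosN sinN mulNr. Qed.

Lemma hw_rot psi p : hw (hrot psi p) = hw p.
Proof.
rewrite /hw hx_rot hy_rot/=; have := cos2Dsin2 psi => e.
transitivity ((cos psi ^+ 2 + sin psi ^+ 2) * (hx p ^+ 2 + hy p ^+ 2) + ht p ^+ 2).
  by ring.
by rewrite e mul1r.
Qed.

Lemma coshd_rot psi p q : coshd (hrot psi p) (hrot psi q) = coshd p q.
Proof.
rewrite /coshd !hw_rot !hx_rot !hy_rot/=; congr ((_ + _ - 2 * _) / _).
have := cos2Dsin2 psi => e.
transitivity ((cos psi ^+ 2 + sin psi ^+ 2) * (hx p * hx q + hy p * hy q)).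
  by ring.
by rewrite e mul1r.
Qed.

Lemma hrotD a b p : hrot (a + b) p = hrot a (hrot b p).
Proof. by apply: hspace_eq => //=; rewrite opprD expiD mulrA. Qed.

Variables (n : nat) (r theta : R).
Hypotheses (n3 : (3 <= n)%N) (r1 : 1 < r).
Local Notation alpha := (2 * pi / n%:R).
Hypotheses (th0 : 0 <= theta) (tha : theta < alpha).

Lemma r_gt0 : 0 < r. Proof. exact: lt_trans r1. Qed.

Definition hscrew p : hspace R :=
  @HPoint R (r%:C * expi theta * hz p) (r * ht p) (mulr_gt0 r_gt0 (ht_gt0 p)).

Lemma hx_screw p : hx (hscrew p) = r * hx (hrot (- theta) p).
Proof. by rewrite hx_rot /hx /= !ReM/= !mul0r subr0 addr0 cosN sinN /hy; ring. Qed.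

Lemma hy_screw p : hy (hscrew p) = r * hy (hrot (- theta) p).
Proof. by rewrite hy_rot /hy /= !ImM/= !mul0r subr0 addr0 cosN sinN /hx; ring. Qed.

Lemma hw_screw p : hw (hscrew p) = r ^+ 2 * hw p.
Proof.
by rewrite -(hw_rot (- theta) p) /hw hx_screw hy_screw/=; ring.
Qed.

Lemma hx_rot_screw psi p : hx (hrot psi (hscrew p)) = r * hx (hrot (psi - theta) p).
Proof.
rewrite hrotD (hx_rot psi (hscrew p)) (hx_rot psi (hrot (- theta) p)).
by rewrite hx_screw hy_screw; ring.
Qed.

Definition drum0 : set (hspace R) :=
  hhull (std_ideal_ngon n `|` hscrew @` std_ideal_ngon n).

(** The isometry g conjugates phi to [hscrew], and hulls commute with preimages under isometries. *)
Lemma drum_preimage D : is_drum n r theta D ->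
  exists2 g, hisometry g & D = g @^-1` drum0.
Proof.
move=> [P [phi [g [_ ig gP gphi ->]]]]; exists g => //.
have [[g' gK g'K] _] := ig.
have ginj : injective g by exact: can_inj gK.
rewrite /drum0 -hhull_preimage// preimage_setU; congr (hhull (_ `|` _)).
  rewrite -gP; apply/seteqP; split=> [x Px|x [y Py /ginj <-]//].
  by exists x.
have gs p : g (phi p) = hscrew (g p).
  by have [ez et] := gphi p; exact: hspace_eq.
rewrite -gP; apply/seteqP; split=> [_ [x Px <-]|x [_ [y Py <-]] /=].
  by exists (g x) => //; exists x.
by rewrite -gs => /ginj <-; exists y.
Qed.

Lemma hconvexI (A B : set (hspace R)) : hconvex A -> hconvex B ->
  hconvex (A `&` B).
Proof.
move=> cA cB p q [Ap Bp] [Aq Bq] x xpq.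
by split; [exact: (cA p q)|exact: (cB p q)].
Qed.

(** Both conclusions are half-spaces in the coordinates (hx, hy, hw), hence convex. It suffices to
    test the ideal geodesics, where (hx, hy) is a convex combination of two vertices and hw = 1. *)
Lemma ngon_sub psi c : (forall k, (k < n)%N -> cos (k%:R * alpha - psi) <= c) ->
  forall p, std_ideal_ngon n p -> hw p = 1 /\ hx (hrot psi p) <= c.
Proof.
move=> hc p.
pose B := [set p : hspace R |
    0 <= (- cos psi) * hx p + (- sin psi) * hy p + 0 * hw p + c] `&`
  ([set p : hspace R | 0 <= 0 * hx p + 0 * hy p + 1 * hw p + -1] `&`
  [set p : hspace R | 0 <= 0 * hx p + 0 * hy p + (-1) * hw p + 1]).
suff : std_ideal_ngon n `<=` B.
  move=> sB /sB[/= h1 [h2 h3]]; split; first lra.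
  by rewrite hx_rot; lra.
apply: hhull_min.
  by apply: hconvexI; [|apply: hconvexI]; exact: hconvex_halfspace.
move=> {p} p [_ [_ [[j jn ->] [k kn ->] _ [s [/andP[s0 s1] zE tE]]]]].
set a := 2 * j%:R * pi / n%:R in zE tE *.
set b := 2 * k%:R * pi / n%:R in zE tE *.
have aE : a = j%:R * alpha by rewrite /a; ring.
have bE : b = k%:R * alpha by rewrite /b; ring.
have xE : hx p = (1 - s) * cos a + s * cos b.
  by rewrite /hx zE !(ReD, ReM, ReN)/=; ring.
have yE : hy p = (1 - s) * sin a + s * sin b.
  by rewrite /hy zE !(ImD, ImM, ImN)/=; ring.
have wE : hw p = 1.
  rewrite /hw xE yE tE sqr_modulus !(ReD, ImD, ReN, ImN)/=.
  transitivity ((1 - s) * (cos a ^+ 2 + sin a ^+ 2) +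
                s * (cos b ^+ 2 + sin b ^+ 2)); first by ring.
  by rewrite !cos2Dsin2; ring.
have := hc _ jn; have := hc _ kn; rewrite -aE -bE !cosB => hb ha.
have s1' : 0 <= 1 - s by rewrite subr_ge0 ltW.
have := addr_ge0 (mulr_ge0 s1' (_ : 0 <= c - (cos a * cos psi + sin a * sin psi)))
  (mulr_ge0 (ltW s0) (_ : 0 <= c - (cos b * cos psi + sin b * sin psi))).
rewrite !subr_ge0 => /(_ ha hb) h.
by split=> /=; [rewrite xE yE; lra|rewrite wE; split; lra].
Qed.

(* The parameter in [0, 1] of the height w between the two polygons; edge
   interpolates at that height between a point of each polygon. *)
Definition level (w : R) := (w - 1) / (r ^+ 2 - 1).

Lemma r21 : 0 < r ^+ 2 - 1.
Proof. by rewrite subr_gt0 -(expr1n _ 2) ltr_pXn2r ?nnegrE// ltW// r_gt0. Qed.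

Lemma level_ge0 w : (0 <= level w) = (1 <= w).
Proof. by rewrite pmulr_lge0 ?invr_gt0 ?r21// subr_ge0. Qed.
Lemma level_gt0 w : (0 < level w) = (1 < w).
Proof. by rewrite pmulr_lgt0 ?invr_gt0 ?r21// subr_gt0. Qed.
Lemma level_le1 w : (level w <= 1) = (w <= r ^+ 2).
Proof. by rewrite ler_pdivrMr ?r21// mul1r lerD2r. Qed.
Lemma level_lt1 w : (level w < 1) = (w < r ^+ 2).
Proof. by rewrite ltr_pdivrMr ?r21// mul1r ltrD2r. Qed.
Lemma levelK w : w = (1 - level w) + level w * r ^+ 2.
Proof. by rewrite /level; field; rewrite gt_eqF// r21. Qed.

Definition edge (A B w : R) := (1 - level w) * A + level w * r * B.

(** In the coordinates (hx, hy, hw) the bound [edge A B] is affine in hw, so this is again a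
    half-space, to be tested only on the two polygons at hw = 1 and hw = r^2. *)
Lemma drum_half psi A B :
  (forall k, (k < n)%N -> cos (k%:R * alpha - psi) <= A) ->
  (forall k, (k < n)%N -> cos (k%:R * alpha - (psi - theta)) <= B) ->
  forall p, drum0 p -> [/\ 1 <= hw p, hw p <= r ^+ 2 &
    hx (hrot psi p) <= edge A B (hw p)].
Proof.
move=> hA hB p.
have r20 := r21.
(* The slope for which c w + (A - c) equals A at w = 1 and r B at w = r^2. *)
pose c := (r * B - A) / (r ^+ 2 - 1).
pose K := [set p : hspace R |
    0 <= (- cos psi) * hx p + (- sin psi) * hy p + c * hw p + (A - c)] `&`
  ([set p : hspace R | 0 <= 0 * hx p + 0 * hy p + 1 * hw p + -1] `&`
  [set p : hspace R | 0 <= 0 * hx p + 0 * hy p + (-1) * hw p + r ^+ 2]).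
have eE w : edge A B w = c * w + (A - c).
  by rewrite /edge /level /c; field; rewrite gt_eqF.
suff : drum0 `<=` K.
  move=> sK /sK[/= h1 [h2 h3]]; split; [lra|lra|].
  by rewrite hx_rot eE; lra.
apply: hhull_min.
  by apply: hconvexI; [|apply: hconvexI]; exact: hconvex_halfspace.
move=> {p} p' [/(ngon_sub _ _ hA)[w1]|[p /(ngon_sub _ _ hB)[w1 h] <-]].
  rewrite hx_rot => h; rewrite /K/= w1; split; last by split; lra.
  by rewrite /=; lra.
rewrite /K/= hw_screw w1.
have := hx_rot_screw psi p; rewrite hx_rot => e.
have rh : r * hx (hrot (psi - theta) p) <= r * B.
  by rewrite ler_pM2l// r_gt0.
have cE : c * r ^+ 2 + (A - c) = r * B.
  by rewrite /c; field; rewrite gt_eqF.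
by split; [rewrite /=; lra|split; rewrite /=; lra].
Qed.

End drum.

(** * Points that belong to the polygon and to the drum *)

Section ngon.
Context {R : realType}.
Implicit Types (p q : hspace R).
Variables (n : nat).
Hypotheses (n3 : (3 <= n)%N).
Local Notation alpha := (2 * pi / n%:R : R).

Lemma n_gt0 : 0 < n%:R :> R. Proof. by rewrite ltr0n (leq_trans _ n3). Qed.

Lemma n_alpha : n%:R * alpha = 2 * pi.
Proof. by rewrite mulrC divfK// gt_eqF// n_gt0. Qed.

Lemma alpha_gt0 : 0 < alpha.
Proof. by rewrite divr_gt0 ?n_gt0// mulr_gt0// pi_gt0. Qed.

Lemma alpha_le : 3 * alpha <= 2 * pi.
Proof. by rewrite -[leRHS]n_alpha ler_pM2r ?alpha_gt0// ler_nat. Qed.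

Lemma sin_half_alpha_gt0 : 0 < sin (alpha / 2).
Proof.
have := alpha_gt0; have := alpha_le; have := pi_gt0 R.
by move: (alpha) => A *; rewrite sin_gt0_pi//; apply/andP; split; lra.
Qed.

Lemma cos_half_alpha_gt0 : 0 < cos (alpha / 2).
Proof.
have := alpha_gt0; have := alpha_le; have := pi_gt0 R.
by move: (alpha) => A *; rewrite cos_gt0_pihalf//; apply/andP; split; lra.
Qed.

Lemma expi_period (x : R) k : expi (x + k%:R * (2 * pi)) = expi x.
Proof.
have e : x + k%:R * (2 * pi) = x + pi *+ 2 *+ k.
  by rewrite !mulr_natl.
apply: complex_eq; rewrite /= e.
  exact: (periodicn (@cosD2pi R)).
exact: (periodicn (@sinD2pi R)).
Qed.

Lemma vertex_mem k :
  [set v | exists2 k, (k < n)%N & v = expi (2 * k%:R * pi / n%:R)]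
    (expi (k%:R * alpha)).
Proof.
exists (k %% n)%N; first by rewrite ltn_pmod// (leq_trans _ n3).
rewrite -[RHS](expi_period _ (k %/ n)); congr expi.
rewrite {1}(divn_eq k n) natrD natrM; field.
by rewrite gt_eqF// n_gt0.
Qed.

Lemma expi_neq (x d : R) : cos d < 0 -> expi x <> expi (x + d).
Proof.
move=> d0 /(congr1 (fun z => expi (- x) * z)).
rewrite -!expiD addrA !addNr add0r expi0 => /(congr1 (@complex.Re R))/= h.
by move: d0; rewrite -h ltNge ler01.
Qed.

Lemma point_exists (x y w : R) : x ^+ 2 + y ^+ 2 < w ->
  exists p : hspace R, [/\ hx p = x, hy p = y & hw p = w].
Proof.
move=> xyw; have t0 : 0 < Num.sqrt (w - x ^+ 2 - y ^+ 2).
  by rewrite sqrtr_gt0; lra.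
exists (@HPoint R (x +i* y) _ t0); split => //.
by rewrite /hw /hx /hy/= sqr_sqrtr; lra.
Qed.

(** For n >= 3 the integer part j of n / 2 puts j alpha in ]pi / 2, pi]. *)
Lemma half_turn : exists2 j, (j <= n)%N & cos (j%:R * alpha) < 0.
Proof.
exists (n./2)%N; first by rewrite -{2}[n]odd_double_half -addnn addnCA leq_addr.
have pi0 := pi_gt0 R.
have e : pi = (n%:R / 2) * alpha :> R by field; rewrite gt_eqF// n_gt0.
have h1 : pi < 2 * ((n./2)%:R * alpha).
  rewrite [ltLHS]e mulrA ltr_pM2r ?alpha_gt0// ltr_pdivrMr//.
  rewrite -!natrM ltr_nat.
  have : (0 < n./2)%N by rewrite half_gt0 (leq_trans _ n3).
  have := odd_double_half n; case: (odd n); lia.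
have h2 : (n./2)%:R * alpha <= pi.
  rewrite [leRHS]e ler_pM2r ?alpha_gt0// ler_pdivlMr// -natrM ler_nat.
  by rewrite -{2}[n]odd_double_half muln2 leq_addl.
rewrite -[X in cos X](subrK pi) cosDpi oppr_lt0 cos_gt0_pihalf//.
by apply/andP; split; lra.
Qed.

Lemma ideal_line_ngon (a b : nat) (s : R) : 0 < s < 1 ->
  cos (b%:R * alpha) < 0 ->
  exists2 p, std_ideal_ngon n p &
    [/\ hx p = (1 - s) * cos (a%:R * alpha) + s * cos ((a + b)%:R * alpha),
        hy p = (1 - s) * sin (a%:R * alpha) + s * sin ((a + b)%:R * alpha) &
        hw p = 1].
Proof.
move=> s01 cb; have /andP[s0 s1] := s01.
set x := a%:R * alpha; set y := (a + b)%:R * alpha.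
have yE : y = x + b%:R * alpha by rewrite /y natrD mulrDl.
pose d := (cos y - cos x) ^+ 2 + (sin y - sin x) ^+ 2.
have e : d = 2 - 2 * cos (b%:R * alpha).
  have -> : b%:R * alpha = y - x by rewrite yE addrC addKr.
  rewrite cosB.
  transitivity ((cos x ^+ 2 + sin x ^+ 2) + (cos y ^+ 2 + sin y ^+ 2)
     - 2 * (cos y * cos x + sin y * sin x)); first by rewrite /d; ring.
  by rewrite !cos2Dsin2; ring.
have d0 : 0 < s * (1 - s) * d by rewrite !mulr_gt0//; lra.
have t0 : 0 < Num.sqrt (s * (1 - s) * d) by rewrite sqrtr_gt0.
pose p := @HPoint R (((1 - s) * cos x + s * cos y) +i* ((1 - s) * sin x + s * sin y)) _ t0.
have pP : std_ideal_ngon n p.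
  apply: hhull_sub; exists (expi x), (expi y); split.
  - exact: vertex_mem.
  - exact: vertex_mem.
  - by rewrite yE; exact: expi_neq.
  - exists s; split => //.
      by apply: complex_eq; rewrite !(ReD, ReM, ReN, ImD, ImM, ImN)/=; ring.
    rewrite sqr_modulus !(ReD, ReN, ImD, ImN).
    rewrite (_ : ht p = Num.sqrt (s * (1 - s) * d))// sqr_sqrtr//.
    exact: ltW.
exists p => //; split => //.
by have [] := ngon_sub n 0 1 (fun k _ => cos_le1 _) p pP.
Qed.

Lemma hhull_between (A : set (hspace R)) s p q x : 0 <= s <= 1 ->
  lift_between s p q x -> hhull A p -> hhull A q -> hhull A x.
Proof.
move=> s01 l Ap Aq; apply: (hhull_convex A p q) => //.
exact: (lift_hsegment p q x s).
Qed.

(* The point is the midpoint, in the coordinates (z, w), of two points of the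
   geodesics from the vertex k to the vertices k + j and k - j, for a j of more
   than a quarter of a turn. *)
Lemma ngon_radial k (l : R) p : 0 <= l < 1 ->
  hx p = l * cos (k%:R * alpha) -> hy p = l * sin (k%:R * alpha) ->
  hw p = 1 -> std_ideal_ngon n p.
Proof.
move=> /andP[l0 l1] px py pw.
have [j jn cj] := half_turn; set c := cos (j%:R * alpha) in cj.
have jE : (n - j)%:R * alpha = - (j%:R * alpha) + 1%:R * (2 * pi) .
  by rewrite natrB// mulrBl n_alpha; ring.
have cj' : cos ((n - j)%:R * alpha) = c.
  by have := congr1 (@complex.Re R) (expi_period (- (j%:R * alpha)) 1); rewrite -jE/= cosN.
have sj' : sin ((n - j)%:R * alpha) = - sin (j%:R * alpha).
  by have := congr1 (@complex.Im R) (expi_period (- (j%:R * alpha)) 1); rewrite -jE/= sinN.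
have c1 : 0 < 1 - c by lra.
(* Solves 1 - s + s c = l, the radial coordinate of the midpoint; s < 1 because c < 0 <= l. *)
pose s := (1 - l) / (1 - c).
have s01 : 0 < s < 1.
  by apply/andP; split; [rewrite divr_gt0// subr_gt0|rewrite /s ltr_pdivrMr//; lra].
have [p1 h1 [x1 y1 w1]] := ideal_line_ngon k j s s01 cj.
have [|p2 h2 [x2 y2 w2]] := ideal_line_ngon k (n - j) s s01; first by rewrite cj'.
apply: (hhull_between _ (2^-1) p1 p2) => //.
  by rewrite invr_ge0 ler0n/= invf_le1// ler1n.
have aD a b : (a + b)%:R * alpha = a%:R * alpha + b%:R * alpha.
  by rewrite natrD mulrDl.
have lE : l = 1 - s * (1 - c) by rewrite /s; field; rewrite gt_eqF.
split.
- by rewrite px x1 x2 !aD !cosD cj' sj' -/c lE; field.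
- by rewrite py y1 y2 !aD !sinD cj' sj' -/c lE; field.
- by rewrite pw w1 w2; field.
Qed.

Lemma comb_norm (x y l u : R) : 0 <= l < 1 -> 0 <= u <= 1 ->
  (l * ((1 - u) * cos x + u * cos y)) ^+ 2 +
  (l * ((1 - u) * sin x + u * sin y)) ^+ 2 < 1.
Proof.
move=> /andP[l0 l1] /andP[u0 u1].
have -> : (l * ((1 - u) * cos x + u * cos y)) ^+ 2 +
  (l * ((1 - u) * sin x + u * sin y)) ^+ 2 =
  l ^+ 2 * ((1 - u) ^+ 2 * (cos x ^+ 2 + sin x ^+ 2) +
    u ^+ 2 * (cos y ^+ 2 + sin y ^+ 2) + 2 * (u * (1 - u)) * cos (x - y)).
  by rewrite cosB; ring.
rewrite !cos2Dsin2 !mulr1.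
have h : (1 - u) ^+ 2 + u ^+ 2 + 2 * (u * (1 - u)) * cos (x - y) <= 1.
  have h0 : 0 <= 2 * (u * (1 - u)) by rewrite !mulr_ge0 ?subr_ge0.
  by have := ler_wpM2l h0 (cos_le1 (x - y)); lra.
have l2 : l ^+ 2 < 1 by rewrite -(expr1n _ 2) ltr_pXn2r ?nnegrE.
by apply: le_lt_trans l2; rewrite -[leRHS]mulr1 ler_wpM2l// sqr_ge0.
Qed.

Lemma ngon_chord k1 k2 (l u : R) p : 0 <= l < 1 -> 0 <= u <= 1 ->
  hx p = l * ((1 - u) * cos (k1%:R * alpha) + u * cos (k2%:R * alpha)) ->
  hy p = l * ((1 - u) * sin (k1%:R * alpha) + u * sin (k2%:R * alpha)) ->
  hw p = 1 -> std_ideal_ngon n p.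
Proof.
move=> l01 u01 px py pw.
have rad k : exists2 q, std_ideal_ngon n q &
    [/\ hx q = l * cos (k%:R * alpha), hy q = l * sin (k%:R * alpha) & hw q = 1].
  have := comb_norm (k%:R * alpha) (k%:R * alpha) l 0 l01.
  rewrite lexx ler01 subr0 !mul1r !mul0r !addr0 => /(_ isT) /point_exists[q [qx qy qw]].
  by exists q => //; exact: (ngon_radial k l).
have [q1 h1 [x1 y1 w1]] := rad k1; have [q2 h2 [x2 y2 w2]] := rad k2.
apply: (hhull_between _ u q1 q2) => //.
by split; rewrite ?px ?py ?pw ?x1 ?x2 ?y1 ?y2 ?w1 ?w2; ring.
Qed.

Variables (r theta : R).
Hypotheses (r1 : 1 < r).

(** The point is on the segment from a point of the lower polygon to the image under [hscrew] of
    another one. The factor l < 1 keeps both strictly above the boundary plane. *)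
Lemma drum_comb k1 k2 k3 k4 (l u v s : R) p :
  0 <= l < 1 -> 0 <= u <= 1 -> 0 <= v <= 1 -> 0 <= s <= 1 ->
  hx p = l * ((1 - s) * ((1 - u) * cos (k1%:R * alpha) + u * cos (k2%:R * alpha)) +
    s * r * ((1 - v) * cos (theta + k3%:R * alpha) + v * cos (theta + k4%:R * alpha))) ->
  hy p = l * ((1 - s) * ((1 - u) * sin (k1%:R * alpha) + u * sin (k2%:R * alpha)) +
    s * r * ((1 - v) * sin (theta + k3%:R * alpha) + v * sin (theta + k4%:R * alpha))) ->
  hw p = (1 - s) + s * r ^+ 2 -> drum0 n r theta r1 p.
Proof.
move=> l01 u01 v01 s01 px py pw.
have [q1 [x1 y1 w1]] :=
  point_exists _ _ _ (comb_norm (k1%:R * alpha) (k2%:R * alpha) l u l01 u01).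
have [q2 [x2 y2 w2]] :=
  point_exists _ _ _ (comb_norm (k3%:R * alpha) (k4%:R * alpha) l v l01 v01).
have h1 : std_ideal_ngon n q1 by exact: (ngon_chord k1 k2 l u).
have h2 : std_ideal_ngon n q2 by exact: (ngon_chord k3 k4 l v).
apply: (hhull_between _ s q1 (hscrew r theta r1 q2)) => //.
- split; rewrite ?hx_screw ?hy_screw ?hw_screw ?hx_rot ?hy_rot ?px ?py ?pw ?x1 ?y1 ?w1.
  + by rewrite x2 y2 cosN sinN !cosD; ring.
  + by rewrite x2 y2 cosN sinN !sinD; ring.
  + by rewrite w2; ring.
- by apply: hhull_sub; left.
- by apply: hhull_sub; right; exists q2.
Qed.

End ngon.

(** * The lateral faces, and the closed wedges that cover the drum *)

Section pieces.
Context {R : realType}.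
Implicit Types (p q : hspace R).
Variables (n : nat) (r theta : R).
Hypotheses (n3 : (3 <= n)%N) (r1 : 1 < r).
Local Notation alpha := (2 * pi / n%:R : R).
Hypotheses (th0 : 0 <= theta) (tha : theta < alpha).

(** A face of the first kind joins an edge of the lower polygon to a vertex of the upper one; a face
    of the second kind joins a vertex below to an edge above. Each is rotated so that its section at
    every height is a segment of constant abscissa, of ordinates from [lo] to [hi]. *)
Definition face1_x w := edge r (cos (alpha / 2)) (cos (theta - alpha / 2)) w.
Definition face1_lo w := edge r (- sin (alpha / 2)) (sin (theta - alpha / 2)) w.
Definition face1_hi w := edge r (sin (alpha / 2)) (sin (theta - alpha / 2)) w.
Definition face2_x w := edge r (cos (alpha / 2 - theta)) (cos (alpha / 2)) w.
Definition face2_lo w := edge r (sin (alpha / 2 - theta)) (- sin (alpha / 2)) w.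
Definition face2_hi w := edge r (sin (alpha / 2 - theta)) (sin (alpha / 2)) w.

Definition wedge1 b : set (hspace R) :=
  [set p | wedge b r face1_x face1_lo face1_hi (hcoords p)].
Definition wedge2 b : set (hspace R) :=
  [set p | wedge b r face2_x face2_lo face2_hi (hcoords p)].

Definition ang1 k := alpha / 2 + k%:R * alpha.
Definition ang2 k := theta + alpha / 2 + k%:R * alpha.

Let a0 : 0 < alpha. Proof. exact: alpha_gt0. Qed.
Let a3 : 3 * alpha <= 2 * pi. Proof. exact: alpha_le. Qed.
Let pi0 : 0 < pi :> R. Proof. exact: pi_gt0. Qed.
Let r0 : 0 < r. Proof. exact: r_gt0. Qed.

Let sin_half : 0 < sin (alpha / 2). Proof. exact: sin_half_alpha_gt0. Qed.

Let cos_half : 0 < cos (alpha / 2). Proof. exact: cos_half_alpha_gt0. Qed.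

Let cos_th : 0 < cos (theta - alpha / 2).
Proof.
move: a0 a3 pi0 th0 tha; move: (alpha) => A a0' a3' pi0' th0' tha'.
by rewrite cos_gt0_pihalf//; apply/andP; split; lra.
Qed.

Let cosC_th : cos (alpha / 2 - theta) = cos (theta - alpha / 2).
Proof. by rewrite -cosN opprB. Qed.

(* corner_p and corner_q are consecutive vertices of the section of the drum at
   height w; the next one is the rotation of corner_p by alpha. *)
Definition corner_p w : R[i] := edge r 1 (cos theta) w +i* edge r 0 (sin theta) w.
Definition corner_q w : R[i] :=
  edge r (cos alpha) (cos theta) w +i* edge r (sin alpha) (sin theta) w.

Let halfE : alpha - alpha / 2 = alpha / 2 :> R.
Proof. by field; rewrite gt_eqF// n_gt0. Qed.

Let edge_lin (c d A B A' B' w : R) :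
  c * edge r A B w + d * edge r A' B' w =
  edge r (c * A + d * A') (c * B + d * B') w.
Proof. by rewrite /edge; ring. Qed.

(** [corner_p] and [corner_q] are the ends of the section of a face of the first kind; [corner_q]
    and the rotated [corner_p] are those of a face of the second kind. The four frame lemmas give
    them in the rotated coordinates of their face. *)
Lemma frame1_p w : expi (- (alpha / 2)) * corner_p w = face1_x w +i* face1_lo w.
Proof.
apply: complex_eq; rewrite ?ReM ?ImM/= cosN sinN.
  rewrite -[_ - _]/(_ + - _) -mulNr opprK edge_lin /face1_x cosB.
  by congr edge; ring.
by rewrite edge_lin /face1_lo sinB; congr edge; ring.
Qed.

Lemma frame1_q w : expi (- (alpha / 2)) * corner_q w = face1_x w +i* face1_hi w.
Proof.
apply: complex_eq; rewrite ?ReM ?ImM/= cosN sinN.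
  rewrite -[_ - _]/(_ + - _) -mulNr opprK edge_lin; congr edge.
    by rewrite -[in RHS]halfE cosB; ring.
  by rewrite cosB; ring.
rewrite edge_lin; congr edge; last by rewrite sinB; ring.
by rewrite -[in RHS]halfE sinB; ring.
Qed.

Lemma frame2_q w : expi (- (theta + alpha / 2)) * corner_q w =
  face2_x w +i* face2_lo w.
Proof.
have e : alpha / 2 - theta = alpha - (theta + alpha / 2).
  by rewrite -[in LHS]halfE; ring.
have e' : cos (alpha / 2) = cos (theta - (theta + alpha / 2)).
  by rewrite opprD addrA subrr add0r cosN.
have e'' : - sin (alpha / 2) = sin (theta - (theta + alpha / 2)).
  by rewrite opprD addrA subrr add0r sinN.
rewrite /face2_x /face2_lo e e' e''; set t := theta + alpha / 2.
apply: complex_eq; rewrite ?ReM ?ImM/= cosN sinN.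
  rewrite -[_ - _]/(_ + - _) -mulNr opprK edge_lin !cosB.
  by congr edge; ring.
by rewrite edge_lin !sinB; congr edge; ring.
Qed.

Lemma frame2_p w : expi (- (theta + alpha / 2)) * (expi alpha * corner_p w) =
  face2_x w +i* face2_hi w.
Proof.
have e : alpha / 2 - theta = alpha - (theta + alpha / 2).
  by rewrite -[in LHS]halfE; ring.
have e' : alpha / 2 = theta + (alpha - (theta + alpha / 2)).
  by rewrite -[in LHS]halfE; ring.
rewrite mulrA -expiD [- _ + _]addrC.
rewrite /face2_x /face2_hi e [in cos (alpha / 2)]e' [in sin (alpha / 2)]e'.
set t := alpha - (theta + alpha / 2).
apply: complex_eq; rewrite ?ReM ?ImM/=.
  rewrite -[_ - _]/(_ + - _) -mulNr edge_lin cosD.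
  by congr edge; ring.
by rewrite edge_lin sinD; congr edge; ring.
Qed.

Lemma wedgeE b q X Y1 Y2 : wedge b r X Y1 Y2 (hcoords q) =
  [&& 1 < hw q ?<= if b, hw q < r ^+ 2 ?<= if b, 0 <= hx q,
      hx q < X (hw q) ?<= if b, Y1 (hw q) * hx q < hy q * X (hw q) ?<= if b &
      hy q * X (hw q) < Y2 (hw q) * hx q ?<= if b].
Proof. by []. Qed.

Lemma cross_framel psi (c : R[i]) p (A B : R) : expi (- psi) * c = A +i* B ->
  cross c (hz p) = A * hy (hrot psi p) - B * hx (hrot psi p).
Proof. by move=> h; rewrite -(cross_expi (- psi)) h. Qed.

Lemma cross_framer psi (c : R[i]) p (A B : R) : expi (- psi) * c = A +i* B ->
  cross (hz p) c = hx (hrot psi p) * B - hy (hrot psi p) * A.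
Proof. by move=> h; rewrite -(cross_expi (- psi)) h. Qed.

Let vertex_le x j k : `|x| <= alpha / 2 -> (k <= n)%N ->
  cos (x + j%:R * alpha - k%:R * alpha) <= cos x.
Proof.
move=> xa kn; have n0 : (0 < n)%N by exact: leq_trans n3.
(* A full turn, n times alpha, keeps the index j + n - k a natural number. *)
have -> : cos (x + j%:R * alpha - k%:R * alpha) = cos (x + (j + n - k)%:R * alpha).
  have := congr1 (@complex.Re R) (expi_period (x + j%:R * alpha - k%:R * alpha) 1).
  rewrite !Re_expi => <-; congr cos.
  rewrite natrB; last by rewrite (leq_trans kn)// leq_addl.
  have -> : (j + n)%:R = j%:R + n%:R :> R by rewrite natrD.
  have := n_alpha n n3 (R := R); move: (alpha) => A; rewrite !mul1r => <-; ring.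
apply: cos_vertex_le => //; apply: le_trans xa _.
by rewrite le_eqVlt; apply/orP; left; apply/eqP; field; rewrite gt_eqF// n_gt0.
Qed.

Let half_le : `|- (alpha / 2)| <= alpha / 2.
Proof. by rewrite normrN ger0_norm// ltW// divr_gt0. Qed.

Let th_le : `|theta - alpha / 2| <= alpha / 2.
Proof.
move: th0 tha; move: (alpha) => A th0' tha'.
by rewrite ler_norml; apply/andP; split; lra.
Qed.

Let thC_le : `|alpha / 2 - theta| <= alpha / 2.
Proof. by rewrite distrC. Qed.

Let level01 w : 1 <= w -> w <= r ^+ 2 -> 0 <= level r w <= 1.
Proof. by move=> w1 w2; rewrite level_ge0// level_le1// w1 w2. Qed.

Lemma face1_x_gt0 w : 1 <= w -> w <= r ^+ 2 -> 0 < face1_x w.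
Proof.
move=> w1 w2; have /andP[s0 s1] := level01 _ w1 w2.
rewrite /face1_x /edge; set s := level r w in s0 s1 *.
have h1 : 0 <= s * r * cos (theta - alpha / 2).
  by apply: mulr_ge0; [apply: mulr_ge0 => //|]; exact: ltW.
have [s1'|s1'] := ltP s 1.
  by apply: ltr_pwDl => //; apply: mulr_gt0; rewrite ?subr_gt0.
apply: ltr_wpDl; first by apply: mulr_ge0; [rewrite subr_ge0|exact: ltW].
by rewrite mulr_gt0// mulr_gt0// (lt_le_trans ltr01 s1').
Qed.

Lemma face2_x_gt0 w : 1 <= w -> w <= r ^+ 2 -> 0 < face2_x w.
Proof.
move=> w1 w2; have /andP[s0 s1] := level01 _ w1 w2.
rewrite /face2_x /edge cosC_th; set s := level r w in s0 s1 *.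
have h1 : 0 <= s * r * cos (alpha / 2).
  by apply: mulr_ge0; [apply: mulr_ge0 => //|]; exact: ltW.
have [s1'|s1'] := ltP s 1.
  by apply: ltr_pwDl => //; apply: mulr_gt0; rewrite ?subr_gt0.
apply: ltr_wpDl; first by apply: mulr_ge0; [rewrite subr_ge0|exact: ltW].
by rewrite mulr_gt0// mulr_gt0// (lt_le_trans ltr01 s1').
Qed.

(** The widths of the two kinds of faces vanish at opposite ends, w = r^2 and w = 1, where the face
    is reduced to a vertex. *)
Lemma face1_width w : face1_hi w - face1_lo w = (1 - level r w) * (2 * sin (alpha / 2)).
Proof. by rewrite /face1_hi /face1_lo /edge; ring. Qed.

Lemma face2_width w : face2_hi w - face2_lo w = level r w * r * (2 * sin (alpha / 2)).
Proof. by rewrite /face2_hi /face2_lo /edge; ring. Qed.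

(** The point lies in one of the n sectors bounded by the rotations of [corner_p], and [corner_q]
    divides that sector into the two kinds of wedges. The outer bounds come from [drum_half], as the
    vertex nearest to a direction has the largest cosine. *)
Lemma drum_cover p : drum0 n r theta r1 p -> exists2 k, (k < n)%N &
  wedge1 true (hrot (ang1 k) p) \/ wedge2 true (hrot (ang2 k) p).
Proof.
move=> Dp.
have [k kn [hP hA]] := sector_exists n (corner_p (hw p)) (hz p) (ltnW n3).
exists k => //.
have [w1 w2 x1] : [/\ 1 <= hw p, hw p <= r ^+ 2 &
    hx (hrot (ang1 k) p) <= face1_x (hw p)].
  apply: (drum_half n r theta r1 (ang1 k)) => // j jn.
    rewrite -[leRHS]cosN; have := vertex_le _ j k half_le (ltnW kn).
    by congr (cos _ <= _); rewrite /ang1; ring.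
  have := vertex_le _ j k th_le (ltnW kn).
  by congr (cos _ <= _); rewrite /ang1; ring.
have [_ _ x2] : [/\ 1 <= hw p, hw p <= r ^+ 2 &
    hx (hrot (ang2 k) p) <= face2_x (hw p)].
  apply: (drum_half n r theta r1 (ang2 k)) => // j jn.
    have := vertex_le _ j k.+1 thC_le kn.
    have e : alpha / 2 - theta + j%:R * alpha - k.+1%:R * alpha =
      j%:R * alpha - ang2 k - (alpha - alpha / 2 - alpha / 2).
      by rewrite /ang2 -natr1; ring.
    by rewrite e halfE subrr subr0.
  rewrite -[leRHS]cosN; have := vertex_le _ j k half_le (ltnW kn).
  by congr (cos _ <= _); rewrite /ang2; ring.
pose p' := hrot (k%:R * alpha) p.
have e1 : hrot (ang1 k) p = hrot (alpha / 2) p' by rewrite -hrotD.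
have e2 : hrot (ang2 k) p = hrot (theta + alpha / 2) p' by rewrite -hrotD.
have w' : hw p' = hw p by rewrite hw_rot.
rewrite e1 in x1 *; rewrite e2 in x2 *.
rewrite -w' in hP hA w1 w2 x1 x2; rewrite -/(hz p') in hP hA.
have {}hP : 0 <= cross (corner_p (hw p')) (hz p') by exact: hP.
have {}hA : 0 <= cross (hz p') (expi alpha * corner_p (hw p')) by exact: hA.
have X1 := face1_x_gt0 _ w1 w2; have X2 := face2_x_gt0 _ w1 w2.
have wd1 := face1_width (hw p'); have wd2 := face2_width (hw p').
have s01 := level01 _ w1 w2.
have cP := cross_framel _ _ p' _ _ (frame1_p (hw p')).
have cQ := cross_framer _ _ p' _ _ (frame1_q (hw p')).
have cQ2 := cross_framel _ _ p' _ _ (frame2_q (hw p')).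
have cA := cross_framer _ _ p' _ _ (frame2_p (hw p')).
have in2 : 0 < level r (hw p') -> 0 <= cross (corner_q (hw p')) (hz p') ->
    wedge2 true (hrot (theta + alpha / 2) p').
  move=> s0 hQ; rewrite /wedge2 /= wedgeE hw_rot /= w1 w2 x2/=.
  move: hQ hA; rewrite cQ2 cA; set x := hx _; set y := hy _ => hQ hA'.
  (* The sum of the two lateral inequalities; as the width is positive it gives x >= 0. *)
  have : 0 <= x * (face2_hi (hw p') - face2_lo (hw p')) by lra.
  rewrite wd2 pmulr_lge0; last first.
    by apply: mulr_gt0; [apply: mulr_gt0|rewrite mulr_gt0].
  by move=> ->; rewrite andTb; apply/andP; split; lra.
(* On the top polygon the first kind of wedge has width 0 and [corner_q] coincides with [corner_p],
   so the second kind takes the whole sector. *)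
have [s1|s1] := eqVneq (level r (hw p')) 1.
  right; apply: in2; first by rewrite s1.
  suff -> : corner_q (hw p') = corner_p (hw p') by [].
  by rewrite /corner_q /corner_p /edge s1 subrr !mul0r.
have [hQ|hQ] := leP 0 (cross (hz p') (corner_q (hw p'))).
  left; rewrite /wedge1 /= wedgeE hw_rot /= w1 w2 x1/=.
  move: hQ hP; rewrite cQ cP; set x := hx _; set y := hy _ => hQ hP'.
  have : 0 <= x * (face1_hi (hw p') - face1_lo (hw p')) by lra.
  rewrite wd1 pmulr_lge0; last first.
    apply: mulr_gt0; last by rewrite mulr_gt0.
    by rewrite subr_gt0 lt_neqAle s1; case/andP: s01.
  by move=> ->; rewrite andTb; apply/andP; split; lra.
right; apply: in2; last by rewrite crossC oppr_ge0 ltW.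
(* On the bottom polygon [corner_q] is the rotated [corner_p], so the point cannot be beyond it. *)
rewrite lt_neqAle; case/andP: (s01) => -> _; rewrite andbT eq_sym.
apply/eqP => s0; move: hQ; suff -> : corner_q (hw p') = expi alpha * corner_p (hw p').
  by rewrite ltNge hA.
by apply: complex_eq; rewrite ?ReM ?ImM /= /edge s0; ring.
Qed.

End pieces.

(** * The open wedges: inside the drum and pairwise disjoint *)

Section open_pieces.
Context {R : realType}.
Implicit Types (p q : hspace R).

(** The strict inequalities describe the open triangle 0, c, d: l = x / X is the ratio to the side
    [c, d], and u the position of the radial projection on that side. *)
Lemma frame_comb psi (c d : R[i]) p X Y1 Y2 :
  expi (- psi) * c = X +i* Y1 -> expi (- psi) * d = X +i* Y2 -> Y1 < Y2 ->
  0 <= hx (hrot psi p) -> hx (hrot psi p) < X ->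
  Y1 * hx (hrot psi p) < hy (hrot psi p) * X ->
  hy (hrot psi p) * X < Y2 * hx (hrot psi p) ->
  exists l u : R, [/\ 0 < l < 1, 0 < u < 1 & hz p = l%:C * ((1 - u)%:C * c + u%:C * d)].
Proof.
move=> cE dE Y12; set x := hx _; set y := hy _ => x0 xX h1 h2.
have X0 : 0 < X by exact: le_lt_trans xX.
have {}x0 : 0 < x.
  rewrite lt_neqAle x0 andbT; apply/eqP => x00; move: h1 h2; rewrite -x00 !mulr0.
  by move=> h1 h2; have := lt_trans h1 h2; rewrite ltxx.
have Y0 : 0 < Y2 - Y1 by rewrite subr_gt0.
have z1 : Y1 < y * X / x by rewrite ltr_pdivlMr.
have z2 : y * X / x < Y2 by rewrite ltr_pdivrMr.
exists (x / X), ((y * X / x - Y1) / (Y2 - Y1)); split.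
- by rewrite divr_gt0//= ltr_pdivrMr// mul1r.
- by rewrite divr_gt0 ?subr_gt0//= ltr_pdivrMr// mul1r ltrD2r.
set u := _ / (Y2 - Y1); set l := x / X.
rewrite -[LHS](expiNK psi) -[RHS](expiNK psi); congr (_ * _).
have -> : expi (- psi) * hz p = x +i* y by apply: complex_eq.
transitivity (l%:C * ((1 - u)%:C * (X +i* Y1) + u%:C * (X +i* Y2))); last first.
  by rewrite -cE -dE; ring.
have lX : l * X = x by rewrite /l divfK// gt_eqF.
have uY : l * u * (Y2 - Y1) = y - l * Y1.
  rewrite -mulrA /u divfK ?gt_eqF// /l; field.
  by rewrite !gt_eqF.
clearbody l u x y.
apply: complex_eq; rewrite ?(ReM, ImM, ReD, ImD) /= !mul0r ?subr0 ?addr0.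
  by apply: etrans (esym lX) _; ring.
have yE : y = l * u * (Y2 - Y1) + l * Y1 by rewrite uY; ring.
by apply: etrans yE _; ring.
Qed.

Lemma cross_comb (c d e : R[i]) (l u : R) :
  cross c (l%:C * ((1 - u)%:C * d + u%:C * e)) =
  l * ((1 - u) * cross c d + u * cross c e).
Proof. by rewrite /cross ?(ReM, ImM, ReD, ImD) /= !mul0r ?subr0 ?addr0; ring. Qed.

Lemma cross_gt0_comb (c d e : R[i]) (l u : R) : 0 < l < 1 -> 0 < u < 1 ->
  0 <= cross c d -> 0 <= cross c e -> (0 < cross c d) || (0 < cross c e) ->
  0 < cross c (l%:C * ((1 - u)%:C * d + u%:C * e)).
Proof.
move=> /andP[l0 _] /andP[u0 u1] cd ce cde; rewrite cross_comb mulr_gt0//.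
have u1' : 0 < 1 - u by rewrite subr_gt0.
case/orP : cde => h.
  by apply: ltr_pwDl; [exact: mulr_gt0|rewrite mulr_ge0// ltW].
by apply: ltr_wpDl; [rewrite mulr_ge0// ltW|exact: mulr_gt0].
Qed.

Lemma cross_gt0_combl (c d e : R[i]) (l u : R) : 0 < l < 1 -> 0 < u < 1 ->
  0 <= cross d c -> 0 <= cross e c -> (0 < cross d c) || (0 < cross e c) ->
  0 < cross (l%:C * ((1 - u)%:C * d + u%:C * e)) c.
Proof.
move=> /andP[l0 _] /andP[u0 u1] cd ce cde; rewrite crossC cross_comb.
rewrite -mulrN opprD -!mulrN -!(crossC _ c) mulr_gt0//.
have u1' : 0 < 1 - u by rewrite subr_gt0.
case/orP : cde => h.
  by apply: ltr_pwDl; [exact: mulr_gt0|rewrite mulr_ge0// ltW].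
by apply: ltr_wpDl; [rewrite mulr_ge0// ltW|exact: mulr_gt0].
Qed.

Lemma cross_self (c : R[i]) : cross c c = 0.
Proof. by rewrite /cross mulrC subrr. Qed.

Variables (n : nat) (r theta : R).
Hypotheses (n3 : (3 <= n)%N) (r1 : 1 < r).
Local Notation alpha := (2 * pi / n%:R : R).
Hypotheses (th0 : 0 <= theta) (tha : theta < alpha).
Local Notation P := (corner_p r theta).
Local Notation Q := (corner_q n r theta).
Local Notation face1_x := (face1_x n r theta).
Local Notation face2_x := (face2_x n r theta).

Let a0 : 0 < alpha. Proof. exact: alpha_gt0. Qed.
Let a3 : 3 * alpha <= 2 * pi. Proof. exact: alpha_le. Qed.
Let pi0 : 0 < pi :> R. Proof. exact: pi_gt0. Qed.
Let r0 : 0 < r. Proof. exact: r_gt0. Qed.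

Let sin_half : 0 < sin (alpha / 2). Proof. exact: sin_half_alpha_gt0. Qed.

Let sin_alpha : 0 < sin alpha.
Proof.
move: a0 a3 pi0; move: (alpha) => A a0' a3' pi0'.
by rewrite sin_gt0_pi//; apply/andP; split; lra.
Qed.

Lemma face1_lt w : w < r ^+ 2 -> face1_lo n r theta w < face1_hi n r theta w.
Proof.
move=> w2; rewrite -subr_gt0 face1_width; apply: mulr_gt0.
  by rewrite subr_gt0 level_lt1.
by rewrite mulr_gt0.
Qed.

Lemma face2_lt w : 1 < w -> face2_lo n r theta w < face2_hi n r theta w.
Proof.
move=> w1; rewrite -subr_gt0 face2_width; apply: mulr_gt0; last by rewrite mulr_gt0.
by apply: mulr_gt0 => //; rewrite level_gt0.
Qed.

Lemma corners_cross w : 1 < w -> w < r ^+ 2 ->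
  [/\ 0 < cross (P w) (Q w), 0 < cross (Q w) (expi alpha * P w) &
      0 < cross (P w) (expi alpha * P w)].
Proof.
move=> w1 w2; split.
- rewrite -(cross_expi (- (alpha / 2))) frame1_p frame1_q// /cross/=.
  rewrite [face1_lo _ _ _ _ * _]mulrC -mulrBr; apply: mulr_gt0.
    by apply: face1_x_gt0 => //; exact: ltW.
  by rewrite subr_gt0 face1_lt.
- rewrite -(cross_expi (- (theta + alpha / 2))) frame2_p// frame2_q// /cross/=.
  rewrite [face2_lo _ _ _ _ * _]mulrC -mulrBr; apply: mulr_gt0.
    by apply: face2_x_gt0 => //; exact: ltW.
  by rewrite subr_gt0 face2_lt.
have -> : cross (P w) (expi alpha * P w) =
    (complex.Re (P w) ^+ 2 + complex.Im (P w) ^+ 2) * sin alpha.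
  by rewrite /cross ReM ImM /=; ring.
apply: mulr_gt0 => //; rewrite lt_neqAle addr_ge0 ?sqr_ge0// andbT eq_sym.
rewrite paddr_eq0 ?sqr_ge0// !sqrf_eq0; apply/negP => /andP[/eqP h1 /eqP h2].
have := frame1_p n r theta w; have -> : P w = 0 by exact: complex_eq.
rewrite mulr0 => /(congr1 (@complex.Re R))/= h.
have := face1_x_gt0 n r theta n3 r1 th0 tha w (ltW w1) (ltW w2).
by rewrite -h ltxx.
Qed.

Lemma wedge1_comb k p : wedge1 n r theta false (hrot (ang1 n k) p) ->
  [/\ 1 < hw p, hw p < r ^+ 2 & exists l u, [/\ 0 < l < 1, 0 < u < 1 &
  hz (hrot (k%:R * alpha) p) =
    l%:C * ((1 - u)%:C * P (hw p) + u%:C * Q (hw p))]].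
Proof.
rewrite /ang1 hrotD /wedge1/= wedgeE hw_rot.
set p' := hrot (k%:R * alpha) p; have -> : hw p' = hw p by rewrite hw_rot.
move=> /and5P[/= w1 w2 x0 xX /andP[h1 h2]]; split => //.
by apply: (frame_comb _ _ _ p' _ _ _ (frame1_p _ _ _ _) (frame1_q _ _ _ n3 _)) => //;
  apply: face1_lt.
Qed.

Lemma wedge2_comb k p : wedge2 n r theta false (hrot (ang2 n theta k) p) ->
  [/\ 1 < hw p, hw p < r ^+ 2 & exists l u, [/\ 0 < l < 1, 0 < u < 1 &
  hz (hrot (k%:R * alpha) p) =
    l%:C * ((1 - u)%:C * Q (hw p) + u%:C * (expi alpha * P (hw p)))]].
Proof.
rewrite /ang2 hrotD /wedge2/= wedgeE hw_rot.
set p' := hrot (k%:R * alpha) p; have -> : hw p' = hw p by rewrite hw_rot.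
move=> /and5P[/= w1 w2 x0 xX /andP[h1 h2]]; split => //.
by apply: (frame_comb _ _ _ p' _ _ _ (frame2_q _ _ _ n3 _) (frame2_p _ _ _ n3 _)) => //;
  apply: face2_lt.
Qed.

Let succ_ang k : k%:R * alpha + alpha = k.+1%:R * alpha.
Proof. by rewrite -natr1; ring. Qed.

(** Expanding the two corners by [edge] exhibits the point as a combination of the lower vertices k
    and k + 1 and the upper vertex k. *)
Lemma wedge1_drum k p : wedge1 n r theta false (hrot (ang1 n k) p) ->
  drum0 n r theta r1 p.
Proof.
move=> /wedge1_comb[w1 w2 [l [u [/andP[l0 l1] /andP[u0 u1] zE]]]].
have {zE} : hz p = expi (k%:R * alpha) *
    (l%:C * ((1 - u)%:C * P (hw p) + u%:C * Q (hw p))) by rewrite -zE expiNK.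
move=> /[dup] /(congr1 (@complex.Re R)) zr /(congr1 (@complex.Im R)) zi.
apply: (drum_comb n n3 r theta r1 k k.+1 k k l u 0 (level r (hw p))).
- by rewrite ltW.
- by rewrite !ltW.
- by rewrite lexx ler01.
- by rewrite level_ge0// level_le1// !ltW.
- rewrite /hx zr ?(ReM, ImM, ReD, ImD) /= !mul0r ?subr0 ?addr0 /edge.
  by rewrite -succ_ang !(cosD (k%:R * alpha)) [theta + _]addrC cosD; ring.
- rewrite /hy zi ?(ReM, ImM, ReD, ImD) /= !mul0r ?subr0 ?addr0 /edge.
  by rewrite -succ_ang !(sinD (k%:R * alpha)) [theta + _]addrC sinD; ring.
exact: levelK.
Qed.

Lemma wedge2_drum k p : wedge2 n r theta false (hrot (ang2 n theta k) p) ->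
  drum0 n r theta r1 p.
Proof.
move=> /wedge2_comb[w1 w2 [l [u [/andP[l0 l1] /andP[u0 u1] zE]]]].
have {zE} : hz p = expi (k%:R * alpha) *
    (l%:C * ((1 - u)%:C * Q (hw p) + u%:C * (expi alpha * P (hw p)))).
  by rewrite -zE expiNK.
move=> /[dup] /(congr1 (@complex.Re R)) zr /(congr1 (@complex.Im R)) zi.
apply: (drum_comb n n3 r theta r1 k.+1 k.+1 k k.+1 l 0 u (level r (hw p))).
- by rewrite ltW.
- by rewrite lexx ler01.
- by rewrite !ltW.
- by rewrite level_ge0// level_le1// !ltW.
- rewrite /hx zr ?(ReM, ImM, ReD, ImD) /= !mul0r ?subr0 ?addr0 /edge.
  rewrite -succ_ang ![theta + _]addrC -addrA !(cosD (k%:R * alpha)).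
  by rewrite (cosD alpha) (sinD alpha); ring.
- rewrite /hy zi ?(ReM, ImM, ReD, ImD) /= !mul0r ?subr0 ?addr0 /edge.
  rewrite -succ_ang ![theta + _]addrC -addrA !(sinD (k%:R * alpha)).
  by rewrite (cosD alpha) (sinD alpha); ring.
exact: levelK.
Qed.

Lemma wedge1_sector k p : wedge1 n r theta false (hrot (ang1 n k) p) ->
  let z := hz (hrot (k%:R * alpha) p) in
  [/\ 0 < cross (P (hw p)) z, 0 < cross z (expi alpha * P (hw p)) &
      0 < cross z (Q (hw p))].
Proof.
move=> /wedge1_comb[w1 w2 [l [u [l01 u01 ->]]]]/=.
have [pq qa pa] := corners_cross _ w1 w2.
by split; [apply: cross_gt0_comb|apply: cross_gt0_combl|apply: cross_gt0_combl];
  rewrite // ?cross_self ?pq ?pa ?qa ?orbT//; apply: ltW.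
Qed.

Lemma wedge2_sector k p : wedge2 n r theta false (hrot (ang2 n theta k) p) ->
  let z := hz (hrot (k%:R * alpha) p) in
  [/\ 0 < cross (P (hw p)) z, 0 < cross z (expi alpha * P (hw p)) &
      0 < cross (Q (hw p)) z].
Proof.
move=> /wedge2_comb[w1 w2 [l [u [l01 u01 ->]]]]/=.
have [pq qa pa] := corners_cross _ w1 w2.
by split; [apply: cross_gt0_comb|apply: cross_gt0_combl|apply: cross_gt0_comb];
  rewrite // ?cross_self ?pq ?pa ?qa ?orbT//; apply: ltW.
Qed.

Definition piece b (c : bool) (k : nat) : set (hspace R) :=
  [set p | if c then wedge1 n r theta b (hrot (ang1 n k) p)
           else wedge2 n r theta b (hrot (ang2 n theta k) p)].

(* Only the open pieces are shown to be in the drum, which suffices as open and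
   closed pieces have the same volume. *)
Lemma piece_drum c k : piece false c k `<=` drum0 n r theta r1.
Proof. by case: c => p; [exact: wedge1_drum|exact: wedge2_drum]. Qed.

Lemma drum_piece p : drum0 n r theta r1 p ->
  exists c, exists2 k, (k < n)%N & piece true c k p.
Proof.
move=> /(drum_cover n r theta n3 r1 th0 tha)[k kn [h|h]].
  by exists true, k.
by exists false, k.
Qed.

(** [sector_unique] separates different indices; within one sector the two kinds are on opposite
    sides of [corner_q]. *)
Lemma piece_disjoint c c' k k' p : (k < n)%N -> (k' < n)%N ->
  piece false c k p -> piece false c' k' p -> c = c' /\ k = k'.
Proof.
move=> kn kn'.
have sec d j : piece false d j p -> let z := hz (hrot (j%:R * alpha) p) in
    [/\ 0 < cross (P (hw p)) z, 0 < cross z (expi alpha * P (hw p)) &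
      if d then 0 < cross z (Q (hw p)) else 0 < cross (Q (hw p)) z].
  by case: d; [exact: wedge1_sector|exact: wedge2_sector].
move=> /sec[h1 h2 h3] /sec[h1' h2' h3'].
have kk : k = k'.
  exact: (sector_unique n k k' (P (hw p)) (hz p) (ltnW n3) kn kn' h1 h2 h1' h2').
split => //; move: h3 h3'; rewrite -kk.
case: c; case: c' => //; rewrite [X in _ < X]crossC oppr_gt0 => ha hb.
  by have := lt_trans ha hb; rewrite ltxx.
by have := lt_trans ha hb; rewrite ltxx.
Qed.

End open_pieces.

(** * Additivity of the volume *)

Section additivity.
Context {R : realType}.
Local Notation mu := (@lebesgue_measure R).

Lemma hvol_sum (I : Type) (s : seq I) (f : I -> R * R * R -> \bar R) :
  (forall i, measurable_fun setT (f i)) -> (forall i x, 0 <= f i x)%E ->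
  (hvol (fun x => \sum_(i <- s) f i x) = \sum_(i <- s) hvol (f i))%E.
Proof.
move=> mf f0; rewrite /hvol.
have mp : measurable_fun setT (fun p : R * R * R => (posinv p.2 ^+ 3)%:E).
  apply/measurable_EFinP; apply: measurable_funX.
  by apply: (measurableT_comp measurable_posinv); exact: measurable_snd.
transitivity (\int[plane_measure \x mu]_x
    (\sum_(i <- s) (f i x * (posinv x.2 ^+ 3)%:E))%E)%E.
  by apply: eq_integral => x _; rewrite ge0_sume_distrl.
apply: (@ge0_integral_sum _ _ _ (plane_measure \x mu)%E setT measurableT I
  (fun i x => f i x * (posinv x.2 ^+ 3)%:E)%E).
  by move=> i; apply: emeasurable_funM; [exact: mf|exact: mp].
by move=> i x _; rewrite mule_ge0// lee_fin exprn_ge0// posinv_ge0.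
Qed.

Lemma le_hvol (f g : R * R * R -> \bar R) : (forall x, 0 <= f x)%E ->
  (forall x y t, (0 < t)%R -> f (x, y, t) <= g (x, y, t))%E -> (hvol f <= hvol g)%E.
Proof.
move=> f0 fg; apply: ge0_le_integral_nomeas => [x|[[x y] t]].
  by rewrite mule_ge0// lee_fin exprn_ge0// posinv_ge0.
rewrite /posinv/=; case: ifPn => [t0|_]; last by rewrite expr0n/= !mule0.
by rewrite lee_wpmul2r ?fg// lee_fin exprn_ge0// invr_ge0 ltW.
Qed.

Lemma measurable_ind_coords (A : set (hspace R)) : hmeasurable A ->
  measurable_fun setT (fun x : R * R * R => ind (x \in hcoords @` A) : \bar R).
Proof.
move=> mA; apply: measurable_ind; apply: (measurable_fun_bool true) => //.
rewrite setTI (_ : _ @^-1` _ = hcoords @` A)//.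
by apply/seteqP; split=> x; [exact: set_mem|exact: mem_set].
Qed.

(** A is an arbitrary set, to be applied to a hull: only the pieces B i need measurable indicators,
    for the integral of their sum. *)
Lemma hvolume_cover (I : finType) (A : set (hspace R)) (B : I -> set (hspace R)) :
  (forall i, hmeasurable (B i)) -> (forall p, A p -> exists i, B i p) ->
  (hvolume A <= \sum_i hvolume (B i))%E.
Proof.
move=> mB AB; under eq_bigr => i _ do rewrite hvolumeE.
rewrite hvolumeE -hvol_sum; last 2 first.
- by move=> i; exact: measurable_ind_coords.
- by move=> i x; exact: ind_ge0.
apply: le_hvol => [x|x y t t0]; first exact: ind_ge0.
have [p <-] := hcoords_surj x y t t0.
have sum0 : (0 <= \sum_i ind (hcoords p \in hcoords @` B i) :> \bar R)%E.
  by apply: sume_ge0 => i _; exact: ind_ge0.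
rewrite {1}/ind; case: ifPn => // /set_mem/hcoords_image/AB[i Bi].
rewrite (bigD1 i)//= (_ : _ \in _ = true); last exact/mem_set/hcoords_image.
by rewrite leeDl// sume_ge0// => j _; exact: ind_ge0.
Qed.

Lemma hvolume_packing (I : finType) (A : set (hspace R)) (B : I -> set (hspace R)) :
  (forall i, hmeasurable (B i)) -> (forall i, B i `<=` A) ->
  (forall i j p, B i p -> B j p -> i = j) ->
  (\sum_i hvolume (B i) <= hvolume A)%E.
Proof.
move=> mB BA Bd; under eq_bigr => i _ do rewrite hvolumeE.
rewrite hvolumeE -hvol_sum; last 2 first.
- by move=> i; exact: measurable_ind_coords.
- by move=> i x; exact: ind_ge0.
apply: le_hvol => [x|x y t t0].
  by apply: sume_ge0 => i _; exact: ind_ge0.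
have [p <-] := hcoords_surj x y t t0.
have [[i Bi]|nB] := pselect (exists i, B i p); last first.
  rewrite big1 ?ind_ge0// => i _; rewrite /ind ifN//.
  by apply/negP => /set_mem/hcoords_image Bi; apply: nB; exists i.
rewrite (bigD1 i)//= big1 => [|j ji]; last first.
  rewrite /ind ifN//; apply/negP => /set_mem/hcoords_image Bj.
  by move: ji; rewrite (Bd _ _ _ Bi Bj) eqxx.
rewrite adde0 (_ : _ \in _ = true); last exact/mem_set/hcoords_image.
rewrite (_ : _ \in _ = true)//; apply/mem_set/hcoords_image; exact: BA Bi.
Qed.

(** The squared norm is convex: the defect is s (1 - s) times the squared distance of the two
    points. *)
Lemma sqr_comb_lt (x1 y1 x2 y2 s A B : R) : 0 < s < 1 ->
  x1 ^+ 2 + y1 ^+ 2 <= A -> x2 ^+ 2 + y2 ^+ 2 <= B ->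
  (x1 ^+ 2 + y1 ^+ 2 < A) || (x2 ^+ 2 + y2 ^+ 2 < B) ->
  ((1 - s) * x1 + s * x2) ^+ 2 + ((1 - s) * y1 + s * y2) ^+ 2 <
  (1 - s) * A + s * B.
Proof.
move=> /andP[s0 s1] hA hB hAB; have s1' : 0 < 1 - s by rewrite subr_gt0.
have -> : ((1 - s) * x1 + s * x2) ^+ 2 + ((1 - s) * y1 + s * y2) ^+ 2 =
  (1 - s) * (x1 ^+ 2 + y1 ^+ 2) + s * (x2 ^+ 2 + y2 ^+ 2) -
  (1 - s) * s * ((x1 - x2) ^+ 2 + (y1 - y2) ^+ 2) by ring.
have h : 0 <= (1 - s) * s * ((x1 - x2) ^+ 2 + (y1 - y2) ^+ 2).
  by rewrite mulr_ge0 ?addr_ge0 ?sqr_ge0// ltW// mulr_gt0.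
rewrite -(ler_pM2l s1') in hA; rewrite -(ler_pM2l s0) in hB.
by move: hAB; rewrite -[X in X || _](ltr_pM2l s1') -[X in _ || X](ltr_pM2l s0);
  case/orP => hAB; lra.
Qed.

Lemma chord_norm (A u : R) : 0 < sin A -> 0 < u < 1 ->
  cos A ^+ 2 + (- sin A + u * (2 * sin A)) ^+ 2 < 1.
Proof.
move=> sA /andP[u0 u1]; have cs := cos2Dsin2 A; rewrite -[ltRHS]cs.
rewrite -subr_gt0; set d := (X in 0 < X).
have -> : d = 4 * (u * (1 - u) * sin A ^+ 2) by rewrite /d; ring.
by rewrite mulr_gt0// mulr_gt0 ?exprn_gt0// mulr_gt0// subr_gt0.
Qed.

End additivity.

Section drum_volume.
Context {R : realType}.
Local Notation mu := (@lebesgue_measure R).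
Variables (n : nat) (r theta : R).
Hypotheses (n3 : (3 <= n)%N) (r1 : 1 < r).
Local Notation alpha := (2 * pi / n%:R : R).
Hypotheses (th0 : 0 <= theta) (tha : theta < alpha).

Definition face_volume (X Y1 Y2 : R -> R) : \bar R :=
  (\int[mu]_(s in `]0%R, 1%R[) \int[mu]_(t in `]1%R, r[)
    (face_density X Y1 Y2 s t)%:E)%E.

Let measurable_edge A B : measurable_fun setT (edge r A B).
Proof.
have ml : measurable_fun setT (level r).
  apply: measurable_funM; last exact: measurable_cst.
  by apply: measurable_funB => //; exact: measurable_cst.
apply: measurable_funD; (apply: measurable_funM; last exact: measurable_cst).
  by apply: measurable_funB => //; exact: measurable_cst.
by apply: measurable_funM => //; exact: measurable_cst.
Qed.

Let hmeasurable_wedge b (X Y1 Y2 : R -> R) : measurable_fun setT X ->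
  measurable_fun setT Y1 -> measurable_fun setT Y2 ->
  hmeasurable [set p | wedge b r X Y1 Y2 (hcoords p)].
Proof.
move=> mX mY1 mY2; rewrite /hmeasurable.
rewrite (_ : _ @` _ = (snd @^-1` `]0, +oo[%classic) `&`
    (wedge b r X Y1 Y2) @^-1` [set true]); last first.
  apply/seteqP; split=> [_ [p /= h <-]|[[x y] t] [/=]].
    by split => //=; rewrite in_itv/= andbT ht_gt0.
  rewrite in_itv/= andbT => t0 h; have [p pE] := hcoords_surj x y t t0.
  by exists p => //=; rewrite pE.
apply: measurableI.
  by rewrite -[X in measurable X]setTI; apply: measurable_snd.
rewrite -[X in measurable X]setTI; apply: measurable_wedge => //.
Qed.

Let hvolume_wedge b (X Y1 Y2 : R -> R) :
  hvolume [set p | wedge b r X Y1 Y2 (hcoords p)] =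
  hvol (fun x => ind (wedge b r X Y1 Y2 x)).
Proof.
rewrite hvolumeE; apply: eq_hvol => x y t t0; congr ind.
have [p <-] := hcoords_surj x y t t0.
by apply/idP/idP => [/set_mem/hcoords_image//|h]; apply/mem_set/hcoords_image.
Qed.

Let r0 : 0 < r. Proof. exact: r_gt0. Qed.
Let sin_half : 0 < sin (alpha / 2). Proof. exact: sin_half_alpha_gt0. Qed.

Local Notation V1 :=
  (face_volume (face1_x n r theta) (face1_lo n r theta) (face1_hi n r theta)).
Local Notation V2 :=
  (face_volume (face2_x n r theta) (face2_lo n r theta) (face2_hi n r theta)).

(** The inside of the face is strictly above the boundary plane: |z|^2 is convex along its segments
    while w is affine, and strictness comes from the inside of the chord. *)
Lemma face1_norm w u : 1 < w < r ^+ 2 -> 0 < u < 1 ->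
  face1_x n r theta w ^+ 2 + (face1_lo n r theta w +
    u * (face1_hi n r theta w - face1_lo n r theta w)) ^+ 2 < w.
Proof.
move=> /andP[w1 w2] u01; rewrite [ltRHS](levelK r r1).
have s01 : 0 < level r w < 1 by rewrite level_gt0// level_lt1// w1 w2.
have -> : face1_lo n r theta w +
    u * (face1_hi n r theta w - face1_lo n r theta w) =
    (1 - level r w) * (- sin (alpha / 2) + u * (2 * sin (alpha / 2))) +
    level r w * (r * sin (theta - alpha / 2)).
  by rewrite face1_width /face1_lo /edge; ring.
rewrite /face1_x /edge -(mulrA (level r w) r) -[X in _ < X + _]mulr1.
have h := chord_norm _ _ sin_half u01.
have e : (r * cos (theta - alpha / 2)) ^+ 2 + (r * sin (theta - alpha / 2)) ^+ 2 = r ^+ 2.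
  by rewrite !exprMn -mulrDr cos2Dsin2 mulr1.
apply: sqr_comb_lt => //; rewrite ?e ?h ?lexx//.
exact: ltW.
Qed.

Lemma face2_norm w u : 1 < w < r ^+ 2 -> 0 < u < 1 ->
  face2_x n r theta w ^+ 2 + (face2_lo n r theta w +
    u * (face2_hi n r theta w - face2_lo n r theta w)) ^+ 2 < w.
Proof.
move=> /andP[w1 w2] u01; rewrite [ltRHS](levelK r r1).
have s01 : 0 < level r w < 1 by rewrite level_gt0// level_lt1// w1 w2.
have -> : face2_lo n r theta w +
    u * (face2_hi n r theta w - face2_lo n r theta w) =
    (1 - level r w) * sin (alpha / 2 - theta) +
    level r w * (r * (- sin (alpha / 2) + u * (2 * sin (alpha / 2)))).
  by rewrite face2_width /face2_lo /edge; ring.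
rewrite /face2_x /edge -(mulrA (level r w) r) -[X in _ < X + _]mulr1.
have h := chord_norm _ _ sin_half u01.
have e : (r * cos (alpha / 2)) ^+ 2 +
  (r * (- sin (alpha / 2) + u * (2 * sin (alpha / 2)))) ^+ 2 < r ^+ 2.
  by rewrite !exprMn -mulrDr -[ltRHS]mulr1 ltr_pM2l// exprn_gt0.
apply: sqr_comb_lt => //; rewrite ?cos2Dsin2 ?e ?lexx ?orbT//.
exact: ltW.
Qed.

Lemma wedge1_volume b : hmeasurable (wedge1 n r theta b) /\
  hvolume (wedge1 n r theta b) = V1.
Proof.
split; first by apply: hmeasurable_wedge; exact: measurable_edge.
rewrite /wedge1 hvolume_wedge hvol_wedge//; try exact: measurable_edge.
move=> w w12; split.
- by case/andP: w12 => w1 w2; apply: face1_x_gt0 => //; exact: ltW.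
- by case/andP: w12 => w1 w2; apply: face1_lt.
- by move=> s s01; exact: face1_norm.
Qed.

Lemma wedge2_volume b : hmeasurable (wedge2 n r theta b) /\
  hvolume (wedge2 n r theta b) = V2.
Proof.
split; first by apply: hmeasurable_wedge; exact: measurable_edge.
rewrite /wedge2 hvolume_wedge hvol_wedge//; try exact: measurable_edge.
move=> w w12; split.
- by case/andP: w12 => w1 w2; apply: face2_x_gt0 => //; exact: ltW.
- by case/andP: w12 => w1 w2; apply: face2_lt.
- by move=> s s01; exact: face2_norm.
Qed.

(** A piece is the preimage under a rotation of one of two fixed wedges, and the rotation composed
    with g preserves distances, hence volume. *)
Lemma piece_volume (g : hspace R -> hspace R) b c k : hisometry g ->
  hmeasurable (g @^-1` piece n r theta b c k) /\
  hvolume (g @^-1` piece n r theta b c k) = if c then V1 else V2.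
Proof.
move=> /hisometry_cosh gc.
have rot psi : vol_pres (hrot psi \o g).
  by apply: cosh_pres_vol_pres => p q /=; rewrite coshd_rot gc.
case: c.
  have [m1 m2] := wedge1_volume b.
  by have [h1 h2] := rot (ang1 n k) _ m1; split; [exact: h1|rewrite -m2 -h2].
have [m1 m2] := wedge2_volume b.
by have [h1 h2] := rot (ang2 n theta k) _ m1; split; [exact: h1|rewrite -m2 -h2].
Qed.

(** Covering by the 2n closed pieces bounds the volume above, packing of the 2n open ones bounds it
    below, and both sums are n (V1 + V2). *)
Lemma drum_volume D : is_drum n r theta D ->
  hvolume D = (n%:R%:E * (V1 + V2))%E.
Proof.
move=> /(drum_preimage n r theta r1)[g ig ->].
have V10 : (0 <= V1)%E.
  by have [_ <-] := wedge1_volume true; rewrite hvolume_wedge; apply: integral_ge0 => x _;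
   rewrite mule_ge0 ?ind_ge0// lee_fin exprn_ge0// posinv_ge0.
have V20 : (0 <= V2)%E.
  by have [_ <-] := wedge2_volume true; rewrite hvolume_wedge; apply: integral_ge0 => x _;
   rewrite mule_ge0 ?ind_ge0// lee_fin exprn_ge0// posinv_ge0.
have sumE b : (\sum_(i : bool * 'I_n) hvolume (g @^-1` piece n r theta b i.1 i.2) =
    n%:R%:E * (V1 + V2))%E.
  under eq_bigr => i _ do rewrite (piece_volume g b i.1 i.2 ig).2.
  rewrite -(pair_bigA _ (fun (c : bool) (k : 'I_n) => if c then V1 else V2)) /=.
  rewrite big_bool/=. rewrite !sumr_const !card_ord.
  by rewrite ge0_muleDr// !mule_natl.
apply/eqP; rewrite eq_le; apply/andP; split.
  rewrite -(sumE true); apply: hvolume_cover => [i|p Dp].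
    by have [] := piece_volume g true i.1 i.2 ig.
  have [c [k kn h]] := drum_piece n r theta n3 r1 th0 tha _ Dp.
  by exists (c, Ordinal kn).
rewrite -(sumE false); apply: hvolume_packing => [i|i p|[c k] [c' k'] p h h'].
- by have [] := piece_volume g false i.1 i.2 ig.
- by apply: piece_drum.
have [/= cc kk] := piece_disjoint n r theta n3 r1 th0 tha _ _ _ _ _
  (ltn_ord k) (ltn_ord k') h h'.
by rewrite cc; congr pair; exact: val_inj.
Qed.

End drum_volume.

(** * The dilogarithm along a ray *)

Section real_analytic.
Context {R : realType}.
Implicit Types (c : nat -> R) (h : R -> R).

(** The secant of a power dominates its derivative at the left end. This bounds the terms of a
    differentiated series by those of the series at a larger point. *)
Lemma succ_expr_le (k s : R) m : 0 <= k -> k <= s ->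
  m.+1%:R * k ^+ m * (s - k) <= s ^+ m.+1 - k ^+ m.+1.
Proof.
move=> k0 ks; elim: m => [|m IH]; first by rewrite !expr1 expr0; lra.
have s0 : 0 <= s by exact: le_trans ks.
have h1 : k * (s ^+ m.+1 - k ^+ m.+1) <= s * (s ^+ m.+1 - k ^+ m.+1).
  by rewrite ler_wpM2r// subr_ge0 lerXn2r.
have h2 := ler_wpM2l k0 IH.
have := lerD (le_trans h2 h1) (lexx (k ^+ m.+1 * (s - k))).
congr (_ <= _); last by rewrite (exprS s m.+1) (exprS k m.+1); ring.
by rewrite -(natr1 m.+1) (exprS k m); ring.
Qed.

Lemma seriesS (u : nat -> R) n : series u n.+1 = u 0 + series (fun i => u i.+1) n.
Proof. by rewrite /series/= big_nat_recl. Qed.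

Lemma cvg_seriesS (u : nat -> R) l : series u @ \oo --> l ->
  series (fun i => u i.+1) @ \oo --> l - u 0.
Proof.
rewrite -cvg_shiftS => /= h.
have -> : series (fun i => u i.+1) = (fun n => series u n.+1 - u 0).
  by apply/funext => n; rewrite seriesS addrC addKr.
by apply: cvgB => //; exact: cvg_cst.
Qed.

(** Between |x| and rho are placed s < s': convergence at s' gives absolute convergence at s, which
    dominates the differentiated series at x by [succ_expr_le]. *)
Lemma cvg_pseries_diffs c rho :
  (forall x, `|x| < rho -> cvgn (pseries c x)) ->
  forall x, `|x| < rho -> cvgn (pseries (pseries_diffs c) x).
Proof.
move=> cc x xr; set k := `|x|; have k0 : 0 <= k by exact: normr_ge0.
pose s := (k + rho) / 2; pose s' := (s + rho) / 2.
have ks : k < s by rewrite /s; move: xr; rewrite -/k; lra.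
have ss' : s < s' by rewrite /s' /s; move: xr; rewrite -/k; lra.
have s'r : s' < rho by rewrite /s' /s; move: xr; rewrite -/k; lra.
have s0 : 0 <= s by exact: ltW (le_lt_trans k0 ks).
have s'0 : 0 <= s' by exact: ltW (le_lt_trans s0 ss').
have cs : cvgn (pseries (fun i => `|c i|) s).
  apply: (@is_cvg_pseries_inside_norm _ _ s').
    by apply: cc; rewrite ger0_norm.
  by rewrite !ger0_norm.
have cs1 : cvgn (series (fun i => (s - k)^-1 * (`|c i.+1| * s ^+ i.+1))).
  apply: is_cvg_seriesZ; move/cvg_ex : cs => [l hl].
  by apply/cvg_ex; exists (l - `|c 0| * s ^+ 0); exact: cvg_seriesS hl.
apply: normed_cvg; apply: (series_le_cvg _ _ _ cs1) => i.
- exact: normr_ge0.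
- by rewrite mulr_ge0 ?invr_ge0 ?subr_ge0 ?mulr_ge0 ?exprn_ge0// ltW.
have sk : 0 < s - k by rewrite subr_gt0.
rewrite /= /pseries_diffs normrM normrX -/k normrM ger0_norm//.
rewrite [leRHS]mulrC ler_pdivlMr//.
have ki : 0 <= k ^+ i.+1 by rewrite exprn_ge0.
have h := ler_wpM2l (normr_ge0 (c i.+1)) (succ_expr_le k s i k0 (ltW ks)).
have h2 : 0 <= `|c i.+1| * k ^+ i.+1 by rewrite mulr_ge0.
lra.
Qed.

Definition psum_at c (t0 rho : R) h :=
  forall t : R, `|t - t0| < rho -> pseries c (t - t0) @ \oo --> h t.

Lemma psum_at_add c c' t0 rho h h' : psum_at c t0 rho h -> psum_at c' t0 rho h' ->
  psum_at (fun i => c i + c' i) t0 rho (fun t => h t + h' t).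
Proof.
move=> H H' t tr; have -> : pseries (fun i => c i + c' i) (t - t0) =
    (fun n => pseries c (t - t0) n + pseries c' (t - t0) n).
  apply/funext => n; rewrite /pseries /series/= -big_split/=.
  by apply: eq_bigr => i _; rewrite mulrDl.
by apply: cvgD; [exact: H|exact: H'].
Qed.

Lemma psum_at_scale c t0 rho h k : psum_at c t0 rho h ->
  psum_at (fun i => k * c i) t0 rho (fun t => k * h t).
Proof.
move=> H t tr; have -> : pseries (fun i => k * c i) (t - t0) =
    (fun n => k * pseries c (t - t0) n).
  apply/funext => n; rewrite /pseries /series/= mulr_sumr.
  by apply: eq_bigr => i _; rewrite mulrA.
by apply: cvgM; [exact: cvg_cst|exact: H].
Qed.

Definition coef_shift c i := if i is j.+1 then c j else 0.

Lemma psum_at_shift c t0 rho h : psum_at c t0 rho h ->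
  psum_at (coef_shift c) t0 rho (fun t => (t - t0) * h t).
Proof.
move=> H t tr; rewrite -cvg_shiftS/=.
have -> : (fun n => pseries (coef_shift c) (t - t0) n.+1) =
    (fun n => (t - t0) * pseries c (t - t0) n).
  apply/funext => n; rewrite /pseries seriesS /= mul0r add0r /series/= mulr_sumr.
  by apply: eq_bigr => i _; rewrite exprS mulrCA.
by apply: cvgM; [exact: cvg_cst|exact: H].
Qed.

(** Multiplication by t, written as t0 + (t - t0), on coefficients centered at t0. *)
Definition coef_mulX t0 c i := t0 * c i + coef_shift c i.

Lemma psum_at_mulX c t0 rho h : psum_at c t0 rho h ->
  psum_at (coef_mulX t0 c) t0 rho (fun t => t * h t).
Proof.
move=> H; have := psum_at_add _ _ _ _ _ _ (psum_at_scale _ _ _ _ t0 H)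
  (psum_at_shift _ _ _ _ H).
by move=> + t tr => /(_ t tr); rewrite -mulrDl (addrC t0) subrK.
Qed.

Lemma psum_at_cst t0 rho k :
  psum_at (fun i => if i is 0%N then k else 0) t0 rho (fun=> k).
Proof.
move=> t _; rewrite -cvg_shiftS/=.
have -> : (fun n => pseries (fun i => if i is 0%N then k else 0) (t - t0) n.+1) =
    (fun=> k); last exact: cvg_cst.
apply/funext => n; rewrite /pseries seriesS /= mulr1 /series/= big1 ?addr0// => i _.
by rewrite mul0r.
Qed.

Lemma psum_at_derive c t0 rho h : psum_at c t0 rho h ->
  (forall t, `|t - t0| < rho -> is_derive t 1 h (derive1 h t)) /\
  psum_at (pseries_diffs c) t0 rho (derive1 h).
Proof.
move=> H.
have cc x : `|x| < rho -> cvgn (pseries c x).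
  move=> xr; apply/cvg_ex; exists (h (x + t0)).
  by have := H (x + t0); rewrite addrK; exact.
have cc1 := cvg_pseries_diffs _ _ cc; have cc2 := cvg_pseries_diffs _ _ cc1.
have der t : `|t - t0| < rho ->
    is_derive t 1 h (limn (pseries (pseries_diffs c) (t - t0))).
  move=> tr; pose K := (`|t - t0| + rho) / 2.
  have k0 : 0 <= `|t - t0| by exact: normr_ge0.
  have K0 : 0 <= K by rewrite /K; lra.
  have Kr : `|K| < rho by rewrite ger0_norm// /K; lra.
  have tK : `|t - t0| < `|K| by rewrite (ger0_norm K0) /K; lra.
  have h1 := pseries_snd_diffs (cc _ Kr) (cc1 _ Kr) (cc2 _ Kr) tK.
  have h2 : is_derive t 1 (fun x => x - t0) (1 - 0 : R).
    by apply: is_deriveB.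
  have := @is_derive1_comp _ (fun x => limn (pseries c x)) (fun x => x - t0) t _ _ h1 h2.
  rewrite subr0 mulr1.
  apply: near_eq_is_derive; near=> x; apply/cvg_lim => //; apply: H.
  near: x; have : \forall x \near t, `|x - t0| < rho; last exact.
  have cf : (fun x : R => `|x - t0|) x @[x --> t] --> `|t - t0|.
    by apply: cvg_norm; apply: cvgB; [exact: cvg_id|exact: cvg_cst].
  exact: (cvgr_lt _ cf).
split=> [t tr|t tr].
  by have := der t tr => dt; rewrite derive1E derive_val.
have dt := der t tr; rewrite derive1E derive_val.
by apply: cvgP; exact: cc1.
Unshelve. all: by end_near. Qed.

End real_analytic.

Section identity.
Context {R : realType}.
Implicit Types (c : nat -> R) (h : R -> R).

Lemma psum_at_center c t0 rho h : 0 < rho -> psum_at c t0 rho h -> h t0 = c 0%N.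
Proof.
move=> rho0 H; have := H t0; rewrite subrr normr0 => /(_ rho0) h1.
suff h2 : pseries c 0 @ \oo --> c 0%N by exact: (cvg_unique (@norm_hausdorff _ _) h1 h2).
rewrite -cvg_shiftS/=.
have -> : (fun n => pseries c 0 n.+1) = (fun=> c 0%N); last exact: cvg_cst.
apply/funext => n; rewrite /pseries seriesS /= mulr1 /series/= big1 ?addr0// => i _.
by rewrite expr0n/= mulr0.
Qed.

(* The coefficients are the derivatives at the center, which vanish by continuity
   on the left. *)
Lemma psum_at_left0 m : forall c t0 rho d h, 0 < rho -> 0 < d ->
  psum_at c t0 rho h -> (forall t, t0 - d < t < t0 -> h t = 0) -> c m = 0.
Proof.
elim: m => [|m IH] c t0 rho d h rho0 d0 H h0.
  rewrite -(psum_at_center _ _ _ _ rho0 H).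
  have [der _] := psum_at_derive _ _ _ _ H.
  have := der t0; rewrite subrr normr0 => /(_ rho0) dt.
  have ct : {for t0, continuous h}.
    by apply: differentiable_continuous; apply/derivable1_diffP; exact: ex_derive.
  have cl : h x @[x --> t0^'-] --> h t0 by exact: cvg_at_left_filter.
  suff c0 : h x @[x --> t0^'-] --> (0 : R).
    exact: (cvg_unique (@norm_hausdorff _ _) cl c0).
  have : (fun=> 0 : R) x @[x --> t0^'-] --> (0 : R) by exact: cvg_cst.
  apply: cvg_trans; apply: near_eq_cvg; near=> x.
  apply/esym; apply: h0; apply/andP; split; near: x.
    by apply: nbhs_left_gt; rewrite gtrBl.
  exact: nbhs_left_lt.
have [_ H'] := psum_at_derive _ _ _ _ H.
have : pseries_diffs c m = 0.
  apply: (IH _ _ _ d _ rho0 d0 H') => t ht.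
  rewrite derive1E -(@derive_cst _ _ _ 0 t (1 : R)).
  apply: near_eq_derive; near=> x; apply: h0; near: x.
  by apply: near_in_itvoo; rewrite in_itv.
by move/eqP; rewrite /pseries_diffs mulf_eq0 pnatr_eq0/= => /eqP.
Unshelve. all: by end_near. Qed.

Lemma psum_at0 c t0 rho h : (forall m, c m = 0) -> psum_at c t0 rho h ->
  forall t, `|t - t0| < rho -> h t = 0.
Proof.
move=> c0 H t tr; suff h2 : pseries c (t - t0) @ \oo --> (0 : R).
  exact: (cvg_unique (@norm_hausdorff _ _) (H _ tr) h2).
have -> : pseries c (t - t0) = (fun=> 0); last exact: cvg_cst.
by apply/funext => n; rewrite /pseries /series/= big1// => i _; rewrite c0 mul0r.
Qed.

(** Let T be the supremum of the t such that h vanishes on [0, t]. Vanishing to the left of T kills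
    all coefficients of the expansion at T, so h vanishes beyond T as well, a contradiction. *)
Lemma analytic_zero h d : 0 < d ->
  (forall t, 0 <= t -> exists c rho, 0 < rho /\ psum_at c t rho h) ->
  (forall t, 0 <= t < d -> h t = 0) -> forall t, 0 <= t -> h t = 0.
Proof.
move=> d0 ha h0 t1 t10; apply/eqP; apply: contrapT => ht1.
pose S := [set t | 0 <= t /\ forall s, 0 <= s <= t -> h s = 0].
have Sub : ubound S t1.
  move=> t [t0 ht]; rewrite leNgt; apply/negP => t1t.
  by apply: ht1; rewrite ht// t10 ltW.
have Sd : S (d / 2).
  split; first by rewrite divr_ge0// ltW.
  by move=> s /andP[s0 sd]; apply: h0; rewrite s0 (le_lt_trans sd)//; lra.
have hS : has_sup S by split; [exists (d / 2)|exists t1].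
pose T := sup S.
have T0 : 0 < T by apply: lt_le_trans (ub_le_sup (proj2 hS) Sd); rewrite divr_gt0.
have below s : 0 <= s -> s < T -> h s = 0.
  move=> s0 sT; have [t [t0 ht] st] : exists2 t, S t & s < t.
    by have [t St st] := sup_gt (proj1 hS) sT; exists t.
  by apply: ht; rewrite s0 ltW.
have [c [rho [rho0 H]]] := ha T (ltW T0).
have c0 m : c m = 0.
  apply: (psum_at_left0 m _ _ _ T _ rho0 T0 H) => t.
  by rewrite subrr => /andP[t0 tT]; apply: below => //; exact: ltW.
have h0' := psum_at0 _ _ _ _ c0 H.
have : S (T + rho / 2).
  split; first by lra.
  move=> s /andP[s0 sT]; have [?|Ts] := ltP s T; first exact: below.
  by apply: h0'; rewrite ger0_norm ?subr_ge0//; lra.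
by move/(ub_le_sup (proj2 hS)); rewrite -/T; lra.
Qed.

End identity.

Section complex_series.
Context {R : realType}.

Lemma Im_le_norm (u v : R[i]) (e : R) : `|u - v| < e%:C ->
  `|complex.Im u - complex.Im v| < e.
Proof.
rewrite normc_def ltcR => h; apply: le_lt_trans h.
rewrite -ImN -ImD -sqrtr_sqr ler_sqrt ?lerDr ?sqr_ge0//.
by rewrite addr_ge0 ?sqr_ge0.
Qed.

Lemma cvg_Im (u : nat -> R[i]) (l : R[i]) : u @ \oo --> (l : R[i]^o) ->
  (fun n => complex.Im (u n)) @ \oo --> complex.Im l.
Proof.
move=> hu; have h := (@cvgrPdist_lt _ (R[i]^o) _ _ _ _ _).1 hu.
apply/cvgrPdist_lt => e e0.
have oF : Filter (\oo : set_system nat) by exact _.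
have := h oF e%:C; rewrite ltcR => /(_ e0); apply: filterS => n.
exact: Im_le_norm.
Qed.

Lemma Im_series (u : nat -> R[i]) n :
  complex.Im (series u n) = series (fun i => complex.Im (u i)) n.
Proof.
rewrite /series/=; elim/big_ind2 : _ => // x x' y y' <- <-.
by rewrite -ImD.
Qed.

Lemma ImMR (a : R[i]) (x : R) : complex.Im (a * x%:C) = complex.Im a * x.
Proof. by rewrite ImM/= mulr0 add0r mulrC. Qed.

Lemma modulusM (u v : R[i]) : modulus (u * v) = modulus u * modulus v.
Proof. exact: Normc.normcM. Qed.

Lemma modulusR (x : R) : modulus x%:C = `|x|.
Proof. by rewrite /modulus /= expr0n/= addr0 sqrtr_sqr. Qed.

(** For real t the m-th term is c m * z^m times the real (t - t0)^m, so imaginary parts give a real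
    power series. *)
Lemma analytic_ray (f : R[i] -> R[i]) (z : R[i]) (t0 : R) : 0 < modulus z ->
  analytic_at f (t0%:C * z) -> exists c rho, 0 < rho /\
  psum_at c t0 rho (fun t => complex.Im (f (t%:C * z))).
Proof.
move=> z0 [c [rho [rho0 H]]].
exists (fun m => complex.Im (c m * z ^+ m)), (rho / modulus z).
split; first by rewrite divr_gt0.
move=> t; rewrite ltr_pdivlMr// => tr.
have e : t%:C * z - t0%:C * z = (t - t0)%:C * z by rewrite rmorphB mulrBl.
have := H (t%:C * z); rewrite e modulusM modulusR => /(_ tr) /cvg_Im.
apply: cvg_trans; apply: near_eq_cvg; near=> n.
rewrite Im_series; congr series; apply/funext => i.
by rewrite exprMn -rmorphXn/= mulrCA mulrC ImMR.
Unshelve. all: by end_near. Qed.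

End complex_series.

Section constancy.
Context {R : realType}.

Lemma derive0_eq (f : R -> R) (a b : R) : a <= b ->
  (forall x, a <= x <= b -> {for x, continuous f}) ->
  (forall x, a < x < b -> is_derive x 1 f 0) -> f a = f b.
Proof.
rewrite le_eqVlt => /predU1P[->//|ab] cf df.
have df' x : x \in `]a, b[%R -> is_derive x 1 f ((fun=> 0) x).
  by rewrite in_itv/=; exact: df.
have cf' : {within `[a, b], continuous f}.
  by apply: continuous_in_subspaceT => x /set_mem/=; rewrite in_itv/=; exact: cf.
have [c _] := MVT ab df' cf'.
by rewrite mul0r => /eqP; rewrite subr_eq0 => /eqP ->.
Qed.

Lemma is_derive_continuous (f : R -> R) (x d : R) : is_derive x 1 f d ->
  {for x, continuous f}.
Proof.
move=> df; apply: differentiable_continuous; apply/derivable1_diffP.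
exact: ex_derive.
Qed.

End constancy.

(** * The differential equation of the dilogarithm along a ray *)

Section ray.
Context {R : realType}.
Variables (Li2 : R[i] -> R[i]) (z : R[i]).
Hypotheses (HLi2 : is_dilogarithm Li2) (y0 : complex.Im z != 0).
Local Notation x := (complex.Re z).
Local Notation y := (complex.Im z).

Definition sqm : R := x ^+ 2 + y ^+ 2.
(** This is |1 - t z|^2, expanded as a polynomial in t. *)
Definition ray_q (t : R) := 1 - 2 * x * t + sqm * t ^+ 2.
Definition ray_Li2 (t : R) := complex.Im (Li2 (t%:C * z)).
(* A smooth form of - arg(1 - tz). *)
Definition ray_arg (t : R) := atan ((t * sqm - x) / y) + atan (x / y).

Lemma sqm_gt0 : 0 < sqm.
Proof. by rewrite ltr_wpDl ?sqr_ge0// exprn_even_gt0. Qed.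

Lemma modulus_gt0 : 0 < modulus z.
Proof.
rewrite /modulus; case: z y0 => a b /= b0.
by rewrite sqrtr_gt0 ltr_wpDl ?sqr_ge0// exprn_even_gt0.
Qed.

Lemma ray_qE t : ray_q t = (1 - t * x) ^+ 2 + (t * y) ^+ 2.
Proof. by rewrite /ray_q /sqm; ring. Qed.

Lemma ray_q_gt0 t : 0 < ray_q t.
Proof.
rewrite ray_qE; have [->|t0] := eqVneq t 0.
  by rewrite !mul0r subr0 expr1n expr0n/= addr0.
by rewrite ltr_wpDl ?sqr_ge0// exprn_even_gt0//= mulf_neq0.
Qed.

Lemma ray_arg0 : ray_arg 0 = 0.
Proof. by rewrite /ray_arg mul0r sub0r mulNr atanN addNr. Qed.

Lemma is_derive_ray_arg (t : R) : is_derive t 1 ray_arg (y / ray_q t).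
Proof.
pose u (s : R) := (s * sqm - x) / y.
have du : is_derive t 1 u (sqm / y).
  apply: is_derive_eq; rewrite !(scaler0, subr0, addr0, oppr0, mulr0, add0r, scale0r).
  by rewrite /GRing.scale/=; ring.
have da := @is_derive1_comp _ atan u t _ _ (is_derive1_atan (u t)) du.
have : is_derive t 1 (fun s => (atan \o u) s + atan (x / y))
    ((1 + u t ^+ 2)^-1 * (sqm / y) + 0).
  by apply: is_deriveD.
rewrite addr0 => h; apply: (@is_derive_eq _ _ _ _ _ _ _ _ h).
have q0 := ray_q_gt0 t; have s0 := sqm_gt0.
rewrite /u; have e : (1 + ((t * sqm - x) / y) ^+ 2) = sqm * ray_q t / y ^+ 2.
  by rewrite /ray_q /sqm; field.
by rewrite e; field; rewrite y0 !gt_eqF.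
Qed.

(** As Im z != 0, the line through 0 and z meets the real axis only at 0, so it avoids the slit. *)
Lemma ray_Li2_analytic t : exists c rho, 0 < rho /\ psum_at c t rho ray_Li2.
Proof.
apply: analytic_ray; first exact: modulus_gt0.
apply: (proj2 HLi2) => -[]; rewrite ImM ReM /= mul0r addr0 => /eqP.
rewrite mulf_eq0 (negbTE y0) orbF => /eqP ->.
by rewrite !mul0r subrr ler10.
Qed.

Definition ray_coef (m : nat) : R :=
  if m is 0 then 0 else complex.Im (z ^+ m) / m%:R ^+ 2.

Lemma ray_Li2_series : psum_at ray_coef 0 (modulus z)^-1 ray_Li2.
Proof.
move=> t; rewrite subr0 => tz.
have m0 := modulus_gt0.
have tz1 : modulus (t%:C * z) <= 1.
  by rewrite modulusM modulusR; apply: ltW; rewrite -ltr_pdivlMr// div1r.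
have := cvg_Im _ _ (proj1 HLi2 _ tz1).
suff : forall l : R,
    (fun n => complex.Im (series (fun m => (t%:C * z) ^+ m.+1 / m.+1%:R ^+ 2) n))
      @ \oo --> l ->
    (fun n => pseries ray_coef t n.+1) @ \oo --> l.
  by move=> h /h; rewrite cvg_shiftS.
move=> l.
apply: cvg_trans; apply: near_eq_cvg; near=> n.
rewrite Im_series /pseries seriesS /= mul0r add0r; congr series; apply/funext => i.
have -> : i.+1%:R ^+ 2 = (i.+1%:R ^+ 2 : R)%:C by rewrite rmorphXn/= rmorph_nat.
rewrite -fmorphV exprMn -rmorphXn/= [_%:C * _]mulrC ImMR ImMR mulrAC.
by [].
Unshelve. all: by end_near. Qed.

Definition ray_ode (t : R) :=
  ray_q t * derive1 (fun s => s * derive1 ray_Li2 s) t - y.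

(** The coefficients at t0 of [ray_ode], given those of [ray_Li2]: p is the expansion of (t (Im
    Li2(tz))')'. *)
Definition ode_coef t0 (c : nat -> R) (k : nat) : R :=
  let p := pseries_diffs (coef_mulX t0 (pseries_diffs c)) in
  let tp := coef_mulX t0 p in
  p k + - (2 * x) * tp k + sqm * coef_mulX t0 tp k +
  (if k is 0 then - y else 0).

Lemma psum_at_ode c t0 rho : psum_at c t0 rho ray_Li2 ->
  psum_at (ode_coef t0 c) t0 rho ray_ode.
Proof.
move=> H; have [_ H1] := psum_at_derive _ _ _ _ H.
have [_ H2] := psum_at_derive _ _ _ _ (psum_at_mulX _ _ _ _ H1).
have H3 := psum_at_mulX _ _ _ _ H2; have H4 := psum_at_mulX _ _ _ _ H3.
have := psum_at_add _ _ _ _ _ _ (psum_at_add _ _ _ _ _ _ (psum_at_add _ _ _ _ _ _ H2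
  (psum_at_scale _ _ _ _ (- (2 * x)) H3)) (psum_at_scale _ _ _ _ sqm H4))
  (psum_at_cst t0 rho (- y)).
by move=> + t tr => /(_ t tr); congr (_ --> _); rewrite /ray_ode /ray_q; ring.
Qed.

(** At t0 = 0 the m-th coefficient of (t (Im Li2(tz))')' is Im z^(m+1), and z^2 = 2 x z - |z|^2 is
    exactly the recurrence encoded by [ray_q]. The constant - y cancels the term of degree 0. *)
Lemma ode_coef0 k : ode_coef 0 ray_coef k = 0.
Proof.
have sE m : pseries_diffs (coef_mulX 0 (pseries_diffs ray_coef)) m =
    complex.Im (z ^+ m.+1).
  rewrite /pseries_diffs /coef_mulX /= mul0r add0r.
  have : m.+1%:R != 0 :> R by rewrite pnatr_eq0.
  by move: (m.+1%:R : R) => d d0; field.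
have zz : z ^+ 2 = (2 * x)%:C * z - sqm%:C.
  apply: complex_eq; rewrite expr2 ?(ReD,ImD,ReM,ImM,ReN,ImN)/= /sqm/=; ring.
rewrite /ode_coef; case: k => [|k].
  by rewrite /coef_mulX /= sE expr1; ring.
rewrite /coef_mulX /=; case: k => [|k] /=; rewrite !sE.
  by rewrite zz ?(ReD,ImD,ReM,ImM,ReN,ImN)/= expr1; ring.
rewrite (_ : z ^+ k.+3 = (2 * x)%:C * z ^+ k.+2 - sqm%:C * z ^+ k.+1); last first.
  by rewrite (exprD _ 2 k.+1) zz [z ^+ k.+2]exprS; ring.
by rewrite ?(ReD,ImD,ReM,ImM,ReN,ImN)/=; ring.
Qed.

Lemma ray_ode0 t : 0 <= t -> ray_ode t = 0.
Proof.
apply: (analytic_zero _ (modulus z)^-1).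
- by rewrite invr_gt0 modulus_gt0.
- move=> s _; have [c [rho [rho0 H]]] := ray_Li2_analytic s.
  by exists (ode_coef s c), rho; split => //; exact: psum_at_ode.
- move=> s /andP[s0 sz].
  apply: (psum_at0 _ _ _ _ ode_coef0 (psum_at_ode _ _ _ ray_Li2_series)).
  by rewrite subr0 ger0_norm.
Qed.

Lemma is_derive_ray_Li2 (t : R) : is_derive t 1 ray_Li2 (derive1 ray_Li2 t).
Proof.
have [c [rho [rho0 H]]] := ray_Li2_analytic t.
by apply: (proj1 (psum_at_derive _ _ _ _ H)); rewrite subrr normr0.
Qed.

(** Both sides vanish at 0, and by the differential equation both have derivative y / [ray_q]. *)
Lemma ray_Li2_derive t : 0 <= t -> t * derive1 ray_Li2 t = ray_arg t.
Proof.
move=> t0; pose T (s : R) := s * derive1 ray_Li2 s.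
have dT (s : R) : is_derive s 1 T (derive1 T s).
  have [c [rho [rho0 H]]] := ray_Li2_analytic s.
  have [_ H1] := psum_at_derive _ _ _ _ H.
  have [+ _] := psum_at_derive _ _ _ _ (psum_at_mulX _ _ _ _ H1).
  by apply; rewrite subrr normr0.
have dTE s : 0 <= s -> derive1 T s = y / ray_q s.
  move=> s0; have q0 := ray_q_gt0 s.
  have /eqP := ray_ode0 s s0; rewrite subr_eq0 => /eqP <-.
  by rewrite mulrAC divff ?mul1r// gt_eqF.
have dL (s : R) : is_derive s 1 (fun s => T s - ray_arg s) (derive1 T s - y / ray_q s).
  by apply: is_deriveB; exact: is_derive_ray_arg.
have : T 0 - ray_arg 0 = T t - ray_arg t.
  apply: (derive0_eq (fun s => T s - ray_arg s)) => // s /andP[s0 st].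
    exact: is_derive_continuous (dL s).
  by have := dL s; rewrite dTE ?subrr// ltW.
by rewrite ray_arg0 /T mul0r subrr => /esym/eqP; rewrite subr_eq0 => /eqP.
Qed.

End ray.

(** * Primitives *)

Section improper.
Context {R : realType}.
Local Notation mu := (@lebesgue_measure R).

Lemma integral_itvcc_derive (F f : R -> R) (a b : R) : a < b ->
  (forall u : R, a <= u <= b -> is_derive u 1 F (f u)) ->
  (forall u : R, a <= u <= b -> {for u, continuous f}) ->
  (\int[mu]_(u in `[a, b]) (f u)%:E = (F b - F a)%:E)%E.
Proof.
move=> ab dF cf.
have cF u : a <= u <= b -> {for u, continuous F}.
  by move=> uab; exact: is_derive_continuous (dF _ uab).
rewrite (@continuous_FTC2 _ f F a b ab) ?EFinB//.
- by apply: continuous_in_subspaceT => u /set_mem/=; rewrite in_itv/=; exact: cf.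
- split.
  + move=> u; rewrite in_itv/= => /andP[au ub].
    have := dF u; rewrite !ltW// => /(_ isT) h; exact: ex_derive.
  + by apply: cvg_at_right_filter; apply: cF; rewrite lexx ltW.
  + by apply: cvg_at_left_filter; apply: cF; rewrite lexx ltW.
move=> u; rewrite in_itv/= => /andP[au ub].
have := dF u; rewrite !ltW// => /(_ isT) h.
by rewrite derive1E derive_val.
Qed.

(** The integrands have logarithmic singularities at 0 and 1, while their primitives are continuous
    there. The fundamental theorem is applied on inner intervals and passed to the limit by monotone
    convergence, which is where nonnegativity enters. *)
Lemma ge0_integral_oo (F f : R -> R) :
  (forall u : R, 0 < u < 1 -> is_derive u 1 F (f u)) ->
  (forall u : R, 0 < u < 1 -> 0 <= f u) ->
  (forall u : R, 0 < u < 1 -> {for u, continuous f}) ->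
  (forall u : R, 0 <= u <= 1 -> {for u, continuous F}) ->
  (\int[mu]_(u in `]0%R, 1%R[) (f u)%:E = (F 1 - F 0)%:E)%E.
Proof.
move=> dF f0 cf cF.
(* The factor 3 ensures a n < 1 - a n already for n = 0. *)
pose a (n : nat) : R := (3 * n.+1%:R)^-1.
have a0 n : 0 < a n by rewrite invr_gt0 mulr_gt0.
have a3 n : a n <= 1 / 3.
  rewrite /a div1r lef_pV2 ?posrE ?mulr_gt0// ler_peMr//.
  by rewrite ler1n.
have ale n m : (n <= m)%N -> a m <= a n.
  by move=> nm; rewrite /a lef_pV2 ?posrE ?mulr_gt0// ler_pM2l// ler_nat.
have acvg : a @ \oo --> (0 : R).
  have h := @cvg_harmonic R.
  have : (fun n => 3^-1 * @harmonic R n) @ \oo --> 3^-1 * (0 : R).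
    by apply: cvgM; [exact: cvg_cst|exact: h].
  rewrite mulr0; apply: cvg_trans; apply: near_eq_cvg; near=> n.
  by rewrite /a /harmonic/= invfM.
pose A n := `[a n, 1 - a n]%classic.
have Ain n u : A n u -> 0 < u < 1.
  rewrite /A/= in_itv/= => /andP[h1 h2]; have := a0 n => h3.
  by apply/andP; split; lra.
have AU : \bigcup_n A n = `]0, 1[%classic.
  apply/seteqP; split=> u; first by move=> [n _ /Ain]; rewrite /= in_itv.
  rewrite /= in_itv/= => /andP[u0 u1].
  have mu0 : 0 < Num.min u (1 - u) by rewrite lt_min u0 subr_gt0.
  have [n _ hn] := cvgr_lt _ acvg _ mu0.
  exists n => //; have := hn n (leqnn n); rewrite lt_min => /andP[h1 h2].
  by rewrite /A/= in_itv/=; apply/andP; split; lra.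
rewrite -AU.
have ic n : (\int[mu]_(u in A n) (f u)%:E = (F (1 - a n) - F (a n))%:E)%E.
  apply: integral_itvcc_derive.
  - by have := a3 n; lra.
  - by move=> u uA; apply: dF; apply: (Ain n); rewrite /A/= in_itv.
  - by move=> u uA; apply: cf; apply: (Ain n); rewrite /A/= in_itv.
have h1 : (fun n => \int[mu]_(u in A n) (f u)%:E)%E @ \oo -->
    (\int[mu]_(u in \bigcup_n A n) (f u)%:E)%E.
  apply: ge0_nondecreasing_set_cvg_integral.
  - move=> n m nm; apply/subsetPset => u; rewrite /A/= !in_itv/= => /andP[h1 h2].
    by have := ale _ _ nm => h; apply/andP; split; lra.
  - by move=> n; exact: measurable_itv.
  - move=> n; apply/measurable_EFinP.
    apply: subspace_continuous_measurable_fun; first exact: measurable_itv.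
    by apply: continuous_in_subspaceT => u /set_mem uA; apply: cf; exact: Ain uA.
  - by move=> n u /Ain u01; rewrite lee_fin f0.
have h2 : (fun n => (F (1 - a n) - F (a n))%:E) @ \oo --> (F 1 - F 0)%:E.
  apply: cvg_EFin; first by near=> n.
  have c1 : (fun n => 1 - a n) @ \oo --> (1 : R).
    have := @cvgB _ _ _ _ _ _ _ _ _ (cvg_cst (1 : R)) acvg.
    by rewrite subr0; exact.
  have cF1 : {for 1, continuous F} by apply: cF; rewrite ler01 lexx.
  have cF0 : {for 0, continuous F} by apply: cF; rewrite ler01 lexx.
  apply: cvgB; [exact: (cvg_comp _ _ c1 cF1)|exact: (cvg_comp _ _ acvg cF0)].
have e : (fun n => \int[mu]_(u in A n) (f u)%:E)%E = (fun n => (F (1 - a n) - F (a n))%:E).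
  by apply/funext => n; exact: ic.
rewrite e in h1; exact: (cvg_unique (@ereal_hausdorff _) h1 h2).
Unshelve. all: by end_near. Qed.

(* When a denominator is 0, so is the numerator, and the formula holds with the
   convention x / 0 = 0. *)
Lemma integral_rational (r p0 p1 k0 k1 : R) : 1 < r -> 0 < k0 -> 0 < k1 ->
  (k1 = k0 -> p1 = p0) -> (k1 = r ^+ 2 * k0 -> p1 = r ^+ 2 * p0) ->
  (\int[mu]_(t in `]1%R, r[)
    (let s := (t ^+ 2 - 1) / (r ^+ 2 - 1) in
     ((1 - s) * p0 + s * p1) / (2 * t * ((1 - s) * k0 + s * k1)))%:E =
  ((1 / 4) * ((p1 - p0) / (k1 - k0) * (ln k1 - ln k0) +
    (r ^+ 2 * p0 - p1) / (k1 - r ^+ 2 * k0) * (ln k1 - ln (r ^+ 2) - ln k0)))%:E)%E.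
Proof.
move=> r1 k00 k10 H1 H2.
have r2 : 1 < r ^+ 2 by rewrite exprn_egt1.
pose d := r ^+ 2 - 1; have d0 : 0 < d by rewrite subr_gt0.
pose Q (t : R) := k0 + (t ^+ 2 - 1) / d * (k1 - k0).
have QE t : (1 - (t ^+ 2 - 1) / d) * k0 + (t ^+ 2 - 1) / d * k1 = Q t.
  by rewrite /Q; ring.
have Q0 t : 1 <= t <= r -> 0 < Q t.
  move=> /andP[t1 tr]; rewrite -QE; set s := _ / d.
  have t2 : 1 <= t ^+ 2 by rewrite exprn_ege1.
  have t2r : t ^+ 2 <= r ^+ 2 by rewrite lerXn2r// nnegrE; lra.
  have s0 : 0 <= s by rewrite divr_ge0 ?subr_ge0// ltW.
  have s1 : s <= 1 by rewrite ler_pdivrMr// mul1r lerD2r.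
  have [->|s0'] := eqVneq s 0; first by rewrite subr0 mul1r mul0r addr0.
  have {}s0 : 0 < s by rewrite lt_neqAle eq_sym s0'.
  by apply: ltr_wpDl; [apply: mulr_ge0; [rewrite subr_ge0|exact: ltW]|exact: mulr_gt0].
pose e := (p1 - p0) / (k1 - k0); pose c := (r ^+ 2 * p0 - p1) / (k1 - r ^+ 2 * k0).
have eE : e * (k1 - k0) = p1 - p0.
  rewrite /e; have [h|h] := eqVneq (k1 - k0) 0; last by rewrite divfK.
  by rewrite h mulr0 H1 ?subrr//; move/eqP: h; rewrite subr_eq0 => /eqP.
have cE : c * (k1 - r ^+ 2 * k0) = r ^+ 2 * p0 - p1.
  rewrite /c; have [h|h] := eqVneq (k1 - r ^+ 2 * k0) 0; last by rewrite divfK.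
  by rewrite h mulr0 H2 ?subrr//; move/eqP: h; rewrite subr_eq0 => /eqP.
pose f (t : R) := ((1 - (t ^+ 2 - 1) / d) * p0 + (t ^+ 2 - 1) / d * p1) /
  (2 * t * ((1 - (t ^+ 2 - 1) / d) * k0 + (t ^+ 2 - 1) / d * k1)).
(* Partial fractions in t^2: d times the numerator is (p1 - p0) t^2 + (r^2 p0 - p1), and its two
   terms integrate to multiples of ln Q and of ln Q - 2 ln t. *)
pose Phi (t : R) := (1 / 4) * (e * ln (Q t) + c * (ln (Q t) - 2 * ln t)).
have dQ (t : R) : is_derive t 1 Q (2 * t / d * (k1 - k0)).
  by apply: is_derive_eq; rewrite /GRing.scale/=; ring.
have df (t : R) : 0 < t -> 0 < Q t -> is_derive t 1 f (derive1 f t).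
  move=> t0 Qt; rewrite derive1E; apply/derivableP.
  apply: derivableM; first by apply: ex_derive.
  by apply: derivableV; rewrite ?QE; [rewrite gt_eqF// !mulr_gt0|exact: ex_derive].
have dPhi (t : R) : 1 <= t <= r -> is_derive t 1 Phi (f t).
  move=> t1r; have Qt := Q0 _ t1r.
  have t0 : 0 < t by case/andP: t1r => t1 _; exact: lt_le_trans t1.
  have dlQ := @is_derive1_comp _ (@ln R) Q t _ _ (is_derive1_ln Qt) (dQ t).
  have dl := is_derive1_ln t0.
  have h : is_derive t 1 Phi ((1 / 4) *: (e *: ((Q t)^-1 * (2 * t / d * (k1 - k0))) +
    c *: ((Q t)^-1 * (2 * t / d * (k1 - k0)) - 2 *: t^-1))).
    by apply: is_deriveZ; apply: is_deriveD; apply: is_deriveZ => //;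
      apply: is_deriveB; apply: is_deriveZ.
  apply: (@is_derive_eq _ _ _ _ _ _ _ _ h); rewrite /GRing.scale/= /f QE.
  have -> : 1 / 4 * (e * ((Q t)^-1 * (2 * t / d * (k1 - k0))) +
      c * ((Q t)^-1 * (2 * t / d * (k1 - k0)) - 2 * t^-1)) =
    (e * (k1 - k0) * t ^+ 2 + c * ((k1 - k0) * t ^+ 2 - d * Q t)) / (2 * d * t * Q t).
    by field; rewrite !gt_eqF.
  have -> : (k1 - k0) * t ^+ 2 - d * Q t = k1 - r ^+ 2 * k0.
    by rewrite /Q /d; field; rewrite gt_eqF.
  by rewrite eE cE /d; field; rewrite !gt_eqF.
transitivity (\int[mu]_(t in `[1%R, r]) (f t)%:E)%E.
  rewrite -(integral_itv_bndoo true false)//.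
  apply/measurable_EFinP; apply: subspace_continuous_measurable_fun => //.
  apply: continuous_in_subspaceT => t /set_mem/=; rewrite in_itv/= => t1r.
  have /andP[t1 tr] : 1 <= t <= r by case/andP: t1r => *; rewrite !ltW.
  by apply: is_derive_continuous (df t _ _); [lra|apply: Q0; rewrite t1].
rewrite (integral_itvcc_derive Phi) //; last first.
  move=> t t1r; apply: is_derive_continuous (df t _ (Q0 _ t1r)).
  by case/andP: t1r => t1 _; lra.
have Qr : Q r = k1 by rewrite /Q /d; field; rewrite gt_eqF.
have Q1 : Q 1 = k0 by rewrite /Q expr1n subrr !mul0r addr0.
congr EFin; rewrite /Phi Qr Q1 ln1 (expr2 r) lnM ?posrE; try lra.
by rewrite /e /c expr2; ring.
Qed.

End improper.

(** * The Bloch-Wigner function along a ray *)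

Section ray_dilogarithm.
Context {R : realType}.
Variables (Li2 : R[i] -> R[i]) (z : R[i]).
Hypotheses (HLi2 : is_dilogarithm Li2) (y0 : complex.Im z != 0).
Local Notation x := (complex.Re z).
Local Notation y := (complex.Im z).
Local Notation N := (sqm z).
Local Notation q := (ray_q z).

Lemma cos_ray_arg1 : cos (ray_arg z 1) = (1 - x) / Num.sqrt (q 1).
Proof.
have N0 := sqm_gt0 z y0; have q0 := ray_q_gt0 z y0 1.
rewrite /ray_arg mul1r cosD; set v := (N - x) / y; set w := x / y.
have sa (s : R) : sin (atan s) = s * cos (atan s).
  have := atanK s; rewrite /tan => /(congr1 (fun a => a * cos (atan s))).
  by rewrite divfK// cos_atan invr_eq0 sqrtr_eq0 -ltNge ltr_pwDl// sqr_ge0.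
have -> : cos (atan v) * cos (atan w) - sin (atan v) * sin (atan w) =
    (1 - v * w) * (cos (atan v) * cos (atan w)) by rewrite !sa; ring.
rewrite !cos_atan -invfM -sqrtrM ?addr_ge0 ?sqr_ge0//.
have -> : (1 + v ^+ 2) * (1 + w ^+ 2) = (N / y ^+ 2) ^+ 2 * q 1.
  by rewrite /v /w /ray_q /sqm; field.
rewrite sqrtrM ?sqr_ge0// sqrtr_sqr ger0_norm; last first.
  by rewrite divr_ge0 ?sqr_ge0// ltW.
have -> : 1 - v * w = (N / y ^+ 2) * (1 - x) by rewrite /v /w /sqm; field.
have s0 : 0 < Num.sqrt (q 1) by rewrite sqrtr_gt0.
by field; rewrite y0 !gt_eqF.
Qed.

Lemma modulus_sub1 : modulus (1 - z) = Num.sqrt (q 1).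
Proof.
rewrite /modulus ray_qE; case: z => a b /=; congr Num.sqrt.
by rewrite !mul1r sub0r sqrrN.
Qed.

(** [ray_arg z 1] has the sign of Im z, absolute value less than pi and the cosine of arg(1 - z),
    whose sign is opposite. These properties determine the principal argument. *)
Lemma carg_sub1 : carg (1 - z) = - ray_arg z 1.
Proof.
have N0 := sqm_gt0 z y0; have pi0 := pi_gt0 R.
have hv := atan_def ((1 * N - x) / y); have hw := atan_def (x / y).
have le_atan (a b : R) : a < b -> atan a < atan b by exact: lt_atan.
have vw : (1 * N - x) / y - - (x / y) = N / y by field.
rewrite /carg modulus_sub1 ReD ReN ImD ImN /= sub0r oppr_ge0 -cos_ray_arg1.
have [yn|yp] := leP y 0.
  have {}yn : y < 0 by rewrite lt_neqAle y0.
  have : atan ((1 * N - x) / y) < atan (- (x / y)).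
    by apply: lt_atan; rewrite -subr_lt0 vw pmulr_rlt0// invr_lt0.
  rewrite atanN => h; rewrite cosKN//; rewrite /ray_arg.
  by case: hv => /andP[]; case: hw => /andP[] *; apply/andP; split; lra.
have : atan (- (x / y)) < atan ((1 * N - x) / y).
  by apply: lt_atan; rewrite -subr_gt0 vw divr_gt0.
rewrite atanN => h; rewrite cosK//; rewrite /ray_arg in_itv/=.
by case: hv => /andP[]; case: hw => /andP[] *; apply/andP; split; lra.
Qed.

(** The function D(t) of the overview, with arg(1 - tz) replaced by the smooth - [ray_arg]. *)
Definition ray_D (t : R) := ray_Li2 Li2 z t - ray_arg z t * ln (t * modulus z).

Lemma tetra_volume_ray : tetra_volume Li2 z = ray_D 1.
Proof.
by rewrite /tetra_volume carg_sub1 /ray_D /ray_Li2 !mul1r; ring.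
Qed.

(** The derivative of the logarithm contributes [ray_arg] / t, which cancels that of the dilogarithm
    by [ray_Li2_derive]. *)
Lemma is_derive_ray_D (t : R) : 0 < t ->
  is_derive t 1 ray_D (- (y / q t) * ln (t * modulus z)).
Proof.
move=> t0; have m0 := modulus_gt0 z y0.
have dl : is_derive t 1 (fun s => ln (s * modulus z)) t^-1.
  have tm : 0 < t * modulus z by exact: mulr_gt0.
  have du : is_derive t 1 (fun s => s * modulus z) (modulus z).
    apply: is_derive_eq; rewrite scaler0 add0r /GRing.scale/=; ring.
  have := @is_derive1_comp _ (@ln R) (fun s => s * modulus z) t _ _ (is_derive1_ln tm) du.
  move=> h; apply: (@is_derive_eq _ _ _ _ _ _ _ _ h).
  by field; rewrite !gt_eqF.
have dG := is_derive_ray_Li2 _ _ HLi2 y0 t.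
have dK := is_derive_ray_arg z y0 t.
have h : is_derive t 1 ray_D (derive1 (ray_Li2 Li2 z) t -
    (ray_arg z t *: t^-1 + ln (t * modulus z) *: (y / q t))).
  by apply: is_deriveB; apply: is_deriveM.
apply: (@is_derive_eq _ _ _ _ _ _ _ _ h).
have e := ray_Li2_derive _ _ HLi2 y0 t (ltW t0).
rewrite /GRing.scale/= -e; field.
by rewrite !gt_eqF// ray_q_gt0.
Qed.

(** The derivative y / q is at most N / |y| in absolute value, because N q(t) - y^2 = (N t -
    x)^2. *)
Lemma ray_arg_lip t : 0 <= t -> `|ray_arg z t| <= N / `|y| * t.
Proof.
move=> t0; have N0 := sqm_gt0 z y0.
move: t0; rewrite le_eqVlt => /predU1P[<-|t0].
  by rewrite ray_arg0 normr0 mulr0.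
have df s : s \in `]0, t[%R -> is_derive s 1 (ray_arg z) (y / q s).
  by move=> _; exact: is_derive_ray_arg.
have cf : {within `[0, t], continuous (ray_arg z)}.
  apply: continuous_in_subspaceT => s _.
  exact: is_derive_continuous (is_derive_ray_arg z y0 s).
have [c _] := MVT t0 df cf; rewrite ray_arg0 !subr0 => ->.
have q0 := ray_q_gt0 z y0 c.
rewrite !normrM normfV (gtr0_norm q0) (gtr0_norm t0) ler_pM2r//.
have ny : 0 < `|y| by rewrite normr_gt0.
rewrite ler_pdivrMr// mulrAC ler_pdivlMr// -normrM -expr2 ger0_norm ?sqr_ge0//.
have : 0 <= (N * c - x) ^+ 2 by exact: sqr_ge0.
by rewrite /ray_q /sqm; nra.
Qed.

(** From ln a <= a at a = s, and at a = 1 / sqrt s for the negative part. The bound tends to 0 with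
    s, which makes [ray_D] continuous at 0. *)
Lemma normr_ln_le (s : R) : 0 < s -> s * `|ln s| <= 2 * Num.sqrt s + s ^+ 2.
Proof.
move=> s0; set k := Num.sqrt s; have k0 : 0 < k by rewrite sqrtr_gt0.
have kk : s = k ^+ 2 by rewrite sqr_sqrtr// ltW.
have ki : 0 < k^-1 by rewrite invr_gt0.
have ln_le (a : R) : 0 < a -> ln a <= a.
  move=> a0; have a1 : -1 < a - 1 by lra.
    by have := le_ln1Dx a1; rewrite (_ : 1 + (a - 1) = a); [lra|ring].
have h1 : ln s <= s by exact: ln_le.
have h2 : - ln s <= 2 * k^-1.
  have := ln_le _ ki; rewrite lnV ?posrE// => h.
  have -> : ln s = 2 * ln k by rewrite kk expr2 lnM ?posrE//; ring.
  by lra.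
have h3 : `|ln s| <= 2 * k^-1 + s.
  by rewrite ler_norml; apply/andP; split; [lra|have : 0 < 2 * k^-1 by rewrite mulr_gt0]; lra.
apply: le_trans (ler_wpM2l (ltW s0) h3) _.
rewrite le_eqVlt; apply/orP; left; apply/eqP; rewrite kk; field.
by rewrite gt_eqF.
Qed.

Lemma ray_D_at0 : {for 0, continuous ray_D}.
Proof.
have m0 := modulus_gt0 z y0; have N0 := sqm_gt0 z y0.
have ny : 0 < `|y| by rewrite normr_gt0.
pose C := N / `|y| / modulus z.
have C0 : 0 < C by rewrite /C !divr_gt0.
have c1 : {for 0, continuous (fun t => ray_arg z t * ln (t * modulus z))}.
  rewrite /prop_for /continuous_at/= ray_arg0 mul0r.
  pose b (t : R) := C * (2 * Num.sqrt (t * modulus z) + (t * modulus z) ^+ 2).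
  have cid : (fun t : R => t * modulus z) t @[t --> 0] --> (0 * modulus z).
    by apply: cvgM; [exact: cvg_id|exact: cvg_cst].
  have cs : (fun t => Num.sqrt (t * modulus z)) t @[t --> (0 : R)] -->
      Num.sqrt (0 * modulus z).
    exact: (@continuous_cvg _ _ _ _ _ (fun t => t * modulus z) (@Num.sqrt R) _
      (@sqrt_continuous R (0 * modulus z)) cid).
  have cb : b t @[t --> (0 : R)] --> (0 : R).
    have e : C * (2 * Num.sqrt (0 * modulus z) + (0 * modulus z) ^+ 2) = 0 :> R.
      by rewrite mul0r sqrtr0 mulr0 expr0n/= addr0 mulr0.
    suff : b t @[t --> (0 : R)] -->
        C * (2 * Num.sqrt (0 * modulus z) + (0 * modulus z) ^+ 2) by rewrite e.
    apply: cvgM; first exact: cvg_cst.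
    apply: cvgD; first by apply: cvgM; [exact: cvg_cst|exact: cs].
    exact: (@continuous_cvg _ _ _ _ _ (fun t => t * modulus z)
      (fun a : R => a ^+ 2) _ (@exprn_continuous R 2 (0 * modulus z)) cid).
  have cnb : (fun t => - b t) t @[t --> (0 : R)] --> (0 : R).
    have := cvgN cb; rewrite oppr0; exact.
  apply: (squeeze_cvgr _ cnb cb); near=> t.
  rewrite -ler_norml normrM.
  (* Continuity at 0 is two-sided; for t <= 0 the logarithm has the default value 0. *)
  have [t0|t0] := leP t 0.
    rewrite ln0 ?normr0 ?mulr0; last by rewrite pmulr_lle0.
    rewrite /b; apply: mulr_ge0; first exact: ltW.
    by rewrite addr_ge0 ?sqr_ge0// mulr_ge0 ?sqrtr_ge0.
  have tm : 0 < t * modulus z by exact: mulr_gt0.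
  have h1 := ler_wpM2r (normr_ge0 (ln (t * modulus z))) (ray_arg_lip t (ltW t0)).
  apply: le_trans h1 _.
  have -> : N / `|y| * t * `|ln (t * modulus z)| =
      C * (t * modulus z * `|ln (t * modulus z)|).
    by rewrite /C; field; rewrite !gt_eqF.
  by rewrite /b ler_pM2l// normr_ln_le.
have c0 : {for 0, continuous (ray_Li2 Li2 z)}.
  exact: is_derive_continuous (is_derive_ray_Li2 _ _ HLi2 y0 0).
by apply: cvgB; [exact: c0|exact: c1].
Unshelve. all: by end_near. Qed.

Lemma ray_D_continuous t : 0 <= t -> {for t, continuous ray_D}.
Proof.
rewrite le_eqVlt => /predU1P[<-|t0]; first exact: ray_D_at0.
exact: is_derive_continuous (is_derive_ray_D _ t0).
Qed.

Lemma ray_D0 : ray_D 0 = 0.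
Proof.
rewrite /ray_D ray_arg0 mul0r subr0.
have [c [rho [rho0 H]]] := ray_Li2_analytic _ _ HLi2 y0 0.
have m0 : 0 < (modulus z)^-1 by rewrite invr_gt0 modulus_gt0.
exact: (psum_at_center _ _ _ _ m0 (ray_Li2_series _ _ HLi2 y0)).
Qed.

End ray_dilogarithm.

(** * Inversion of the edge parameter *)

Section inversion.
Context {R : realType}.
Variables (Li2 : R[i] -> R[i]).
Hypotheses (HLi2 : is_dilogarithm Li2).
Implicit Types (w z : R[i]).

Lemma modulus2 z : modulus z ^+ 2 = sqm z.
Proof. by rewrite /modulus; case: z => a b /=; rewrite sqr_sqrtr// addr_ge0 ?sqr_ge0. Qed.

Lemma ReV z : complex.Re z^-1 = complex.Re z / sqm z.
Proof. by case: z. Qed.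

Lemma ImV z : complex.Im z^-1 = - complex.Im z / sqm z.
Proof. by case: z => a b; rewrite /= mulNr. Qed.

(** The dilogarithm series has real coefficients. *)
Lemma Im_Li2_conj w : modulus w <= 1 ->
  complex.Im (Li2 (conjc w)) = - complex.Im (Li2 w).
Proof.
move=> w1; have w1' : modulus (conjc w) <= 1.
  by move: w1; rewrite /modulus; case: w => a b /=; rewrite sqrrN.
have h1 : (fun n => - complex.Im (series (fun m => w ^+ m.+1 / m.+1%:R ^+ 2) n)) @ \oo -->
    - complex.Im (Li2 w) by exact: cvgN (cvg_Im _ _ (proj1 HLi2 _ w1)).
have h2 := cvg_Im _ _ (proj1 HLi2 _ w1').
suff e : (fun n => complex.Im (series (fun m => conjc w ^+ m.+1 / m.+1%:R ^+ 2) n)) =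
    (fun n => - complex.Im (series (fun m => w ^+ m.+1 / m.+1%:R ^+ 2) n)).
  rewrite e in h2; exact: (cvg_unique (@norm_hausdorff _ _) h2 h1).
apply/funext => n; rewrite !Im_series /series/= -sumrN; apply: eq_bigr => i _.
have -> : i.+1%:R ^+ 2 = (i.+1%:R ^+ 2 : R)%:C by rewrite rmorphXn/= rmorph_nat.
by rewrite -fmorphV -rmorphXn !ImMR -mulNr; congr (_ * _); case: (w ^+ i.+1).
Qed.

Lemma derive0_pos (f : R -> R) (a b : R) : (forall t : R, 0 < t -> is_derive t 1 f 0) ->
  0 < a -> 0 < b -> f a = f b.
Proof.
move=> df; wlog ab : a b / a <= b => [hw a0 b0|a0 b0].
  by have [/hw|/ltW/hw] := leP a b; [apply|move=> h; apply/esym/h].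
apply: derive0_eq => // t /andP[at_ tb].
  by apply: is_derive_continuous (df t _); exact: lt_le_trans at_.
by apply: df; exact: lt_trans at_.
Qed.

Lemma is_derive_ray_D_inv z (t : R) : complex.Im z != 0 -> 0 < t ->
  is_derive t 1 (fun s => ray_D Li2 z^-1 s^-1)
    (complex.Im z / ray_q z t * ln (t * modulus z)).
Proof.
move=> y0 t0; have N0 := sqm_gt0 z y0; have m0 := modulus_gt0 z y0.
have y0' : complex.Im z^-1 != 0.
  by rewrite ImV mulf_eq0 oppr_eq0 invr_eq0 negb_or y0 gt_eqF.
have ti : 0 < t^-1 by rewrite invr_gt0.
have d1 : is_derive t 1 (fun s : R => s^-1) (- t ^- 2).
  have h : is_derive t 1 (fun s : R => s^-1) (- t ^- 2 *: 1).
    by apply: is_deriveV; rewrite gt_eqF.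
  by apply: (@is_derive_eq _ _ _ _ _ _ _ _ h); rewrite /GRing.scale/= mulr1.
have h := @is_derive1_comp _ (ray_D Li2 z^-1) (fun s => s^-1) t _ _
  (is_derive_ray_D _ _ HLi2 y0' t^-1 ti) d1.
apply: (@is_derive_eq _ _ _ _ _ _ _ _ h).
have -> : t^-1 * modulus z^-1 = (t * modulus z)^-1.
  by rewrite invfM; congr (_ * _); exact: Normc.normcV.
rewrite lnV ?posrE ?mulr_gt0// ImV.
have q0 := ray_q_gt0 z y0 t.
have -> : ray_q z^-1 t^-1 = ray_q z t / (t ^+ 2 * sqm z).
  have sV : sqm z^-1 = (sqm z)^-1.
    rewrite {1}/sqm ReV ImV /=; move: N0; rewrite /sqm => N0; field.
    by rewrite gt_eqF.
  rewrite /ray_q sV ReV; field.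
  by rewrite !gt_eqF.
by field; rewrite !gt_eqF.
Qed.

(** The sum f of [ray_D] for z at t and for 1 / z at 1 / t has derivative 0. At t = 1 / |z| both
    logarithms vanish, and the two arguments of Li2 are conjugate points of the unit circle, so f =
    0 there and at t = 1. *)
Lemma ray_D_inv z : complex.Im z != 0 -> ray_D Li2 z^-1 1 = - ray_D Li2 z 1.
Proof.
move=> y0; have N0 := sqm_gt0 z y0; have m0 := modulus_gt0 z y0.
have mV : modulus z^-1 = (modulus z)^-1 by exact: Normc.normcV.
pose f (t : R) := ray_D Li2 z t + ray_D Li2 z^-1 t^-1.
have df (t : R) : 0 < t -> is_derive t 1 f 0.
  move=> t0; have h := is_deriveD (is_derive_ray_D _ _ HLi2 y0 t t0)
    (is_derive_ray_D_inv z t y0 t0).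
  by apply: (@is_derive_eq _ _ _ _ _ _ _ _ h); rewrite mulNr addNr.
have mi : 0 < (modulus z)^-1 by rewrite invr_gt0.
have := derive0_pos f 1 (modulus z)^-1 df ltr01 mi.
rewrite /f invr1 invrK /ray_D mV mulVf ?mulfV ?gt_eqF// ln1 !mulr0 !subr0.
rewrite {2 4}/ray_Li2 => h.
suff e : complex.Im (Li2 ((modulus z)%:C / z)) =
    - complex.Im (Li2 ((modulus z)^-1%:C * z)).
  by rewrite e subrr in h; move/eqP: h; rewrite addrC addr_eq0 => /eqP.
rewrite -Im_Li2_conj; last first.
  by rewrite modulusM modulusR gtr0_norm// mulVf ?lexx// gt_eqF.
congr (complex.Im (Li2 _)).
have e : modulus z / sqm z = (modulus z)^-1.
  by rewrite -modulus2; field; rewrite gt_eqF.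
have Rc u : complex.Re (conjc u) = complex.Re u :> R by case: u.
have Ic u : complex.Im (conjc u) = - complex.Im u :> R by case: u.
apply: complex_eq; rewrite ?Rc ?Ic ?ReM ?ImM ReV ImV /= -e; ring.
Qed.

End inversion.

Section tetrahedron_integrand.
Context {R : realType}.
Variables (Li2 : R[i] -> R[i]) (z : R[i]).
Hypotheses (HLi2 : is_dilogarithm Li2) (y0 : complex.Im z != 0).
Local Notation x := (complex.Re z).
Local Notation y := (complex.Im z).
Local Notation N := (sqm z).
Local Notation q := (ray_q z).

Definition chord_den u := u * q 1 + (1 - u).
(* The involution of [0, 1] that satisfies du' / ray_q u' = - du / ray_q u. *)
Definition chord_inv u := (1 - u) / chord_den u.

(* The integrand attached to the edge parameter 1 / z. *)
Definition tetra_integrand u :=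
  - (1 / 2) * (y / q u) * ln (chord_den u / (N * (u * (1 - u)))).

Definition tetra_primitive u :=
  (1 / 2) * (ray_D Li2 z (chord_inv u) - ray_D Li2 z u).

Lemma chord_den_gt0 u : 0 <= u <= 1 -> 0 < chord_den u.
Proof.
move=> /andP[u0 u1]; have q0 := ray_q_gt0 z y0 1.
move: u0; rewrite le_eqVlt => /predU1P[<-|u0].
  by rewrite /chord_den mul0r add0r subr0.
by rewrite ltr_pwDl ?subr_ge0// mulr_gt0.
Qed.

Lemma tetra_primitive0 : tetra_primitive 0 = (1 / 2) * ray_D Li2 z 1.
Proof.
by rewrite /tetra_primitive /chord_inv /chord_den mul0r add0r subr0 divr1 ray_D0// subr0.
Qed.

Lemma tetra_primitive1 : tetra_primitive 1 = - (1 / 2) * ray_D Li2 z 1.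
Proof.
by rewrite /tetra_primitive /chord_inv subrr mul0r ray_D0// sub0r mulrN mulNr.
Qed.

Lemma is_derive_chord_inv (u : R) : 0 <= u <= 1 ->
  is_derive u 1 chord_inv (- q 1 / chord_den u ^+ 2).
Proof.
move=> u01; have d0 := chord_den_gt0 _ u01.
have d1 : is_derive u 1 chord_den (q 1 - 1).
  apply: is_derive_eq; rewrite /GRing.scale/=; ring.
have d2 : is_derive u 1 (fun s => (chord_den s)^-1) (- chord_den u ^- 2 *: (q 1 - 1)).
  by apply: is_deriveV; rewrite gt_eqF.
have d3 : is_derive u 1 (fun s : R => 1 - s) (0 - 1) by apply: is_deriveB.
have h : is_derive u 1 chord_inv ((1 - u) *: (- chord_den u ^- 2 *: (q 1 - 1)) +
    (chord_den u)^-1 *: (0 - 1)) by apply: is_deriveM.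
apply: (@is_derive_eq _ _ _ _ _ _ _ _ h); rewrite /GRing.scale/=.
have -> : (chord_den u)^-1 = chord_den u * chord_den u ^- 2.
  by field; rewrite gt_eqF.
by rewrite {2}/chord_den; ring.
Qed.

(** The derivatives of the two terms share the factor y / q(u), as [chord_inv] changes the sign of
    du / q(u). Their logarithms add up to that of u u' |z|^2, with u' = [chord_inv u]. *)
Lemma is_derive_tetra_primitive (u : R) : 0 < u < 1 ->
  is_derive u 1 tetra_primitive (tetra_integrand u).
Proof.
move=> /andP[u0 u1]; have q1 := ray_q_gt0 z y0 1; have qu := ray_q_gt0 z y0 u.
have m0 := modulus_gt0 z y0; have N0 := sqm_gt0 z y0.
have u01 : 0 <= u <= 1 by rewrite !ltW.
have d0 := chord_den_gt0 _ u01.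
have u1' : 0 < 1 - u by rewrite subr_gt0.
have i0 : 0 < chord_inv u by rewrite divr_gt0.
have h1 := @is_derive1_comp _ (ray_D Li2 z) chord_inv u _ _
  (is_derive_ray_D _ _ HLi2 y0 _ i0) (is_derive_chord_inv u u01).
have h2 := is_derive_ray_D _ _ HLi2 y0 u u0.
have h : is_derive u 1 tetra_primitive ((1 / 2) *:
  (- (y / q (chord_inv u)) * ln (chord_inv u * modulus z) * (- q 1 / chord_den u ^+ 2)
   - (- (y / q u) * ln (u * modulus z)))).
  by apply: is_deriveZ; apply: is_deriveB.
apply: (@is_derive_eq _ _ _ _ _ _ _ _ h); rewrite /GRing.scale/=.
have -> : q (chord_inv u) = q 1 * q u / chord_den u ^+ 2.
  rewrite {1}/ray_q /chord_inv /chord_den /ray_q.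
  move: d0; rewrite /chord_den /ray_q expr1n !mulr1 => d0; field.
  by rewrite gt_eqF.
rewrite /tetra_integrand.
have -> : ln (chord_den u / (N * (u * (1 - u)))) =
    - (ln (chord_inv u * modulus z) + ln (u * modulus z)).
  have p1 : 0 < chord_inv u * modulus z by exact: mulr_gt0.
  have p2 : 0 < u * modulus z by exact: mulr_gt0.
  have p3 : 0 < (chord_inv u * modulus z) * (u * modulus z) by exact: mulr_gt0.
  rewrite -(lnM p1 p2) -(lnV p3); congr ln.
  by rewrite -modulus2 /chord_inv; field; rewrite !gt_eqF.
by field; rewrite !gt_eqF.
Qed.

Lemma tetra_primitive_continuous u : 0 <= u <= 1 ->
  {for u, continuous tetra_primitive}.
Proof.
move=> u01; have d0 := chord_den_gt0 _ u01; have /andP[u0 u1] := u01.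
have i0 : 0 <= chord_inv u by rewrite divr_ge0 ?subr_ge0// ltW.
have c1 := ray_D_continuous _ _ HLi2 y0 _ u0.
have c2 := ray_D_continuous _ _ HLi2 y0 _ i0.
have c3 := is_derive_continuous _ _ _ (is_derive_chord_inv u u01).
have c4 : {for u, continuous (ray_D Li2 z \o chord_inv)}.
  exact: continuous_comp c3 c2.
by apply: cvgM; [exact: cvg_cst|apply: cvgB; [exact: c4|exact: c1]].
Qed.

End tetrahedron_integrand.

Section symmetry.
Context {R : realType}.
Variables (Li2 : R[i] -> R[i]).
Hypotheses (HLi2 : is_dilogarithm Li2).
Implicit Types (p v w z : R[i]).

Lemma sqmM z w : sqm (z * w) = sqm z * sqm w.
Proof. by rewrite /sqm ReM ImM; ring. Qed.

Lemma sqm_neq0 v : v != 0 -> sqm v != 0.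
Proof.
apply: contra; rewrite /sqm paddr_eq0 ?sqr_ge0// !sqrf_eq0 => /andP[/eqP h1 /eqP h2].
by apply/eqP/complex_eq.
Qed.

Lemma ray_q_sqm z (u : R) : ray_q z u = sqm (1 - u%:C * z).
Proof. by rewrite ray_qE /sqm ReD ImD ReN ImN ReM ImM /=; ring. Qed.

Lemma sqmV v : sqm v^-1 = (sqm v)^-1.
Proof.
have [->|v0] := eqVneq v 0.
  by rewrite invr0 /sqm/= expr0n/= addr0 invr0.
by apply: (mulfI (sqm_neq0 _ v0)); rewrite -sqmM !mulfV ?sqm_neq0// /sqm/= expr0n expr1n addr0.
Qed.

Lemma ray_q_div p v (u : R) : v != 0 ->
  ray_q (p / v) u = sqm (v - u%:C * p) / sqm v.
Proof.
move=> v0; rewrite ray_q_sqm -sqmV -sqmM; congr sqm.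
by rewrite mulrBl divff// mulrA.
Qed.

Lemma Im_div p v : complex.Im (p / v) = cross v p / sqm v.
Proof. by rewrite ImM ReV ImV /cross; ring. Qed.

Lemma sqm_comb p v (u : R) : sqm (v - u%:C * p) =
  u * sqm (v - p) + (1 - u) * sqm v - u * (1 - u) * sqm p.
Proof. by rewrite /sqm !(ReD, ImD, ReN, ImN, ReM, ImM) /=; ring. Qed.

(** Writing the parameter as a quotient p / v makes the integrand depend only on the squared sides
    of the triangle 0, v, p and on a determinant, which are the quantities met on the faces. *)
Lemma tetra_integrand_div p v (u : R) (M := u * sqm (v - p) + (1 - u) * sqm v) :
  v != 0 -> tetra_integrand (p / v) u =
  - (1 / 2) * (cross v p / (M - u * (1 - u) * sqm p) *
    ln (M / (sqm p * (u * (1 - u))))).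
Proof.
move=> v0; have s0 := sqm_neq0 _ v0.
rewrite /tetra_integrand -mulrA Im_div ray_q_div// sqm_comb -/M; congr (_ * (_ * ln _)).
  by rewrite -mulf_div divff ?mulr1// invr_eq0.
rewrite /chord_den ray_q_div// rmorph1 mul1r sqmM sqmV.
have -> : u * (sqm (v - p) / sqm v) + (1 - u) = M / sqm v by rewrite /M; field.
rewrite !invfM !invrK; move: (sqm p)^-1 u^-1 (1 - u)^-1 => A B C; field.
exact: s0.
Qed.

(* Up to sign, 1 - u exchanges the integrands of z and z / (z - 1). *)
Lemma ray_D_cyc z : complex.Im z != 0 ->
  ray_D Li2 (z / (z - 1)) 1 = - ray_D Li2 z 1.
Proof.
move=> y0.
have z1 : z - 1 != 0.
  by apply: contra y0 => /eqP/(congr1 (@complex.Im R)); rewrite ImD ImN /= subr0 => ->.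
have s0 := sqm_neq0 _ z1.
pose v := z / (z - 1).
have cv : cross (z - 1) z = - complex.Im z.
  by rewrite /cross ReD ImD ReN ImN /=; ring.
have v0 : complex.Im v != 0 by rewrite Im_div cv mulf_neq0 ?oppr_eq0 ?invr_eq0.
pose h (u : R) := tetra_primitive Li2 v u - tetra_primitive Li2 z (1 - u).
have dr (u : R) : is_derive u 1 (fun s : R => 1 - s) (0 - 1) by apply: is_deriveB.
have := derive0_eq h 0 1 ler01 _ _; rewrite /h subr0 subrr.
rewrite !tetra_primitive0// !tetra_primitive1// -/v => H.
suff e : 1 / 2 * ray_D Li2 v 1 - - (1 / 2) * ray_D Li2 z 1 =
    - (1 / 2) * ray_D Li2 v 1 - 1 / 2 * ray_D Li2 z 1 by lra.
apply: H => u u01.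
  have u01' : 0 <= 1 - u <= 1 by case/andP: u01 => *; apply/andP; split; lra.
  apply: cvgB; first exact: (tetra_primitive_continuous _ _ HLi2 v0 u u01).
  have c1 := is_derive_continuous _ _ _ (dr u).
  exact: (@continuous_comp _ _ _ (fun s : R => 1 - s) (tetra_primitive Li2 z) u c1
    (tetra_primitive_continuous _ _ HLi2 y0 _ u01')).
have u01' : 0 < 1 - u < 1 by case/andP: u01 => *; apply/andP; split; lra.
have h1 := is_derive_tetra_primitive _ _ HLi2 v0 u u01.
have h2 := @is_derive1_comp _ (tetra_primitive Li2 z) (fun s : R => 1 - s) u _ _
  (is_derive_tetra_primitive _ _ HLi2 y0 _ u01') (dr u).
have h3 : is_derive u 1 h (tetra_integrand v u - tetra_integrand z (1 - u) * (0 - 1)).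
  by apply: is_deriveB.
apply: (@is_derive_eq _ _ _ _ _ _ _ _ h3).
have := tetra_integrand_div z 1 (1 - u) (oner_neq0 _); rewrite divr1 => ->.
rewrite tetra_integrand_div// cv.
have -> : cross 1 z = complex.Im z by rewrite /cross /=; ring.
have -> : sqm (z - 1 - z) = 1 by rewrite /sqm !(ReD, ReN, ImD, ImN)/=; ring.
have -> : sqm (1 - z) = sqm (z - 1) by rewrite /sqm !(ReD, ReN, ImD, ImN)/=; ring.
have -> : sqm (1 : R[i]) = 1 by rewrite /sqm/=; ring.
have -> : 1 - (1 - u) = u by ring.
rewrite !mulr1 [(1 - u) * u]mulrC [u + _]addrC.
by ring.
Qed.

Lemma tetra_volume_inv z : complex.Im z != 0 ->
  tetra_volume Li2 z^-1 = - tetra_volume Li2 z.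
Proof.
move=> y0; rewrite !tetra_volume_ray//; last first.
  by rewrite ImV mulf_neq0 ?oppr_eq0 ?invr_eq0// gt_eqF// sqm_gt0.
exact: ray_D_inv.
Qed.

(** [ray_D_cyc] at 1 / z relates 1 / (1 - z) to 1 / z, and inversion is applied on both sides. *)
Lemma tetra_volume_sub1 z : complex.Im z != 0 ->
  tetra_volume Li2 (1 - z) = - tetra_volume Li2 z.
Proof.
move=> y0.
have iV w : complex.Im w != 0 -> complex.Im w^-1 != 0.
  by move=> w0; rewrite ImV mulf_neq0 ?oppr_eq0 ?invr_eq0// gt_eqF// sqm_gt0.
have y1 : complex.Im (1 - z) != 0 by rewrite ImD ImN /= sub0r oppr_eq0.
have z0 : z != 0 by apply: contra y0 => /eqP ->.
have z1 : 1 - z != 0 by apply: contra y1 => /eqP ->.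
have e : z^-1 / (z^-1 - 1) = (1 - z)^-1.
  have -> : z^-1 - 1 = (1 - z) / z by rewrite mulrBl mul1r divff.
  by rewrite invf_div mulrA mulVf// mul1r.
apply: oppr_inj; rewrite -(tetra_volume_inv (1 - z))// -e.
rewrite tetra_volume_ray//; last by rewrite e; exact: iV.
by rewrite ray_D_cyc ?iV// -tetra_volume_ray ?iV// tetra_volume_inv.
Qed.

(** Here arg(1 - z) = 0. Im Li2 vanishes on [-1, 0] by conjugation, and then on the whole negative
    axis by [analytic_zero]. *)
Lemma tetra_volume_neg_real z : complex.Im z = 0 -> complex.Re z < 0 ->
  tetra_volume Li2 z = 0.
Proof.
move=> zi zr; pose t := - complex.Re z.
have zE : z = t%:C * -1 by apply: complex_eq; rewrite ?ReM ?ImM /= ?zi /t; ring.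
have -> : tetra_volume Li2 z = complex.Im (Li2 z) + ln (modulus z) * 0.
  rewrite /tetra_volume; congr (_ + _ * _).
  rewrite /carg ImD ImN zi /= oppr0 add0r lexx /modulus.
  have -> : 1 - z = (1 + t)%:C.
    by apply: complex_eq; rewrite ?(ReD, ImD, ReN, ImN)/= ?zi /t; ring.
  have t1 : 0 < 1 + t by rewrite /t; lra.
  by rewrite -[Normc.normc _]/(modulus _) modulusR gtr0_norm//= divff ?acos1// gt_eqF.
rewrite mulr0 addr0 zE.
apply: (analytic_zero (fun s : R => complex.Im (Li2 (s%:C * -1))) 1 ltr01).
- move=> s s0; apply: analytic_ray.
    by rewrite /modulus /= oppr0 expr0n/= addr0 sqrrN expr1n sqrtr1.
  apply: (proj2 HLi2) => -[_]; rewrite ReM /=; lra.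
- move=> s /andP[s0 s1].
  have m1 : modulus (s%:C * -1 : R[i]) <= 1.
    by rewrite mulrN1 -rmorphN modulusR normrN ger0_norm// ltW.
  have h := Im_Li2_conj _ HLi2 _ m1.
  suff e : conjc (s%:C * -1 : R[i]) = s%:C * -1 by rewrite e in h; lra.
  by rewrite mulrN1 /=; congr (_ +i* _); ring.
- by rewrite /t; lra.
Qed.

End symmetry.

(** * The integrals over the two faces *)

Section faces.
Context {R : realType}.
Variables (n : nat) (r theta : R).
Hypotheses (n3 : (3 <= n)%N) (r1 : 1 < r).
Local Notation alpha := (2 * pi / n%:R : R).
Hypotheses (th0 : 0 <= theta) (tha : theta < alpha).

(** For a = e^(i alpha) and b = r e^(i theta), r times this is cross 1 b + cross b a, and
    [chord_sqr] is |a - 1|^2. *)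
Definition side_sin := sin theta + sin (alpha - theta).
Definition chord_sqr := 2 - 2 * cos alpha.
(* This is |b - e|^2 + 1 - |e|^2 for b = r e^(i theta) and e on the chord from
   e^(i alpha) to 1, and 1 - |e|^2 = u (1 - u) chord_sqr. *)
Definition link_sqr u :=
  u * (1 + r ^+ 2 - 2 * r * cos theta) +
  (1 - u) * (1 + r ^+ 2 - 2 * r * cos (alpha - theta)).

Definition affine_ratio p0 p1 k0 k1 (t : R) :=
  let s := (t ^+ 2 - 1) / (r ^+ 2 - 1) in
  ((1 - s) * p0 + s * p1) / (2 * t * ((1 - s) * k0 + s * k1)).

Let A := cos (alpha / 2).
Let S := sin (alpha / 2).
Let B := cos (theta - alpha / 2).
Let C := sin (theta - alpha / 2).

Let AS : A ^+ 2 + S ^+ 2 = 1. Proof. exact: cos2Dsin2. Qed.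
Let BC : B ^+ 2 + C ^+ 2 = 1. Proof. exact: cos2Dsin2. Qed.

Let alphaE : alpha = alpha / 2 + alpha / 2 :> R.
Proof. by move: (alpha) => a; lra. Qed.
Let thetaE : theta = (theta - alpha / 2) + alpha / 2 :> R.
Proof. by rewrite subrK. Qed.
Let alpha_thetaE : alpha - theta = alpha / 2 - (theta - alpha / 2) :> R.
Proof. by move: (alpha) => a; lra. Qed.

Let sin_alphaE : sin alpha = 2 * S * A.
Proof. by rewrite alphaE sinD -/A -/S; ring. Qed.
Let chord_sqrE : chord_sqr = 4 * S ^+ 2.
Proof. by rewrite /chord_sqr alphaE cosD -/A -/S; have := AS; lra. Qed.
Let cos_thE : cos theta = B * A - C * S.
Proof. by rewrite [in LHS]thetaE cosD -/A -/S. Qed.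
Let cos_athE : cos (alpha - theta) = A * B + S * C.
Proof. by rewrite alpha_thetaE cosB -/A -/S. Qed.
Let side_sinE : side_sin = 2 * S * B.
Proof.
rewrite /side_sin alpha_thetaE sinB [sin theta](_ : _ = C * A + B * S).
  by rewrite -/A -/S -/B -/C; ring.
by rewrite [in LHS]thetaE sinD -/A -/S.
Qed.
Let link_sqrE u :
  link_sqr u = 1 + r ^+ 2 - 2 * r * (A * B + (1 - 2 * u) * (S * C)).
Proof. by rewrite /link_sqr cos_thE cos_athE; ring. Qed.

Let r20 : 0 < r ^+ 2 - 1. Proof. exact: r21. Qed.

Let level_itv t : 1 < t < r -> 0 < level r (t ^+ 2) < 1.
Proof.
move=> /andP[t1 tr]; rewrite level_gt0// level_lt1// exprn_egt1//=.
rewrite -subr_gt0 subr_sqr; apply: mulr_gt0; lra.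
Qed.

(** The width of the face and the squared height of its points both contain the factor 1 - level.
    Once it is cancelled, numerator and cofactor of 2 t are affine in t^2, as [integral_rational]
    requires. *)
Lemma face1_density u t : 1 < t < r ->
  face_density (face1_x n r theta) (face1_lo n r theta) (face1_hi n r theta) u t =
  affine_ratio (sin alpha) (r * side_sin) (u * (1 - u) * chord_sqr) (link_sqr (1 - u)) t.
Proof.
move=> t1r; have /andP[s0 s1] := level_itv _ t1r.
have s1' : 1 - level r (t ^+ 2) != 0 by rewrite gt_eqF// subr_gt0.
have t0 : 0 < t by lra.
rewrite /face_density /affine_ratio face1_width.
rewrite -[(_ - 1) / (_ - 1)]/(level r (t ^+ 2)) -/S.
have -> : t ^+ 2 - face1_x n r theta (t ^+ 2) ^+ 2 -
    (face1_lo n r theta (t ^+ 2) + u * ((1 - level r (t ^+ 2)) * (2 * S))) ^+ 2 =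
    (1 - level r (t ^+ 2)) * ((1 - level r (t ^+ 2)) * (u * (1 - u) * chord_sqr) +
      level r (t ^+ 2) * link_sqr (1 - u)).
  rewrite [X in X - _ - _](levelK r r1) chord_sqrE link_sqrE.
  rewrite /face1_x /face1_lo /edge -/A -/S -/B -/C; set s := level _ _.
  transitivity ((1 - s) * ((1 - s) * (u * (1 - u) * (4 * S ^+ 2)) +
      s * (1 + r ^+ 2 - 2 * r * (A * B + (1 - 2 * (1 - u)) * (S * C)))) -
      (1 - s) ^+ 2 * (A ^+ 2 + S ^+ 2 - 1) - s ^+ 2 * r ^+ 2 * (B ^+ 2 + C ^+ 2 - 1)).
    by ring.
  by rewrite AS BC !subrr !mulr0 !subr0.
rewrite sin_alphaE side_sinE /face1_x /edge -/A -/B; set s := level _ _ in s1' *.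
set Q := (1 - s) * (u * _ * _) + _.
have -> : (1 - s) * (2 * S) * ((1 - s) * A + s * r * B) =
  (1 - s) * ((1 - s) * (2 * S * A) + s * (r * (2 * S * B))) by ring.
by rewrite [2 * t * _]mulrCA -mulf_div divff// mul1r.
Qed.

Lemma face2_density u t : 1 < t < r ->
  face_density (face2_x n r theta) (face2_lo n r theta) (face2_hi n r theta) u t =
  affine_ratio (r * side_sin) (r ^+ 2 * sin alpha) (link_sqr u)
    (r ^+ 2 * (u * (1 - u) * chord_sqr)) t.
Proof.
move=> t1r; have /andP[s0 s1] := level_itv _ t1r.
have s1' : level r (t ^+ 2) != 0 by rewrite gt_eqF.
have t0 : 0 < t by lra.
have cB : cos (alpha / 2 - theta) = B by rewrite -cosN opprB.
have sC : sin (alpha / 2 - theta) = - C by rewrite -sinN opprB.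
rewrite /face_density /affine_ratio face2_width.
rewrite -[(_ - 1) / (_ - 1)]/(level r (t ^+ 2)) -/S.
have -> : t ^+ 2 - face2_x n r theta (t ^+ 2) ^+ 2 -
    (face2_lo n r theta (t ^+ 2) + u * (level r (t ^+ 2) * r * (2 * S))) ^+ 2 =
    level r (t ^+ 2) * ((1 - level r (t ^+ 2)) * link_sqr u +
      level r (t ^+ 2) * (r ^+ 2 * (u * (1 - u) * chord_sqr))).
  rewrite [X in X - _ - _](levelK r r1) chord_sqrE link_sqrE.
  rewrite /face2_x /face2_lo /edge cB sC -/A -/S; set s := level _ _.
  transitivity (s * ((1 - s) * (1 + r ^+ 2 - 2 * r * (A * B + (1 - 2 * u) * (S * C))) +
      s * (r ^+ 2 * (u * (1 - u) * (4 * S ^+ 2)))) -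
      s ^+ 2 * r ^+ 2 * (A ^+ 2 + S ^+ 2 - 1) - (1 - s) ^+ 2 * (B ^+ 2 + C ^+ 2 - 1)).
    by ring.
  by rewrite AS BC !subrr !mulr0 !subr0.
rewrite sin_alphaE side_sinE /face2_x /edge cB -/A; set s := level _ _ in s1' *.
set Q := (1 - s) * link_sqr u + _.
have -> : s * r * (2 * S) * ((1 - s) * B + s * r * A) =
  s * ((1 - s) * (r * (2 * S * B)) + s * (r ^+ 2 * (2 * S * A))) by ring.
by rewrite [2 * t * _]mulrCA -mulf_div divff// mul1r.
Qed.

Let a0 : 0 < alpha. Proof. exact: alpha_gt0. Qed.
Let a3 : 3 * alpha <= 2 * pi. Proof. exact: alpha_le. Qed.
Let pi0 : 0 < pi :> R. Proof. exact: pi_gt0. Qed.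

Let S0 : 0 < S. Proof. exact: sin_half_alpha_gt0. Qed.

Let A0 : 0 < A. Proof. exact: cos_half_alpha_gt0. Qed.

Lemma cos_half_le : A <= B.
Proof.
rewrite /A /B -(cos_norm (theta - _)); move: a0 a3 pi0 th0 tha.
move: (alpha) => a a0' a3' pi0' th0' tha'.
have h : `|theta - a / 2| <= a / 2 by rewrite ler_norml; apply/andP; split; lra.
by rewrite leNgt ltr_cos ?in_itv/= ?normr_ge0 -?leNgt/=; lra.
Qed.

Lemma sin_alpha_gt0 : 0 < sin alpha.
Proof. by rewrite sin_alphaE mulr_gt0// mulr_gt0. Qed.

(** Since theta - alpha / 2 is at most alpha / 2 in absolute value, its cosine is at least cos
    (alpha / 2), and r > 1. This makes Im z2 positive, so tau_2 is never flat. *)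
Lemma sin_alpha_lt : sin alpha < r * side_sin.
Proof.
rewrite sin_alphaE side_sinE mulrCA ltr_pM2l ?mulr_gt0//.
apply: le_lt_trans cos_half_le _; rewrite -subr_gt0.
have -> : r * B - B = (r - 1) * B by ring.
by rewrite mulr_gt0 ?subr_gt0// (lt_le_trans A0 cos_half_le).
Qed.

Lemma chord_sqr_gt0 : 0 < chord_sqr.
Proof. by rewrite chord_sqrE mulr_gt0// exprn_gt0. Qed.

Lemma link_end_gt0 (x : R) : 0 < 1 + r ^+ 2 - 2 * r * cos x.
Proof.
have r0 : 0 <= r by apply: ltW; exact: lt_trans r1.
have h := ler_wpM2l r0 (cos_le1 x).
have : 0 < (r - 1) ^+ 2 by rewrite exprn_gt0// subr_gt0.
by rewrite (_ : (r - 1) ^+ 2 = r ^+ 2 - 2 * r + 1); [lra|ring].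
Qed.

Lemma link_sqr_gt0 u : 0 < u < 1 -> 0 < link_sqr u.
Proof.
move=> /andP[u0 u1]; have u1' : 0 < 1 - u by rewrite subr_gt0.
by apply: addr_gt0; apply: mulr_gt0 => //; exact: link_end_gt0.
Qed.

(** The hypothesis is that z3 is real, and the left-hand side is Re z3 up to a positive factor. The
    hypothesis amounts to cos (theta - alpha / 2) = r cos (alpha / 2), which reduces it to 1 -
    r^2. *)
Lemma link_dot_lt0 : r ^+ 2 * sin alpha = r * side_sin ->
  r ^+ 2 * cos alpha - r * cos theta - r * cos (alpha - theta) + 1 < 0.
Proof.
rewrite sin_alphaE side_sinE cos_thE cos_athE => h.
have r0 : 0 < r by exact: lt_trans r1.
have BE : B = r * A.
  have rS : r * (2 * S) != 0 by rewrite gt_eqF// mulr_gt0// mulr_gt0.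
  by apply: (mulfI rS); lra.
have -> : cos alpha = A ^+ 2 - S ^+ 2 by rewrite alphaE cosD -/A -/S; ring.
have -> : r ^+ 2 * (A ^+ 2 - S ^+ 2) - r * (B * A - C * S) - r * (A * B + S * C) + 1 =
    1 - r ^+ 2 * (A ^+ 2 + S ^+ 2) by rewrite BE; ring.
by rewrite AS mulr1 subr_lt0 exprn_egt1.
Qed.

End faces.

Section drum_tetrahedra.
Context {R : realType}.
Local Notation mu := (@lebesgue_measure R).

Lemma sqm_expi (x : R) : sqm (expi x) = 1.
Proof. by rewrite /sqm /= cos2Dsin2. Qed.

Lemma sqmR (x : R) : sqm x%:C = x ^+ 2.
Proof. by rewrite /sqm/= expr0n addr0. Qed.

Lemma sqmB (u v : R[i]) : sqm (u - v) =
  sqm u + sqm v - 2 * (complex.Re u * complex.Re v + complex.Im u * complex.Im v).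
Proof. by rewrite /sqm ReD ImD ReN ImN; ring. Qed.

Lemma cross_shear (u v : R[i]) : cross (v - u) (v - u * v) =
  - (sqm v * complex.Im u) - cross u v + sqm u * complex.Im v.
Proof. by rewrite /cross /sqm !ReD !ImD !ReN !ImN ReM ImM; ring. Qed.

Lemma Re_div_shear (u v : R[i]) : complex.Re ((u * v - u) / (v - u)) =
  (sqm v * complex.Re u - sqm u * complex.Re v -
   (complex.Re u * complex.Re v + complex.Im u * complex.Im v) + sqm u) / sqm (v - u).
Proof.
rewrite ReM ReV ImV; move: (sqm (v - u)) => d.
by rewrite !ReD !ImD !ReN !ImN ReM ImM /sqm; ring.
Qed.

Lemma tetra_integrand_continuous z (u : R) : complex.Im z != 0 -> 0 < u < 1 ->
  {for u, continuous (tetra_integrand (R := R) z)}.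
Proof.
move=> y0 u01; have /andP[u0 u1] := u01.
have q0 := ray_q_gt0 z y0 u; have N0 := sqm_gt0 z y0.
have u01' : 0 <= u <= 1 by rewrite !ltW.
have d0 := chord_den_gt0 _ y0 _ u01'.
have n0 : 0 < sqm z * (u * (1 - u)) by rewrite mulr_gt0// mulr_gt0// subr_gt0.
pose g (s : R) := chord_den z s / (sqm z * (s * (1 - s))).
have g0 : 0 < g u by rewrite divr_gt0.
have dg : derivable g u 1.
  apply: derivableM; first exact: ex_derive.
  by apply: derivableV; [rewrite gt_eqF|exact: ex_derive].
have dl := @is_derive1_comp _ (@ln R) g u _ _ (is_derive1_ln g0) (derivableP dg).
have dq : derivable (fun s => complex.Im z / ray_q z s) u 1.
  apply: derivableM; first exact: ex_derive.
  by apply: derivableV; [rewrite gt_eqF|exact: ex_derive].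
have cq := is_derive_continuous _ _ _ (derivableP dq).
have cl := is_derive_continuous _ _ _ dl.
by apply: cvgM; [apply: cvgM; [exact: cvg_cst|exact: cq]|exact: cl].
Qed.

Variables (Li2 : R[i] -> R[i]) (n : nat) (r theta : R).
Hypotheses (HLi2 : is_dilogarithm Li2) (n3 : (3 <= n)%N) (r1 : 1 < r).
Local Notation alpha := (2 * pi / n%:R : R).
Hypotheses (th0 : 0 <= theta) (tha : theta < alpha).

Let a : R[i] := expi alpha.
Let b : R[i] := r%:C * expi theta.
Let m := side_sin n theta.
Let S := chord_sqr (R := R) n.
Let M := link_sqr n r theta.
Let M1 := 1 + r ^+ 2 - 2 * r * cos theta.
Let M0 := 1 + r ^+ 2 - 2 * r * cos (alpha - theta).

Let sqm_a : sqm a = 1. Proof. exact: sqm_expi. Qed.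
Let sqm_b : sqm b = r ^+ 2. Proof. by rewrite sqmM sqmR sqm_expi mulr1. Qed.

Let Re_b : complex.Re b = r * cos theta.
Proof. by rewrite ReM /= mul0r subr0. Qed.
Let Im_b : complex.Im b = r * sin theta.
Proof. by rewrite ImM /= mul0r addr0. Qed.

Let sqm_a1 : sqm (a - 1) = S.
Proof. by rewrite sqmB sqm_a /sqm /= /S /chord_sqr; ring. Qed.
Let sqm_ab : sqm (a - b) = M0.
Proof. by rewrite sqmB sqm_a sqm_b Re_b Im_b /= /M0 cosB; ring. Qed.
Let sqm_1b : sqm (1 - b) = M1.
Proof. by rewrite sqmB sqm_b Re_b Im_b /sqm /= /M1; ring. Qed.

Let sqmC (u v : R[i]) : sqm (u - v) = sqm (v - u).
Proof. by rewrite !sqmB; ring. Qed.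

Let cross2 : cross (a - b) (a - 1) = sin alpha - r * m.
Proof.
rewrite /cross !ReD !ImD !ReN !ImN Re_b Im_b /= /m /side_sin sinB.
by ring.
Qed.

Let cross3 : cross (b - a) (b - a * b) = r * m - r ^+ 2 * sin alpha.
Proof.
rewrite cross_shear.
by rewrite sqm_b sqm_a /cross Re_b Im_b /= /m /side_sin sinB; ring.
Qed.

Let M00 : 0 < M0. Proof. exact: link_end_gt0. Qed.

Let v20 : a - b != 0.
Proof.
by apply/eqP => h; move: M00; rewrite -sqm_ab h /sqm/= expr0n/= addr0 ltxx.
Qed.

Let v30 : b - a != 0.
Proof. by rewrite -opprB oppr_eq0. Qed.

(* The inverse of the edge parameter z2, and 1 - z3. *)
Let Z2 := (a - 1) / (a - b).
Let Z3 := (b - a * b) / (b - a).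
(** The numerator of Im z3: it vanishes exactly when z3 is real, that is when tau_3 is flat. *)
Let kappa := r ^+ 2 * sin alpha - r * m.

Let Im_Z2 : complex.Im Z2 != 0.
Proof.
have c0 : sin alpha - r * m != 0 by rewrite lt_eqF// subr_lt0; exact: sin_alpha_lt.
by rewrite Im_div cross2 sqm_ab mulf_neq0// invr_eq0 gt_eqF.
Qed.

Let Im_Z3 : complex.Im Z3 = - kappa / M0.
Proof. by rewrite Im_div cross3 sqmC sqm_ab /kappa opprB. Qed.

Let h u : R := u * (1 - u) * S.

(** The difference is |a - b|^2 times [ray_q Z2 u]. It excludes one of the vanishing denominators in
    [integral_rational]. *)
Let den2 u : 0 < M u - h u.
Proof.
have := ray_q_gt0 _ Im_Z2 u; rewrite ray_q_div// sqm_comb.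
rewrite pmulr_lgt0 ?invr_gt0 ?sqm_ab// sqm_a1.
have -> : a - b - (a - 1) = 1 - b by ring.
by rewrite sqm_1b.
Qed.

Let sqm_p3 : sqm (b - a * b) = r ^+ 2 * S.
Proof.
have -> : b - a * b = b * (1 - a) by ring.
by rewrite sqmM sqm_b sqmC sqm_a1.
Qed.

Let sqm_vp3 : sqm (b - a - (b - a * b)) = M1.
Proof.
have -> : b - a - (b - a * b) = a * (b - 1) by ring.
by rewrite sqmM sqm_a mul1r sqmC sqm_1b.
Qed.

Let den3 u : kappa != 0 -> 0 < M u - r ^+ 2 * h u.
Proof.
move=> k0; have Z30 : complex.Im Z3 != 0.
  by rewrite Im_Z3 mulf_eq0 oppr_eq0 invr_eq0 negb_or k0 gt_eqF.
have := ray_q_gt0 _ Z30 u; rewrite ray_q_div// sqm_comb.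
rewrite pmulr_lgt0; last by rewrite invr_gt0 -(sqmC a b) sqm_ab.
rewrite sqm_p3 sqm_vp3.
congr (0 < _); rewrite -(sqmC a b) sqm_ab /h /M /link_sqr -/M1 -/M0; ring.
Qed.

Definition drum_integrand u := tetra_integrand Z2 u + tetra_integrand Z3 u.

Let S0 : 0 < S. Proof. exact: chord_sqr_gt0. Qed.
Let h_gt0 u : 0 < u < 1 -> 0 < h u.
Proof.
by move=> /andP[u0 u1]; apply: mulr_gt0 => //; apply: mulr_gt0; rewrite ?subr_gt0.
Qed.

Let r0 : 0 < r. Proof. exact: r_gt0. Qed.

Let drum_integrandE u : 0 < u < 1 -> drum_integrand u =
  (1 / 2) * ((r * m - sin alpha) / (M u - h u) * (ln (M u) - ln (h u)) +
    kappa / (M u - r ^+ 2 * h u) * (ln (M u) - ln (r ^+ 2) - ln (h u))).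
Proof.
move=> u01; have h0 := h_gt0 _ u01; have m0 := link_sqr_gt0 n r theta r1 _ u01.
have r20 : 0 < r ^+ 2 by rewrite exprn_gt0.
rewrite /drum_integrand /Z2 /Z3 !tetra_integrand_div// sqm_p3 sqm_vp3 sqm_a1.
have -> : a - b - (a - 1) = 1 - b by ring.
rewrite sqm_1b sqm_ab -(sqmC a b) sqm_ab cross2 cross3.
rewrite -[u * M1 + _]/(M u) -[u * (1 - u) * S]/(h u).
have -> : u * (1 - u) * (r ^+ 2 * S) = r ^+ 2 * h u by rewrite /h; ring.
have -> : S * (u * (1 - u)) = h u by rewrite /h; ring.
have -> : r ^+ 2 * S * (u * (1 - u)) = r ^+ 2 * h u by rewrite /h; ring.
have rh : 0 < r ^+ 2 * h u by exact: mulr_gt0.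
have m0' : 0 < M u by exact: m0.
rewrite (ln_div m0' h0) (ln_div m0' rh) (lnM r20 h0).
rewrite /kappa; move: (M u - h u)^-1 (M u - r ^+ 2 * h u)^-1 => x y.
by ring.
Qed.

Let hC u : h (1 - u) = h u. Proof. by rewrite /h; ring. Qed.

Let p0 : 0 < sin alpha. Proof. exact: sin_alpha_gt0. Qed.
Let p1 : sin alpha < r * m. Proof. exact: sin_alpha_lt. Qed.

(** In [integral_rational] the first denominator is positive by [den2]; the second can vanish only
    if kappa = 0 by [den3], and then so does its numerator. *)
Lemma face1_inner u : 0 < u < 1 ->
  (\int[mu]_(t in `]1%R, r[)
    (face_density (face1_x n r theta) (face1_lo n r theta) (face1_hi n r theta) u t)%:E =
  ((1 / 2) * drum_integrand (1 - u))%:E)%E.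
Proof.
move=> u01; have u01' : 0 < 1 - u < 1 by case/andP: u01 => *; apply/andP; split; lra.
have h0 := h_gt0 _ u01; have m0 := link_sqr_gt0 n r theta r1 _ u01'.
have d2 := den2 (1 - u); rewrite hC in d2.
transitivity (\int[mu]_(t in `]1%R, r[)
  (affine_ratio r (sin alpha) (r * m) (h u) (M (1 - u)) t)%:E)%E.
  apply: eq_integral => t /set_mem/=; rewrite in_itv/= => t1r.
  by rewrite face1_density.
rewrite (integral_rational r (sin alpha) (r * m) (h u) (M (1 - u))) //.
- rewrite drum_integrandE// hC; congr EFin.
  by rewrite mulrA (_ : 1 / 2 * (1 / 2) = 1 / 4)//; field.
- by move=> e; rewrite e subrr ltxx in d2.
- move=> e; apply/eqP; rewrite eq_sym -subr_eq0; apply: contraT => k0.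
  by have := den3 (1 - u) k0; rewrite hC e subrr ltxx.
Qed.

Lemma face2_inner u : 0 < u < 1 ->
  (\int[mu]_(t in `]1%R, r[)
    (face_density (face2_x n r theta) (face2_lo n r theta) (face2_hi n r theta) u t)%:E =
  ((1 / 2) * drum_integrand u)%:E)%E.
Proof.
move=> u01; have h0 := h_gt0 _ u01; have m0 := link_sqr_gt0 n r theta r1 _ u01.
have d2 := den2 u; have r20 : 0 < r ^+ 2 by rewrite exprn_gt0.
transitivity (\int[mu]_(t in `]1%R, r[)
  (affine_ratio r (r * m) (r ^+ 2 * sin alpha) (M u) (r ^+ 2 * h u) t)%:E)%E.
  apply: eq_integral => t /set_mem/=; rewrite in_itv/= => t1r.
  by rewrite face2_density.
have rh : 0 < r ^+ 2 * h u by rewrite mulr_gt0.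
rewrite (integral_rational r (r * m) (r ^+ 2 * sin alpha) (M u) (r ^+ 2 * h u)) //.
- rewrite drum_integrandE//; congr EFin.
  rewrite (lnM r20 h0).
  have -> : r ^+ 2 * (r * m) - r ^+ 2 * sin alpha = (- r ^+ 2) * (sin alpha - r * m).
    by ring.
  have -> : r ^+ 2 * h u - r ^+ 2 * M u = (- r ^+ 2) * (M u - h u) by ring.
  rewrite -[_ / (- r ^+ 2 * _)]mulf_div divff ?mul1r; last by rewrite oppr_eq0 gt_eqF.
  rewrite -[r ^+ 2 * h u - M u]opprB invrN -/kappa.
  move: (M u - h u)^-1 (M u - r ^+ 2 * h u)^-1 => x y.
  by rewrite /kappa; field.
- move=> e; apply/eqP; rewrite -subr_eq0; apply: contraT => k0.
  by have := den3 u k0; rewrite e subrr ltxx.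
- move=> /(mulfI (lt0r_neq0 r20)) e.
  by rewrite e subrr ltxx in d2.
Qed.

(** In the flat case the integrand of [Z3] is identically 0 while [ray_D] is studied only off the
    real axis; the primitive is then taken to be 0. *)
Let prim3 u := if kappa == 0 then 0 else tetra_primitive Li2 Z3 u.
Let prim u := tetra_primitive Li2 Z2 u + prim3 u.

Let Z30 : kappa != 0 -> complex.Im Z3 != 0.
Proof. by move=> k0; rewrite Im_Z3 mulf_eq0 oppr_eq0 invr_eq0 negb_or k0 gt_eqF. Qed.

Let integrand3_0 u : kappa = 0 -> tetra_integrand Z3 u = 0.
Proof. by move=> k0; rewrite /tetra_integrand Im_Z3 k0 oppr0 !mul0r mulr0 mul0r. Qed.

Let prim_derive (u : R) : 0 < u < 1 -> is_derive u 1 prim (drum_integrand u).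
Proof.
move=> u01; apply: is_deriveD; first exact: is_derive_tetra_primitive.
rewrite /prim3; have [k0|k0] := eqVneq kappa 0; last first.
  by apply: is_derive_tetra_primitive => //; exact: Z30.
by rewrite integrand3_0//; exact: is_derive_cst.
Qed.

Let prim_continuous (u : R) : 0 <= u <= 1 -> {for u, continuous prim}.
Proof.
move=> u01; apply: cvgD; first exact: tetra_primitive_continuous.
rewrite /prim3; have [k0|k0] := eqVneq kappa 0; first exact: cvg_cst.
by apply: tetra_primitive_continuous => //; exact: Z30.
Qed.

Let integrand_continuous (u : R) : 0 < u < 1 -> {for u, continuous drum_integrand}.
Proof.
move=> u01; apply: cvgD; first exact: tetra_integrand_continuous.
have [k0|k0] := eqVneq kappa 0; last first.
  by apply: tetra_integrand_continuous => //; exact: Z30.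
rewrite (_ : tetra_integrand Z3 = fun=> 0); first exact: cvg_cst.
by apply/funext => s; exact: integrand3_0.
Qed.

(** The two summands show no sign, but half of their sum is the inner integral of a nonnegative
    density by [face2_inner]. *)
Let integrand_ge0 u : 0 < u < 1 -> 0 <= drum_integrand u.
Proof.
move=> u01; suff : (0 <= ((1 / 2) * drum_integrand u)%:E)%E by rewrite lee_fin pmulr_rge0.
rewrite -face2_inner//; apply: integral_ge0 => t; rewrite /= in_itv/= => t1r.
have h0 := h_gt0 _ u01; have m0 := link_sqr_gt0 n r theta r1 _ u01.
have /andP[t1 tr] := t1r; have r20 : 0 < r ^+ 2 by rewrite exprn_gt0.
rewrite face2_density// lee_fin /affine_ratio.
have s0 : 0 <= level r (t ^+ 2) by rewrite level_ge0// exprn_ege1// ltW.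
have s1 : 0 <= 1 - level r (t ^+ 2).
  rewrite subr_ge0 level_le1// -subr_ge0 subr_sqr; apply: mulr_ge0; lra.
rewrite -[(_ - 1) / (_ - 1)]/(level r (t ^+ 2)).
have t0 : 0 <= 2 * t by lra.
have q1 : 0 <= r * side_sin n theta by apply: ltW; exact: lt_trans p1.
have q2 : 0 <= r ^+ 2 * sin alpha by rewrite mulr_ge0// ltW.
have q3 : 0 <= r ^+ 2 * (u * (1 - u) * chord_sqr n) by apply: mulr_ge0; exact: ltW.
by apply: divr_ge0; [|apply: mulr_ge0 => //]; apply: addr_ge0;
  apply: mulr_ge0 => //; exact: ltW.
Qed.

Lemma drum_integral (c : bool) :
  (\int[mu]_(u in `]0%R, 1%R[)
    ((1 / 2) * drum_integrand (if c then 1 - u else u))%:E =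
  ((1 / 2) * (prim 1 - prim 0))%:E)%E.
Proof.
case: c.
  transitivity ((- (1 / 2) * prim (1 - 1) - - (1 / 2) * prim (1 - 0))%:E); last first.
    by congr EFin; rewrite subrr subr0; ring.
  apply: (ge0_integral_oo (fun u => - (1 / 2) * prim (1 - u))
    (fun u => (1 / 2) * drum_integrand (1 - u))).
  - move=> u u01; have u01' : 0 < 1 - u < 1.
      by case/andP: u01 => *; apply/andP; split; lra.
    have dr : is_derive u 1 (fun s : R => 1 - s) (0 - 1) by apply: is_deriveB.
    have h2 := @is_derive1_comp _ prim (fun s : R => 1 - s) u _ _ (prim_derive _ u01') dr.
    have h3 : is_derive u 1 (fun u => - (1 / 2) * prim (1 - u))
        (- (1 / 2) *: (drum_integrand (1 - u) * (0 - 1))) by apply: is_deriveZ.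
    apply: (@is_derive_eq _ _ _ _ _ _ _ _ h3).
    by rewrite /GRing.scale/=; ring.
  - move=> u u01; apply: mulr_ge0 => //; apply: integrand_ge0.
    by case/andP: u01 => *; apply/andP; split; lra.
  - move=> u u01; have u01' : 0 < 1 - u < 1.
      by case/andP: u01 => *; apply/andP; split; lra.
    have dr : is_derive u 1 (fun s : R => 1 - s) (0 - 1) by apply: is_deriveB.
    apply: cvgM; first exact: cvg_cst.
    exact: (@continuous_comp _ _ _ (fun s : R => 1 - s) drum_integrand u
      (is_derive_continuous _ _ _ dr) (integrand_continuous _ u01')).
  - move=> u u01; have u01' : 0 <= 1 - u <= 1.
      by case/andP: u01 => *; apply/andP; split; lra.
    have dr : is_derive u 1 (fun s : R => 1 - s) (0 - 1) by apply: is_deriveB.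
    apply: cvgM; first exact: cvg_cst.
    exact: (@continuous_comp _ _ _ (fun s : R => 1 - s) prim u
      (is_derive_continuous _ _ _ dr) (prim_continuous _ u01')).
rewrite mulrBr.
apply: (ge0_integral_oo (fun u => (1 / 2) * prim u) (fun u => (1 / 2) * drum_integrand u)).
- by move=> u u01; apply: is_deriveZ; exact: prim_derive.
- by move=> u u01; apply: mulr_ge0 => //; exact: integrand_ge0.
- by move=> u u01; apply: cvgM; [exact: cvg_cst|exact: integrand_continuous].
- by move=> u u01; apply: cvgM; [exact: cvg_cst|exact: prim_continuous].
Qed.

(** Each primitive goes from D / 2 to - D / 2, and the symmetries z to 1 / z and z to 1 - z absorb
    the signs. In the flat case the tau_3 term is 0, as z3 is a negative real. *)
Lemma prim_diff : prim 1 - prim 0 =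
  tetra_volume Li2 ((a - b) / (a - 1)) +
  tetra_volume Li2 ((r%:C * expi (alpha + theta) - a) / (b - a)).
Proof.
have -> : r%:C * expi (alpha + theta) = a * b by rewrite expiD /a /b; ring.
have e2 : tetra_volume Li2 ((a - b) / (a - 1)) = - tetra_volume Li2 Z2.
  by rewrite -tetra_volume_inv// /Z2 invf_div.
have e3 : (a * b - a) / (b - a) = 1 - Z3.
  by rewrite /Z3 -{1}(divff v30) -mulrBl; congr (_ / _); ring.
rewrite e2 e3 /prim /prim3 tetra_primitive0// tetra_primitive1// -tetra_volume_ray//.
have [k0|k0] := eqVneq kappa 0; last first.
  rewrite tetra_volume_sub1 ?Z30// tetra_primitive0 ?Z30// tetra_primitive1 ?Z30//.
  by rewrite -tetra_volume_ray ?Z30//; field.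
rewrite -e3 (tetra_volume_neg_real Li2 HLi2 ((a * b - a) / (b - a))) ?addr0; first by field.
  by rewrite e3 ImD ImN Im_Z3 k0 oppr0 mul0r /= subr0.
have kE : r ^+ 2 * sin alpha = r * m by apply/eqP; rewrite -subr_eq0; apply/eqP.
have := link_dot_lt0 n r theta n3 r1 kE.
set d := _ + 1 => d0.
have -> : complex.Re ((a * b - a) / (b - a)) = d / M0.
  rewrite Re_div_shear -(sqmC a b) sqm_ab sqm_a sqm_b Re_b Im_b /d cosB /=.
  by congr (_ / _); ring.
by rewrite pmulr_llt0 ?invr_gt0.
Qed.

Lemma drum_faces_volume :
  (face_volume r (face1_x n r theta) (face1_lo n r theta) (face1_hi n r theta) +
   face_volume r (face2_x n r theta) (face2_lo n r theta) (face2_hi n r theta) =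
  (tetra_volume Li2 ((a - b) / (a - 1)) +
   tetra_volume Li2 ((r%:C * expi (alpha + theta) - a) / (b - a)))%:E)%E.
Proof.
have e1 : face_volume r (face1_x n r theta) (face1_lo n r theta) (face1_hi n r theta) =
    ((1 / 2) * (prim 1 - prim 0))%:E.
  rewrite -(drum_integral true); apply: eq_integral => u /set_mem/=.
  by rewrite in_itv/= => u01; rewrite face1_inner.
have e2 : face_volume r (face2_x n r theta) (face2_lo n r theta) (face2_hi n r theta) =
    ((1 / 2) * (prim 1 - prim 0))%:E.
  rewrite -(drum_integral false); apply: eq_integral => u /set_mem/=.
  by rewrite in_itv/= => u01; rewrite face2_inner.
by rewrite e1 e2 -prim_diff -EFinD; congr EFin; field.
Qed.

End drum_tetrahedra.

Theorem theorem1 (R : realType) (Li2 : R[i] -> R[i]) (n : nat) (r theta : R)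
    (D : set (hspace R)) :
  is_dilogarithm Li2 ->
  (3 <= n)%N -> 1 < r -> 0 <= theta < 2 * pi / n%:R ->
  is_drum n r theta D ->
  let alpha : R := 2 * pi / n%:R in
  let z2 : R[i] :=
    (expi alpha - r%:C * expi theta) / (expi alpha - 1) in
  let z3 : R[i] :=
    (r%:C * expi (alpha + theta) - expi alpha)
    / (r%:C * expi theta - expi alpha) in
  hvolume D =
    (n%:R * (tetra_volume Li2 z2 + tetra_volume Li2 z3))%:E.
Proof.
move=> HLi2 n3 r1 /andP[th0 tha] drumD alpha z2 z3.
by rewrite (drum_volume n r theta n3 r1 th0 tha D drumD) (drum_faces_volume Li2).
Qed.
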